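(* Let $d\ge1$ be an integer and let $\alpha\in\mathbb{R}$. Then the following conditions are equivalent: (1) $\alpha<d+2$; (2) there exist $1\le p,q\le\infty$ such that $K_\alpha:L^p\to L^q$ is bounded; (3) there exist $1\le p,q\le\infty$ such that $K_\alpha^+:L^p\to L^q$ is bounded; (4) there exist $1\le p,q\le\infty$ such that $K_\alpha:L^p\to L^q$ is compact.
   Context: $\mathbb{B}^d$ is the open unit ball of $\mathbb{C}^d$ with Lebesgue measure $dv$ normalized so that $v(\mathbb{B}^d)=1$; $\langle z,w\rangle=\sum_j z_j\overline{w_j}$; $L^p=L^p(\mathbb{B}^d,dv)$. For $\alpha\in\mathbb{R}$ and $f\in L^1(\mathbb{B}^d,dv)$, $$K_\alpha f(z)=\int_{\mathbb{B}^d}\frac{f(w)}{(1-\langle z,w\rangle)^\alpha}\,dv(w),\qquad K_\alpha^+f(z)=\int_{\mathbb{B}^d}\frac{f(w)}{|1-\langle z,w\rangle|^\alpha}\,dv(w),\qquad z\in\mathbb{B}^d$$ (principal branch of the power). *)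

(* Defs.v *)
From HB Require Import structures.
From mathcomp Require Import all_boot all_order all_algebra.
From mathcomp Require Import all_classical all_reals all_analysis.
From mathcomp Require Import complex.

Set Implicit Arguments.
Unset Strict Implicit.
Unset Printing Implicit Defensive.

Import Order.TTheory GRing.Theory Num.Theory.
Import ComplexField.Normc.
Import numFieldNormedType.Exports.

Local Open Scope classical_set_scope.
Local Open Scope ring_scope.
Local Open Scope complex_scope.

Section pushforward_iso.
Local Open Scope ereal_scope.
Context d1 d2 (T1 : measurableType d1) (T2 : measurableType d2) (R : realType).
Variables (m : {measure set T1 -> \bar R}) (f : T1 -> T2) (g : T2 -> T1).
Hypotheses (m_fin : sigma_finite setT m) (mf : measurable_fun setT f).
Hypotheses (mg : measurable_fun setT g) (fK : cancel f g).

(* [pushforward m f] as a sigma-finite measure; the side conditions are carried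
   along only so that canonical structures can be inferred. *)
Definition pushforward_iso of sigma_finite setT m & measurable_fun setT f
    & measurable_fun setT g & cancel f g : set T2 -> \bar R :=
  pushforward m f.

Local Notation mf_ := (pushforward_iso m_fin mf mg fK).

Let pushforward0 : mf_ set0 = 0.
Proof. by rewrite /pushforward_iso /pushforward preimage_set0 measure0. Qed.

Let pushforward_ge0 A : 0 <= mf_ A.
Proof. exact: measure_ge0. Qed.

Let pushforward_sigma_additive : semi_sigma_additive mf_.
Proof. exact: (@measure_semi_sigma_additive _ _ _ (pushforward m f)). Qed.

HB.instance Definition _ := isMeasure.Build _ _ _ mf_
  pushforward0 pushforward_ge0 pushforward_sigma_additive.

Let pushforward_sigma_finite : sigma_finite setT mf_.
Proof.
have [F TF mF] := m_fin; exists (fun n => g @^-1` F n).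
  by rewrite -preimage_bigcup -TF preimage_setT.
move=> k; have [mFk Fkoo] := mF k; split.
  by rewrite -[X in measurable X]setTI; exact: mg.
rewrite /pushforward_iso /pushforward -comp_preimage.
by rewrite (_ : g \o f = idfun)//; exact/funext.
Qed.

HB.instance Definition _ := Measure_isSigmaFinite.Build _ _ _ mf_
  pushforward_sigma_finite.

End pushforward_iso.

Lemma sigma_finite_product d1 d2 (T1 : measurableType d1)
    (T2 : measurableType d2) (R : realType)
    (m1 : {sigma_finite_measure set T1 -> \bar R})
    (m2 : {sigma_finite_measure set T2 -> \bar R}) :
  sigma_finite setT (m1 \x m2)%E.
Proof.
have /sigma_finiteP[F [TF ndF Foo]] := sigma_finiteT m1.
have /sigma_finiteP[G [TG ndG Goo]] := sigma_finiteT m2.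
exists (fun n => F n `*` G n).
  rewrite -setXTT TF TG predeqE => -[x y]; split.
    move=> [/= [n _ Fnx] [k _ Gky]]; exists (maxn n k) => //; split.
    - by move: x Fnx; exact/subsetPset/ndF/leq_maxl.
    - by move: y Gky; exact/subsetPset/ndG/leq_maxr.
  by move=> [n _ []/= ? ?]; split; exists n.
move=> k; have [? ?] := Foo k; have [? ?] := Goo k.
split; first exact: measurableX.
by rewrite product_measure1E// lte_mul_pinfty// ge0_fin_numE.
Qed.

Section lebesgue_Cn.
Variable R : realType.

Definition ReIm (z : R[i]) : measurableTypeR R * measurableTypeR R :=
  (complex.Re z, complex.Im z).

Definition mkcomplex (p : measurableTypeR R * measurableTypeR R) : R[i] :=
  p.1 +i* p.2.

Lemma mkcomplexK : cancel mkcomplex ReIm.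
Proof. by case. Qed.

End lebesgue_Cn.

HB.instance Definition _ (R : realType) := isPointed.Build R[i] 0.

(* The Borel sigma-algebra of R[i], transported from R * R. *)
HB.instance Definition _ (R : realType) :=
  Measurable.copy R[i] (g_sigma_algebra_preimageType (@ReIm R)).

Section lebesgue_Cn.
Variable R : realType.

Lemma measurable_mkcomplex : measurable_fun setT (@mkcomplex R).
Proof.
move=> _ _ [B mB <-]; rewrite !setTI -comp_preimage.
by rewrite (_ : _ \o _ = idfun)//; apply/funext => -[].
Qed.

Lemma measurable_ReIm : measurable_fun setT (@ReIm R).
Proof. by move=> _ B mB; rewrite setTI; exists B => //; rewrite setTI. Qed.

Definition lebesgue_C : {sigma_finite_measure set R[i] -> \bar R} :=
  pushforward_iso
    (sigma_finite_product (@lebesgue_measure R) (@lebesgue_measure R))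
    measurable_mkcomplex measurable_ReIm (@mkcomplexK R).

Lemma lebesgue_C_rectangle (A B : set (measurableTypeR R)) :
  measurable A -> measurable B ->
  lebesgue_C [set z | A (complex.Re z) /\ B (complex.Im z)] =
  (lebesgue_measure A * lebesgue_measure B)%E.
Proof.
by move=> mA mB; rewrite -product_measure1E.
Qed.

Definition consC n (p : R[i] * n.-tuple R[i]) : n.+1.-tuple R[i] :=
  [tuple of p.1 :: p.2].

Definition unconsC n (t : n.+1.-tuple R[i]) : R[i] * n.-tuple R[i] :=
  (thead t, [tuple of behead t]).

Lemma consCK n : cancel (@consC n) (@unconsC n).
Proof. by move=> [z t]; congr (_, _) => /=; exact: val_inj. Qed.

Lemma measurable_consC n : measurable_fun setT (@consC n).
Proof. exact: measurable_cons. Qed.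

Lemma measurable_unconsC n : measurable_fun setT (@unconsC n).
Proof.
by apply: measurable_fun_pair; [exact: measurable_tnth|exact: measurable_behead].
Qed.

(* Lebesgue measure on C^n, as an iterated product measure. *)
Fixpoint lebesgue_Cn n : {sigma_finite_measure set (n.-tuple R[i]) -> \bar R} :=
  if n is n'.+1 then
    pushforward_iso (sigma_finite_product lebesgue_C (lebesgue_Cn n'))
      (@measurable_consC n') (@measurable_unconsC n') (@consCK n')
  else \d_ [tuple].

Lemma lebesgue_Cn_box n (A : 'I_n -> set R[i]) :
  (forall i, measurable (A i)) ->
  measurable [set z : n.-tuple R[i] | forall i, A i (tnth z i)] /\
  lebesgue_Cn n [set z | forall i, A i (tnth z i)] =
  (\prod_(i < n) lebesgue_C (A i))%E.
Proof.
elim: n A => [|n IH] A mA.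
  rewrite (_ : [set z | _] = setT) ?big_ord0; last first.
    by apply/seteqP; split => // z _ [].
  by split; [exact: measurableT|rewrite /= diracT].
have [mB IHB] := IH (fun i => A (lift ord0 i)) (fun i => mA _).
have E : [set z : n.+1.-tuple R[i] | forall i, A i (tnth z i)] =
    @unconsC n @^-1`
      (A ord0 `*` [set z | forall i, A (lift ord0 i) (tnth z i)]).
  apply/seteqP; split => z /=.
    move=> Az; split; first exact: Az.
    by move=> i /=; rewrite tnth_behead -(lift0 i) (inord_val _) ; exact: Az.
  move=> [A0 A1] i; case: (unliftP ord0 i) => [j|] ->; last exact: A0.
  by move: (A1 j); rewrite tnth_behead -(lift0 j) inord_val.
split.
  rewrite E -[X in measurable X]setTI.
  by apply: measurable_unconsC => //; exact: measurableX.
rewrite big_ord_recl -IHB -product_measure1E// E /=.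
rewrite /pushforward_iso /pushforward -comp_preimage.
congr product_measure1.
rewrite (_ : _ \o _ = idfun)//; apply/funext => p; exact: consCK.
Qed.

End lebesgue_Cn.

Section complex_power.
Variable R : realType.

(* Principal argument, in ]-pi, pi]. *)
Definition carg (z : R[i]) : R :=
  if 0 <= complex.Im z then acos (complex.Re z / normc z)
  else - acos (complex.Re z / normc z).

Definition clog (z : R[i]) : R[i] := ln (normc z) +i* carg z.

Definition cexp (z : R[i]) : R[i] :=
  (expR (complex.Re z))%:C * (cos (complex.Im z) +i* sin (complex.Im z)).

(* Principal branch of z^a; only meaningful for z <> 0. *)
Definition cpow (z : R[i]) (a : R) : R[i] := cexp (a%:C * clog z).

End complex_power.

Section unit_ball.
Variables (R : realType) (d : nat).
Local Notation Cd := (d.-tuple R[i]).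

Definition cinner (z w : Cd) : R[i] :=
  \sum_(j < d) tnth z j * (tnth w j)^*.

Definition unit_ball : set Cd := [set z | \sum_(j < d) normc (tnth z j) ^+ 2 < 1].

Lemma ball_scale_ge0 : 0 <= (fine (lebesgue_Cn R d unit_ball))^-1.
Proof. by rewrite invr_ge0 fine_ge0. Qed.

(* Lebesgue measure on C^d, scaled so that the unit ball has measure 1.  Functions
   on the ball are represented by functions on C^d of which only the values on
   [unit_ball] matter. *)
Definition vol : {measure set Cd -> \bar R} :=
  mscale (NngNum ball_scale_ge0) (lebesgue_Cn R d).

Definition cintegral (f : Cd -> R[i]) : R[i] :=
  (\int[vol]_(w in unit_ball) complex.Re (f w)) +i*
  (\int[vol]_(w in unit_ball) complex.Im (f w)).

Definition ball_norm (p : \bar R) (f : Cd -> R[i]) : \bar R :=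
  'N[vol]_p[(fun z => (normc (f z))%:E) \_ unit_ball]%E.

(* Membership in L^p of the ball, elements being functions rather than classes. *)
Definition in_Lp (p : \bar R) (f : Cd -> R[i]) : Prop :=
  measurable_fun unit_ball f /\ (ball_norm p f < +oo)%E.

Definition K (alpha : R) (f : Cd -> R[i]) (z : Cd) : R[i] :=
  cintegral (fun w => f w / cpow (1 - cinner z w) alpha).

Definition Kplus (alpha : R) (f : Cd -> R[i]) (z : Cd) : R[i] :=
  cintegral (fun w => f w / (normc (1 - cinner z w) `^ alpha)%:C).

Definition bounded_Lp (p q : \bar R) (T : (Cd -> R[i]) -> (Cd -> R[i])) : Prop :=
  exists M : R, forall f, in_Lp p f ->
    in_Lp q (T f) /\ (ball_norm q (T f) <= M%:E * ball_norm p f)%E.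

(* Compact operator: bounded sequences have images with L^q-convergent subsequences. *)
Definition compact_Lp (p q : \bar R) (T : (Cd -> R[i]) -> (Cd -> R[i])) : Prop :=
  (forall f, in_Lp p f -> in_Lp q (T f)) /\
  forall (u : nat -> (Cd -> R[i])) (M : R),
    (forall n, in_Lp p (u n) /\ (ball_norm p (u n) <= M%:E)%E) ->
    exists (phi : nat -> nat) (g : Cd -> R[i]),
      {homo phi : m n / (m < n)%N} /\ in_Lp q g /\
      ball_norm q (T (u (phi n)) \- g) @[n --> \oo] --> 0%E.

End unit_ball.

(* Main.v *)
(* Everything is tested on the pair p = +oo, q = 1.  If alpha < d + 2, then
   |1 - <z, w>|^(-alpha) is integrable on the product of two balls, because the set
   |1 - <z, w>| <= t has measure O(t^(d+2)) there.  Hence K and K^+ map L^oo to L^1.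
   For compactness, a diagonal subsequence of K u_n converges at all rational points
   of the ball, hence everywhere by continuity of the kernel in z, and dominated
   convergence gives convergence in L^1.

   Conversely let alpha >= d + 2.  The shell 1 - |z|^2 ~ s^2 has measure ~ s^2 and is
   cut into O(s^(-2d)) cells in which 1 - <z, w> is of size s^2 and almost a positive
   real number, so that the real part of the kernel is at least c s^(-2 alpha) on the
   square of each cell.  By Cauchy-Schwarz, the diagonal blocks of the quadratic form
   of K contribute at least c s^(-2 alpha) (s^2)^2 s^(2d) >= c at every level s = 2^(-k).
   With suitable signs on the cells the off-diagonal blocks contribute a nonnegative
   amount, so the form is unbounded on functions with values in [-1, 1], and K maps a
   bounded subset of L^oo to an unbounded subset of L^1.  The same holds for K^+. *)

Require Import Defs.
From HB Require Import structures.
From mathcomp Require Import all_boot all_order all_algebra.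
From mathcomp Require Import all_classical all_reals all_analysis.
From mathcomp Require Import measurable_realfun ess_sup_inf complex.
From mathcomp Require Import ring lra.

Set Implicit Arguments.
Unset Strict Implicit.
Unset Printing Implicit Defensive.

Import Order.TTheory GRing.Theory Num.Theory.
Import ComplexField.Normc.
Import numFieldNormedType.Exports.

Local Open Scope classical_set_scope.
Local Open Scope ring_scope.

(** * Lebesgue measure on C^n: dilations and slices *)

(** The pair (oo, 1) decides all others because the ball has measure 1: a function bounded by 1 lies
    in the unit ball of every L^p, and a bound in L^q gives one in L^1. The exponent d + 2 is a
    count of dimensions: for fixed z one complex coordinate of w is confined to size t and the d - 1
    others to size sqrt t, which gives t^(d+1), and z itself must lie in a shell of measure O(t).
    The obstacle in the converse is oscillation. For instance K 1 = 1 for every alpha, so constants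
    do not detect the singularity, and the kernel is only controlled from below where u = 1 - <z, w>
    satisfies |Im u| <= eps Re u. In a cell of diameter of order s one has Re u ~ s^2, but Im u is
    in general of order s; hence one more subdivision along Im <z, b> is required. At the critical
    exponent a single level gains only a constant, so many disjoint levels have to be combined, and
    the signs must control the interaction between levels as well as between cells. *)

Section scaled_measures.
Context d (T : measurableType d) (R : realType).
Local Open Scope ereal_scope.

Definition scales (m : set T -> \bar R) (f : T -> T) (c : R) :=
  [/\ measurable_fun setT f, (0 < c)%R &
      forall A, measurable A -> m (f @^-1` A) = c%:E * m A].

End scaled_measures.

(** Uniqueness of the product measure: the pushforward under the product map, divided by c1 c2, has
    the right value on rectangles. *)
Lemma scales_prod d1 d2 (T1 : measurableType d1) (T2 : measurableType d2)
    (R : realType) (m1 : {sigma_finite_measure set T1 -> \bar R})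
    (m2 : {sigma_finite_measure set T2 -> \bar R}) f1 f2 (c1 c2 : R) :
  scales m1 f1 c1 -> scales m2 f2 c2 ->
  scales (m1 \x m2)%E (fun p => (f1 p.1, f2 p.2)) (c1 * c2).
Proof.
move=> [mf1 c10 f1E] [mf2 c20 f2E].
have c0 : 0 < c1 * c2 by rewrite mulr_gt0.
pose f := fun p : T1 * T2 => (f1 p.1, f2 p.2).
have mf : measurable_fun setT f.
  by apply: measurable_fun_pair => /=; apply: measurableT_comp.
split=> // X mX.
pose g : {mfun (T1 * T2)%type >-> (T1 * T2)%type} :=
  HB.pack f (isMeasurableFun.Build _ _ _ _ f mf).
have ci0 : 0 <= (c1 * c2)^-1 by rewrite invr_ge0 ltW.
rewrite (@product_measure_unique _ _ _ _ _ m1 m2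
  (mscale (NngNum ci0) (pushforward (m1 \x m2)%E g)) _ X mX); last first.
  move=> A B mA mB; rewrite /= /mscale /=.
  have -> : pushforward (m1 \x m2)%E g (A `*` B) =
      (m1 \x m2)%E ((f1 @^-1` A) `*` (f2 @^-1` B)) by [].
  have m1A : measurable (f1 @^-1` A) by rewrite -[X in measurable X]setTI; exact: mf1.
  have m2B : measurable (f2 @^-1` B) by rewrite -[X in measurable X]setTI; exact: mf2.
  rewrite product_measure1E//; move: (f1E _ mA) (f2E _ mB) => /= -> ->.
  rewrite muleACA -EFinM [LHS]muleA -EFinM.
  by rewrite mulVf ?gt_eqF// mul1e.
by rewrite /= /mscale /= /pushforward muleA -EFinM mulfV ?gt_eqF// mul1e.
Qed.

(** Uniqueness of Lebesgue measure: the pushforward under x -> r x, multiplied by r, gives each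
    interval ]a, b] its length. *)
Lemma scales_lebesgue_measure (R : realType) (r : R) : 0 < r ->
  scales (@lebesgue_measure R) (fun x => r * x : measurableTypeR R) r^-1.
Proof.
move=> r0.
have mf : measurable_fun setT (fun x : measurableTypeR R => r * x : measurableTypeR R).
  by apply: measurable_funM.
split=> //; first by rewrite invr_gt0.
move=> A mA.
pose g : {mfun measurableTypeR R >-> measurableTypeR R} :=
  HB.pack (fun x : measurableTypeR R => r * x : measurableTypeR R)
   (isMeasurableFun.Build _ _ _ _ (fun x : measurableTypeR R => r * x : measurableTypeR R) mf).
rewrite (@lebesgue_measure_unique R
  (mscale (NngNum (ltW r0)) (pushforward (@lebesgue_measure R) g)) _ A mA); last first.
  move=> _ [[a b] _ <-]; rewrite /= /mscale /= /pushforward.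
  have -> : g @^-1` `]a, b]%classic = `]r^-1 * a, r^-1 * b]%classic.
    apply/seteqP; split=> x /=; rewrite !in_itv /= => /andP[h1 h2]; apply/andP; split.
    - by rewrite ltr_pdivrMl.
    - by rewrite ler_pdivlMl.
    - by rewrite -ltr_pdivrMl.
    - by rewrite -ler_pdivlMl.
  rewrite !lebesgue_measure_itv /= !lte_fin ltr_pM2l ?invr_gt0//.
  case: ifPn => _; last by rewrite mule0.
  by rewrite -!EFinD -EFinM; congr EFin; field; rewrite gt_eqF.
by rewrite /= /mscale /= /pushforward muleA -EFinM mulVf ?gt_eqF// mul1e.
Qed.

Section scaling_Cn.
Variable R : realType.
Local Open Scope complex_scope.

Definition dilate n (r : R) (z : n.-tuple R[i]) : n.-tuple R[i] :=
  [tuple r%:C * tnth z j | j < n].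

Lemma measurable_complex (f : R[i] -> R[i]) :
  measurable_fun setT (@ReIm R \o f \o @mkcomplex R) -> measurable_fun setT f.
Proof.
move=> mf; have -> : f = @mkcomplex R \o (@ReIm R \o f \o @mkcomplex R) \o @ReIm R.
  by apply/funext => -[a b] /=; rewrite /mkcomplex /ReIm/=; case: (f _).
apply: measurableT_comp; last exact: measurable_ReIm.
by apply: measurableT_comp => //; exact: measurable_mkcomplex.
Qed.

Lemma scales_lebesgue_C (r : R) : 0 < r ->
  scales (lebesgue_C R) (fun z => r%:C * z) (r^-1 ^+ 2).
Proof.
move=> r0; have H := scales_lebesgue_measure r0.
have [mF c0 FE] := scales_prod H H.
have E (z : R[i]) : ReIm (r%:C * z) = (r * (ReIm z).1, r * (ReIm z).2).
  by case: z => a b; rewrite /ReIm /=; congr (_, _); ring.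
have E2 : @ReIm R \o (fun z => r%:C * z) \o @mkcomplex R =
   (fun p => (r * p.1, r * p.2)) by apply/funext => -[a b] /=; rewrite E.
split.
- by apply: measurable_complex; rewrite E2.
- by rewrite exprn_gt0 ?invr_gt0.
move=> A mA; rewrite /= /pushforward_iso /pushforward.
rewrite -FE; last by rewrite -[X in measurable X]setTI; exact: measurable_mkcomplex.
congr (_ _); rewrite -comp_preimage; apply/seteqP; split => -[a b] /=.
  suff -> : mkcomplex (r * a, r * b) = r%:C * mkcomplex (a, b) by [].
  by rewrite /mkcomplex/=; congr (_ +i* _); ring.
suff -> : mkcomplex (r * a, r * b) = r%:C * mkcomplex (a, b) by [].
by rewrite /mkcomplex/=; congr (_ +i* _); ring.
Qed.

Lemma scales_lebesgue_Cn n (r : R) : 0 < r ->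
  scales (lebesgue_Cn R n) (@dilate n r) (r^-1 ^+ (2 * n)).
Proof.
move=> r0; elim: n => [|n IH].
  have E (z : 0.-tuple R[i]) : dilate r z = z.
    by apply/eq_from_tnth => -[].
  split.
  - by rewrite (_ : @dilate 0 r = idfun); [exact: measurable_id|exact/funext].
  - by rewrite muln0 expr0.
  - move=> A mA; rewrite muln0 expr0 mul1e.
    by congr (_ _); apply/seteqP; split => z /=; rewrite E.
have [mF c0 FE] := scales_prod (scales_lebesgue_C r0) IH.
have E (p : R[i] * n.-tuple R[i]) :
    dilate r (consC p) = consC (r%:C * p.1, dilate r p.2).
  apply/eq_from_tnth => j; rewrite tnth_mktuple.
  case: (unliftP ord0 j) => [i|] ->; rewrite !(tnthS,tnth0)//.
  by rewrite tnth_mktuple.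
have E3 (z : n.+1.-tuple R[i]) : consC (unconsC z) = z.
  by apply: val_inj => /=; case: z => -[].
split.
- rewrite (_ : @dilate n.+1 r = (@consC R n) \o
     (fun p => (r%:C * p.1, dilate r p.2)) \o @unconsC R n); last first.
    apply/funext => z.
    transitivity (consC (r%:C * (unconsC z).1, dilate r (unconsC z).2)) => //.
    by rewrite -E E3.
  apply: measurableT_comp; last exact: measurable_unconsC.
  by apply: measurableT_comp => //; exact: measurable_consC.
- by rewrite exprn_gt0 ?invr_gt0.
move=> A mA; rewrite /= /pushforward_iso /pushforward mulnS exprD.
rewrite -FE; last by rewrite -[X in measurable X]setTI; exact: measurable_consC.
by congr (_ _); rewrite -comp_preimage; apply/seteqP; split => p /=; rewrite E.
Qed.

End scaling_Cn.

Lemma measurable_preimage d1 d2 (T1 : measurableType d1) (T2 : measurableType d2)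
    (f : T1 -> T2) (B : set T2) :
  measurable_fun setT f -> measurable B -> measurable (f @^-1` B).
Proof. by move=> mf mB; rewrite -[X in measurable X]setTI; exact: mf. Qed.

Section slices.
Variable R : realType.
Local Open Scope complex_scope.
Local Notation leb := (lebesgue_Cn R).

(** The sup norm of the real and imaginary parts makes neighbourhoods squares, whose measure is a
    product of lengths. *)
Definition near_C (r : R) (x y : R[i]) :=
  `|complex.Re x - complex.Re y| <= r /\ `|complex.Im x - complex.Im y| <= r.

Lemma measurable_Re : measurable_fun setT (@complex.Re R).
Proof. exact: (measurableT_comp measurable_fst (@measurable_ReIm R)). Qed.

Lemma measurable_Im : measurable_fun setT (@complex.Im R).
Proof. exact: (measurableT_comp measurable_snd (@measurable_ReIm R)). Qed.

Lemma square_C (r : R) (x : R[i]) : 0 <= r ->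
  measurable [set y | near_C r y x] /\
  lebesgue_C R [set y | near_C r y x] = (((2 * r) ^+ 2)%:E)%E.
Proof.
move=> r0; pose I (a : R) : set (measurableTypeR R) := `[a - r, a + r]%classic.
have mI a : measurable (I a) by exact: measurable_itv.
  have E : [set y | near_C r y x] =
    [set z | I (complex.Re x) (complex.Re z) /\ I (complex.Im x) (complex.Im z)].
  by apply/seteqP; split => y; rewrite /near_C /I /= !in_itv /= !ler_distl.
have lI a : lebesgue_measure (I a) = (2 * r)%:E.
  rewrite /I lebesgue_measure_itv /= lte_fin -EFinD.
  case: ifPn => h; congr EFin; first by ring.
  by move: h; rewrite -leNgt; lra.
split; last by rewrite E lebesgue_C_rectangle// !lI -EFinM expr2.
rewrite E (_ : [set z | _] = (@complex.Re R @^-1` I (complex.Re x)) `&`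
  (@complex.Im R @^-1` I (complex.Im x)))//.
apply: measurableI.
  by apply: measurable_preimage; [exact: measurable_Re|exact: mI].
by apply: measurable_preimage; [exact: measurable_Im|exact: mI].
Qed.

Lemma lebesgue_C_diam (r : R) (A : set R[i]) : 0 <= r -> measurable A ->
  (forall x y, A x -> A y -> near_C r x y) ->
  (lebesgue_C R A <= ((2 * r) ^+ 2)%:E)%E.
Proof.
move=> r0 mA dA; have [->|/set0P[x Ax]] := eqVneq A set0.
  by rewrite measure0 lee_fin exprn_ge0// mulr_ge0.
have [mS <-] := square_C x r0.
by apply: le_measure; rewrite ?inE// => y Ay; exact: dA.
Qed.

Lemma lebesgue_Cn_slice1 n (A : set (n.+1.-tuple R[i])) : measurable A ->
  (leb n.+1 A = \int[lebesgue_C R]_x leb n [set t | A (consC (x, t))])%E.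
Proof.
move=> mA.
transitivity (\int[lebesgue_C R]_x (leb n \o xsection (@consC R n @^-1` A)) x)%E => //.
apply: eq_integral => x _ /=; congr (_ _).
by apply/seteqP; split => t; rewrite /xsection/= inE.
Qed.

Lemma measurable_slice1 n (A : set (n.+1.-tuple R[i])) : measurable A ->
  measurable_fun setT (fun x => leb n [set t | A (consC (x, t))]).
Proof.
move=> mA; have mB : measurable (@consC R n @^-1` A).
  exact: (measurable_preimage (@measurable_consC R n)).
have := measurable_fun_xsection (leb n) mB; congr measurable_fun.
apply/funext => x /=; congr (_ _).
by apply/seteqP; split => t; rewrite /xsection/= inE.
Qed.

(** The product measure is defined by integrating over the first factor last, so this order of
    integration rests on Tonelli's theorem for indicators. *)
Lemma lebesgue_Cn_slice2 n (A : set (n.+1.-tuple R[i])) : measurable A ->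
  (leb n.+1 A = \int[leb n]_t lebesgue_C R [set x | A (consC (x, t))])%E.
Proof.
move=> mA; have mB : measurable (@consC R n @^-1` A).
  exact: (measurable_preimage (@measurable_consC R n)).
have E t : lebesgue_C R [set x | A (consC (x, t))] =
    (lebesgue_C R \o ysection (@consC R n @^-1` A)) t.
  by rewrite /=; congr (_ _); apply/seteqP; split => x; rewrite /ysection/= inE.
under eq_integral do rewrite E.
transitivity ((lebesgue_C R \x leb n)%E (@consC R n @^-1` A)) => //.
rewrite -(indic_fubini_tonelli_GE (lebesgue_C R) mB).
rewrite -(indic_fubini_tonelli (lebesgue_C R) (leb n) mB).
by rewrite -(indic_fubini_tonelli1 (lebesgue_C R) (leb n) mB) integral_indic// setIT.
Qed.

Lemma measurable_slice2 n (A : set (n.+1.-tuple R[i])) : measurable A ->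
  measurable_fun setT (fun t : n.-tuple R[i] => lebesgue_C R [set x | A (consC (x, t))]).
Proof.
move=> mA; have mB : measurable (@consC R n @^-1` A).
  exact: (measurable_preimage (@measurable_consC R n)).
have := measurable_fun_ysection (lebesgue_C R) mB; congr measurable_fun.
apply/funext => x /=; congr (_ _).
by apply/seteqP; split => t; rewrite /ysection/= inE.
Qed.

Lemma integral_le_slab d (T : measurableType d) (m : {measure set T -> \bar R})
    (g : T -> \bar R) (D : set T) (c : R) : measurable D -> 0 <= c ->
  measurable_fun setT g -> (forall x, 0 <= g x)%E ->
  (forall x, D x -> g x <= c%:E)%E -> (forall x, ~ D x -> g x = 0)%E ->
  (\int[m]_x g x <= c%:E * m D)%E.
Proof.
move=> mD c0 mg g0 gc gD.
rewrite -(integral_cst m mD) [leRHS]integral_mkcond.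
apply: ge0_le_integral => //.
- by apply/(measurable_restrictT _ mD).1; exact: measurable_cst.
- move=> x _; rewrite patchE; case: ifPn => [/set_mem/gc//|/negP xD].
  by rewrite gD// => Dx; apply: xD; rewrite inE.
Qed.

Lemma cube_Cn n (r : R) (z : n.-tuple R[i]) : 0 <= r ->
  measurable [set w : n.-tuple R[i] | forall i, near_C r (tnth w i) (tnth z i)] /\
  leb n [set w | forall i, near_C r (tnth w i) (tnth z i)] =
    (((2 * r) ^+ 2) ^+ n)%:E.
Proof.
move=> r0; have [|mB ->] := @lebesgue_Cn_box R n (fun i => [set x | near_C r x (tnth z i)]).
  by move=> i; have [] := square_C (tnth z i) r0.
split=> //; rewrite (eq_bigr (fun=> ((2 * r) ^+ 2)%:E)).
  by rewrite prodEFin prodr_const card_ord.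
by move=> i _; have [] := square_C (tnth z i) r0.
Qed.

Lemma tnth_consC0 n x (t : n.-tuple R[i]) : tnth (consC (x, t)) ord0 = x.
Proof. by rewrite tnth0. Qed.

Lemma tnth_consCS n x (t : n.-tuple R[i]) i : tnth (consC (x, t)) (lift ord0 i) = tnth t i.
Proof. by rewrite tnthS. Qed.

(** The last n coordinates stay in a cube of half-side [r] around those of any point of [A]; over
    each of them the slice in the first coordinate has diameter [s]. *)
Let lebesgue_Cn_diam0 n (A : set (n.+1.-tuple R[i])) (r s : R) :
  0 <= r -> 0 <= s -> measurable A ->
  (forall z w i, A z -> A w -> i != ord0 -> near_C r (tnth z i) (tnth w i)) ->
  (forall z w, A z -> A w -> (forall i, i != ord0 -> tnth z i = tnth w i) ->
    near_C s (tnth z ord0) (tnth w ord0)) ->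
  (leb n.+1 A <= ((2 * s) ^+ 2 * ((2 * r) ^+ 2) ^+ n)%:E)%E.
Proof.
move=> r0 s0 mA dr ds; have sq0 (x : R) : 0 <= (2 * x) ^+ 2 by rewrite sqr_ge0.
have [->|/set0P[a Aa]] := eqVneq A set0.
  by rewrite measure0 lee_fin mulr_ge0// exprn_ge0.
have [mQ QE] := cube_Cn (unconsC a).2 r0.
rewrite lebesgue_Cn_slice2// EFinM -QE.
have mS t : measurable [set x | A (consC (x, t))].
  apply: (@measurable_preimage _ _ _ _ (fun x => consC (x, t)) A) => //.
  by apply: measurableT_comp; [exact: measurable_consC|exact: measurable_fun_pair].
apply: integral_le_slab => //; first exact: measurable_slice2.
- move=> t _; apply: lebesgue_C_diam => //= x y Ax Ay.
  have := ds _ _ Ax Ay; rewrite !tnth_consC0; apply=> i.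
  by case: (unliftP ord0 i) => [k ->|->]; rewrite ?eqxx// !tnth_consCS.
- move=> t Qt; rewrite (_ : [set _ | _] = set0) ?measure0//.
  apply/seteqP; split=> // x Ax; apply: Qt => i.
  have := dr _ _ (lift ord0 i) Ax Aa; rewrite tnth_consCS.
  by rewrite tnth_behead -(lift0 i) inord_val; apply; rewrite eq_sym neq_lift.
Qed.

(* The set [A] may be sheared: only its slices in the coordinate [j] are required
   to have diameter [s]. *)
Lemma lebesgue_Cn_diam n (A : set (n.+1.-tuple R[i])) (j : 'I_n.+1) (r s : R) :
  0 <= r -> 0 <= s -> measurable A ->
  (forall z w i, A z -> A w -> i != j -> near_C r (tnth z i) (tnth w i)) ->
  (forall z w, A z -> A w -> (forall i, i != j -> tnth z i = tnth w i) ->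
    near_C s (tnth z j) (tnth w j)) ->
  (leb n.+1 A <= ((2 * s) ^+ 2 * ((2 * r) ^+ 2) ^+ n)%:E)%E.
Proof.
move=> r0 s0; have sq0 (x : R) : 0 <= (2 * x) ^+ 2 by rewrite sqr_ge0.
(* The coordinates before [j] are integrated out one at a time, each at the cost of a square of
   half-side [r], until [j] comes first. *)
elim: n A j => [|n IH] A j mA; (case: (unliftP ord0 j) => [k|] ->;
  last exact: lebesgue_Cn_diam0); first by case: k.
move=> dr ds; have [->|/set0P[a Aa]] := eqVneq A set0.
  by rewrite measure0 lee_fin mulr_ge0// exprn_ge0.
have [mQ QE] := square_C (tnth a ord0) r0.
have mS x : measurable [set t | A (consC (x, t))].
  apply: (@measurable_preimage _ _ _ _ (fun t => consC (x, t)) A) => //.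
  by apply: measurableT_comp; [exact: measurable_consC|exact: measurable_fun_pair].
rewrite lebesgue_Cn_slice1// (exprSr _ n) mulrA EFinM -QE.
apply: integral_le_slab => //.
- by rewrite mulr_ge0// exprn_ge0.
- exact: measurable_slice1.
- move=> x _; apply: (IH _ k) => //.
    move=> z w i Az Aw ik; have := dr _ _ (lift ord0 i) Az Aw.
    by rewrite !tnth_consCS; apply; rewrite (inj_eq lift_inj).
  move=> z w Az Aw zw; have := ds _ _ Az Aw; rewrite !tnth_consCS; apply=> i.
  case: (unliftP ord0 i) => [l ->|-> _]; last by rewrite !tnth_consC0.
  by rewrite (inj_eq lift_inj) !tnth_consCS => /zw.
- move=> x Qx; rewrite (_ : [set _ | _] = set0) ?measure0//.
  apply/seteqP; split=> // t At; apply: Qx.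
  by have := dr _ _ ord0 At Aa; rewrite tnth_consC0; apply; rewrite neq_lift.
Qed.

End slices.

(** * Geometry of 1 - <z, w> on the ball *)

Section ball_geometry.
Variables (R : realType) (d : nat).
Local Open Scope complex_scope.
Local Notation Cd := (d.-tuple R[i]).
Local Notation B := (@unit_ball R d).

Definition re (z : Cd) j : R := complex.Re (tnth z j).
Definition im (z : Cd) j : R := complex.Im (tnth z j).
Definition nsq (z : Cd) : R := \sum_(j < d) (re z j ^+ 2 + im z j ^+ 2).
Definition dsq (z w : Cd) : R :=
  \sum_(j < d) ((re z j - re w j) ^+ 2 + (im z j - im w j) ^+ 2).
Definition ipre (z w : Cd) : R := \sum_(j < d) (re z j * re w j + im z j * im w j).
Definition ipim (z w : Cd) : R := \sum_(j < d) (im z j * re w j - re z j * im w j).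
(* Real part, imaginary part and modulus of u = 1 - <z, w>. *)
Definition ure z w : R := 1 - ipre z w.
Definition uim z w : R := - ipim z w.
Definition umod z w : R := Num.sqrt (ure z w ^+ 2 + uim z w ^+ 2).

Lemma unit_ballE z : B z <-> nsq z < 1.
Proof.
rewrite /unit_ball /= (_ : \sum_(j < d) _ = nsq z)//; apply: eq_bigr => j _.
rewrite /re /im; case: (tnth z j) => a b /=.
by rewrite sqr_sqrtr// addr_ge0 ?sqr_ge0.
Qed.

Lemma cinnerE z w : 1 - cinner z w = (ure z w) +i* (uim z w).
Proof.
have -> : cinner z w = ipre z w +i* ipim z w.
  have ReD : {morph (@complex.Re R) : x y / x + y} by move=> [? ?] [].
  have ImD : {morph (@complex.Im R) : x y / x + y} by move=> [? ?] [].
  apply/eqP; rewrite eq_complex /cinner; apply/andP; split; apply/eqP => /=.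
    rewrite (big_morph _ ReD (erefl _)); apply: eq_bigr => j _; rewrite /re /im.
    by case: (tnth z j) (tnth w j) => a b [a' b'] /=; ring.
  rewrite (big_morph _ ImD (erefl _)); apply: eq_bigr => j _; rewrite /re /im.
  by case: (tnth z j) (tnth w j) => a b [a' b'] /=; ring.
by apply/eqP; rewrite eq_complex /= /ure /uim sub0r !eqxx.
Qed.

Lemma normc_u z w : normc (1 - cinner z w) = umod z w.
Proof. by rewrite cinnerE. Qed.

(** Polarization. On the ball all three terms are nonnegative, so each of them is at most 2 Re u;
    every lower bound on Re u comes from here. *)
Lemma ureE z w : ure z w = ((1 - nsq z) + (1 - nsq w) + dsq z w) / 2.
Proof.
have -> : dsq z w = nsq z + nsq w - 2 * ipre z w.
  rewrite /dsq /nsq /ipre -big_split mulr_sumr -sumrB /=.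
  by apply: eq_bigr => j _; ring.
by rewrite /ure; field.
Qed.

Lemma dsq_ge0 z w : 0 <= dsq z w.
Proof. by apply: sumr_ge0 => j _; rewrite addr_ge0 ?sqr_ge0. Qed.

Lemma coord_nsq z j : re z j ^+ 2 + im z j ^+ 2 <= nsq z.
Proof.
rewrite /nsq (bigD1 j)//= lerDl; apply: sumr_ge0 => i _.
by rewrite addr_ge0 ?sqr_ge0.
Qed.

Lemma coord_dsq z w j :
  (re z j - re w j) ^+ 2 + (im z j - im w j) ^+ 2 <= dsq z w.
Proof.
rewrite /dsq (bigD1 j)//= lerDl; apply: sumr_ge0 => i _.
by rewrite addr_ge0 ?sqr_ge0.
Qed.

Lemma ipre_le z w : `|ipre z w| <= (nsq z + nsq w) / 2.
Proof.
rewrite /ipre /nsq -big_split mulr_suml (le_trans (ler_norm_sum _ _ _))//.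
apply: ler_sum => j _ /=; rewrite ler_norml; apply/andP.
have := sqr_ge0 (re z j + re w j); have := sqr_ge0 (re z j - re w j).
have := sqr_ge0 (im z j + im w j); have := sqr_ge0 (im z j - im w j).
by rewrite !sqrrB !sqrrD; split; lra.
Qed.

Lemma ipim_le z w : `|ipim z w| <= (nsq z + nsq w) / 2.
Proof.
rewrite /ipim /nsq -big_split mulr_suml (le_trans (ler_norm_sum _ _ _))//.
apply: ler_sum => j _ /=; rewrite ler_norml; apply/andP.
have := sqr_ge0 (im z j + re w j); have := sqr_ge0 (im z j - re w j).
have := sqr_ge0 (re z j + im w j); have := sqr_ge0 (re z j - im w j).
by rewrite !sqrrB !sqrrD; split; lra.
Qed.

Lemma umod_ge0 z w : 0 <= umod z w. Proof. exact: sqrtr_ge0. Qed.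

Lemma umod_sqr z w : umod z w ^+ 2 = ure z w ^+ 2 + uim z w ^+ 2.
Proof. by rewrite sqr_sqrtr// addr_ge0 ?sqr_ge0. Qed.

Lemma ure_umod z w : `|ure z w| <= umod z w.
Proof. by rewrite -sqrtr_sqr ler_wsqrtr// lerDl sqr_ge0. Qed.

Lemma uim_umod z w : `|uim z w| <= umod z w.
Proof. by rewrite -sqrtr_sqr ler_wsqrtr// lerDr sqr_ge0. Qed.

Lemma ure_gt0 z w : B z -> B w -> 0 < ure z w.
Proof. by move=> /unit_ballE zB /unit_ballE wB; rewrite ureE; have := dsq_ge0 z w; lra. Qed.

Lemma ure_ge z w : B z -> B w -> (1 - nsq z) / 2 <= ure z w.
Proof. by move=> /unit_ballE zB /unit_ballE wB; rewrite ureE; have := dsq_ge0 z w; lra. Qed.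

Lemma umod_gt0 z w : B z -> B w -> 0 < umod z w.
Proof.
by move=> zB wB; rewrite (lt_le_trans _ (ure_umod _ _))// gtr0_norm ure_gt0.
Qed.

(** The real and imaginary parts of <z, w> are bounded by 1 separately, so |u|^2 <= 4 + 1; the
    constant 3 is chosen for convenience. *)
Lemma umod_le3 z w : B z -> B w -> umod z w <= 3.
Proof.
move=> /unit_ballE zB /unit_ballE wB; rewrite -(@ler_pXn2r _ 2) ?nnegrE ?umod_ge0//.
rewrite umod_sqr /ure /uim; have := ipre_le z w; have := ipim_le z w.
rewrite !ler_norml => /andP[h1 h2] /andP[h3 h4].
by nra.
Qed.

Lemma measurable_re j : measurable_fun setT (fun z : Cd => re z j).
Proof. exact: measurableT_comp (@measurable_Re R) (@measurable_tnth _ _ _ j). Qed.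

Lemma measurable_im j : measurable_fun setT (fun z : Cd => im z j).
Proof. exact: measurableT_comp (@measurable_Im R) (@measurable_tnth _ _ _ j). Qed.

Lemma measurable_nsq : measurable_fun setT nsq.
Proof.
apply: measurable_sum => j; apply: measurable_funD; apply: measurable_funX.
  exact: measurable_re.
exact: measurable_im.
Qed.

Lemma measurable_ipre : measurable_fun setT (fun p : Cd * Cd => ipre p.1 p.2).
Proof.
have mr := measurable_re; have mi := measurable_im.
apply: measurable_sum => j; apply: measurable_funD; apply: measurable_funM;
  by [exact: (measurableT_comp (mr j))|exact: (measurableT_comp (mi j))].
Qed.

Lemma measurable_ipim : measurable_fun setT (fun p : Cd * Cd => ipim p.1 p.2).
Proof.
have mr := measurable_re; have mi := measurable_im.
apply: measurable_sum => j; apply: measurable_funB; apply: measurable_funM;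
  by [exact: (measurableT_comp (mr j))|exact: (measurableT_comp (mi j))].
Qed.

Lemma measurable_ure : measurable_fun setT (fun p : Cd * Cd => ure p.1 p.2).
Proof. by apply: measurable_funB => //; exact: measurable_ipre. Qed.

Lemma measurable_uim : measurable_fun setT (fun p : Cd * Cd => uim p.1 p.2).
Proof. by apply: measurable_funN; exact: measurable_ipim. Qed.

Lemma measurable_umod : measurable_fun setT (fun p : Cd * Cd => umod p.1 p.2).
Proof.
apply: (measurableT_comp (continuous_measurable_fun (@sqrt_continuous R))).
by apply: measurable_funD; apply: measurable_funX; [exact: measurable_ure|exact: measurable_uim].
Qed.

Lemma measurable_unit_ball : measurable B.
Proof.
rewrite (_ : B = nsq @^-1` `]-oo, 1[%classic).
  exact: (measurable_preimage measurable_nsq (measurable_itv _)).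
by apply/seteqP; split => z /=; rewrite in_itv /= => /unit_ballE.
Qed.

Lemma measurable_section1 d' (T : measurableType d') (g : Cd * Cd -> T) z :
  measurable_fun setT g -> measurable_fun setT (fun w => g (z, w)).
Proof. by move=> mg; apply: (measurableT_comp mg); exact: measurable_fun_pair. Qed.

Definition sublevel z t : set Cd := [set w | B w /\ umod z w <= t].

Lemma measurable_sublevel z t : measurable (sublevel z t).
Proof.
rewrite (_ : sublevel z t = B `&` (fun w => umod z w) @^-1` `]-oo, t]%classic).
  apply: measurableI; first exact: measurable_unit_ball.
  apply: (measurable_preimage _ (measurable_itv _)).
  exact: (measurable_section1 z measurable_umod).
by apply/seteqP; split => w /=; rewrite in_itv.
Qed.

Lemma sublevel_nsq z w t : B z -> B w -> umod z w <= t -> 1 - nsq z <= 2 * t.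
Proof.
move=> zB wB ut; have := ure_ge zB wB; have := ure_umod z w.
by rewrite (gtr0_norm (ure_gt0 zB wB)); lra.
Qed.

Lemma sublevel_dsq z w t : B z -> B w -> umod z w <= t -> dsq z w <= 2 * t.
Proof.
move=> zB wB ut; have := ure_umod z w; have := ure_gt0 zB wB.
move=> u0; rewrite gtr0_norm// ureE.
by move: zB wB => /unit_ballE ? /unit_ballE ?; lra.
Qed.

Lemma sqr_le_near (x y t : R) : x ^+ 2 + y ^+ 2 <= t ->
  `|x| <= Num.sqrt t /\ `|y| <= Num.sqrt t.
Proof.
move=> h; split; rewrite -sqrtr_sqr ler_wsqrtr//.
  by have := sqr_ge0 y; lra.
by have := sqr_ge0 x; lra.
Qed.

Lemma sublevel_near z t w w' i : B z -> sublevel z t w -> sublevel z t w' ->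
  near_C (2 * Num.sqrt (2 * t)) (tnth w i) (tnth w' i).
Proof.
move=> zB [wB ut] [wB' ut'].
have [] := sqr_le_near (le_trans (coord_dsq z w i) (sublevel_dsq zB wB ut)).
have [] := sqr_le_near (le_trans (coord_dsq z w' i) (sublevel_dsq zB wB' ut')).
rewrite /near_C -!/(re _ _) -!/(im _ _) !ler_norml.
by move=> /andP[? ?] /andP[? ?] /andP[? ?] /andP[? ?]; split; apply/andP; split; lra.
Qed.

(** If w and w' differ only in the coordinate j, then u(z, w) - u(z, w') = - z_j conj(w_j - w'_j).
    Both parts of the left side are at most 2t; multiplying by conj(z_j) and dividing by |z_j|^2 >=
    c isolates w_j - w'_j. *)
Lemma sublevel_near1 z t w w' j c : B z -> 0 < c ->
  c <= re z j ^+ 2 + im z j ^+ 2 ->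
  sublevel z t w -> sublevel z t w' ->
  (forall i, i != j -> tnth w i = tnth w' i) ->
  near_C (4 * t / c) (tnth w j) (tnth w' j).
Proof.
move=> zB c0 zj [wB ut] [wB' ut'] ww.
have h1 : `|ure z w - ure z w'| <= 2 * t.
  have := ure_umod z w; have := ure_umod z w'; rewrite !ler_norml.
  by move=> /andP[? ?] /andP[? ?]; apply/andP; split; lra.
have h2 : `|uim z w - uim z w'| <= 2 * t.
  have := uim_umod z w; have := uim_umod z w'; rewrite !ler_norml.
  by move=> /andP[? ?] /andP[? ?]; apply/andP; split; lra.
have E1 : ure z w - ure z w' =
    - (re z j * (re w j - re w' j) + im z j * (im w j - im w' j)).
  rewrite /ure /ipre (bigD1 j)//= [in X in _ - X](bigD1 j)//=.
  rewrite (eq_bigr (fun i => re z i * re w' i + im z i * im w' i)); last first.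
    by move=> i ij; rewrite /re /im ww.
  by ring.
have E2 : uim z w - uim z w' =
    - (im z j * (re w j - re w' j) - re z j * (im w j - im w' j)).
  rewrite /uim /ipim (bigD1 j)//= [in X in _ - X](bigD1 j)//=.
  rewrite (eq_bigr (fun i => im z i * re w' i - re z i * im w' i)); last first.
    by move=> i ij; rewrite /re /im ww.
  by ring.
rewrite /near_C -!/(re _ _) -!/(im _ _).
move: E1 E2; set p := re w j - re w' j; set q := im w j - im w' j => E1 E2.
have zj1 : re z j ^+ 2 + im z j ^+ 2 <= 1.
  by rewrite (le_trans (coord_nsq z j))// ltW//; apply/unit_ballE.
have a1 : `|re z j| <= 1 by have [] := sqr_le_near zj1; rewrite sqrtr1.
have b1 : `|im z j| <= 1 by have [] := sqr_le_near zj1; rewrite sqrtr1.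
have t0 : 0 <= t by exact: le_trans (umod_ge0 _ _) ut.
have key x y X Y p' : `|x| <= 1 -> `|y| <= 1 -> `|X| <= 2 * t -> `|Y| <= 2 * t ->
    (re z j ^+ 2 + im z j ^+ 2) * p' = x * X + y * Y -> `|p'| <= 4 * t / c.
  move=> x1 y1 X1 Y1 E; rewrite ler_pdivlMr// mulrC.
  apply: (@le_trans _ _ ((re z j ^+ 2 + im z j ^+ 2) * `|p'|)).
    by rewrite ler_wpM2r.
  rewrite -[X in X * _]ger0_norm ?addr_ge0 ?sqr_ge0// -normrM E.
  rewrite (le_trans (ler_normD _ _))// !normrM.
  have := ler_pM (normr_ge0 _) (normr_ge0 _) x1 X1.
  have := ler_pM (normr_ge0 _) (normr_ge0 _) y1 Y1.
  by lra.
split.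
  apply: (key (- re z j) (- im z j) (ure z w - ure z w') (uim z w - uim z w')) => //.
  - by rewrite normrN.
  - by rewrite normrN.
  by rewrite E1 E2; ring.
apply: (key (- im z j) (re z j) (ure z w - ure z w') (uim z w - uim z w')) => //.
- by rewrite normrN.
by rewrite E1 E2; ring.
Qed.

End ball_geometry.

(* On a sublevel set of |1 - <z, .>| all coordinates vary by O(sqrt t), and the
   coordinate [j] with |z_j| maximal is determined up to O(t) by the others. *)
Lemma lebesgue_sublevel (R : realType) (n : nat) :
  exists2 C : R, 0 < C & forall (z : n.+1.-tuple R[i]) t, unit_ball z -> 0 < t -> t <= 1 / 4 ->
  (lebesgue_Cn R n.+1 (sublevel z t) <= (C * t ^+ n.+2)%:E)%E.
Proof.
pose N : R := (2 * n.+1)%:R.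
have N0 : 0 < N by rewrite ltr0n.
have C0 : 0 < (2 * (4 * N)) ^+ 2 * (32 ^+ n) :> R.
  by do ?[apply: mulr_gt0 | apply: exprn_gt0] => //; rewrite ltr0n.
exists ((2 * (4 * N)) ^+ 2 * (32 ^+ n)) => //.
move=> z t zB t0 t4.
have [->|/set0P[w [wB ut]]] := eqVneq (sublevel z t) set0.
  by rewrite measure0 lee_fin mulr_ge0 ?exprn_ge0// ltW.
(* This uses t <= 1/4. One of the n + 1 coordinates then satisfies |z_j|^2 >= 1 / (2 (n + 1)), which
   is 1 / [N]. *)
have nz : 1 / 2 <= nsq z by have := sublevel_nsq zB wB ut; lra.
have [j zj] : exists j, N^-1 <= re z j ^+ 2 + im z j ^+ 2.
  apply: contrapT => /forallNP h.
  suff : nsq z < 1 / 2 by lra.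
  have -> : 1 / 2 = \sum_(j < n.+1) N^-1.
    by rewrite sumr_const card_ord -[RHS]mulr_natl /N natrM; field;
      rewrite -?natr1 gt_eqF// ltr_wpDl.
  apply: ltr_sum; first by apply/hasP; exists ord0; rewrite ?mem_index_enum.
  by move=> i _; rewrite ltNge; apply/negP.
apply: le_trans.
  apply: (@lebesgue_Cn_diam R n (sublevel z t) j (2 * Num.sqrt (2 * t)) (4 * t / N^-1)).
  - by rewrite mulr_ge0 ?sqrtr_ge0.
  - by rewrite invrK; apply: mulr_ge0; [lra|exact: ltW].
  - exact: measurable_sublevel.
  - by move=> w1 w2 i s1 s2 _; apply: (@sublevel_near _ _ z t).
  - by move=> w1 w2 s1 s2 h; apply: (@sublevel_near1 _ _ z t w1 w2 j N^-1) => //; rewrite invr_gt0.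
have -> : (2 * (2 * Num.sqrt (2 * t))) ^+ 2 = 32 * t.
  by rewrite !exprMn sqr_sqrtr; [ring|lra].
rewrite lee_fin invrK le_eqVlt; apply/orP; left; apply/eqP.
by clearbody N; rewrite [X in _ * X]exprMn !(exprS t); ring.
Qed.

(** * Volumes of shells, cones and sublevel sets *)

Section shells.
Variables (R : realType) (n : nat).
Local Open Scope complex_scope.
Local Notation Cd := (n.+1.-tuple R[i]).
Local Notation B := (@unit_ball R n.+1).
Local Notation leb := (lebesgue_Cn R n.+1).

Definition conic (C : set Cd) := forall r z, 0 < r -> C (dilate r z) <-> C z.

Lemma re_dilate r (z : Cd) j : re (dilate r z) j = r * re z j.
Proof. by rewrite /re tnth_mktuple; case: (tnth z j) => a b /=; ring. Qed.

Lemma im_dilate r (z : Cd) j : im (dilate r z) j = r * im z j.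
Proof. by rewrite /im tnth_mktuple; case: (tnth z j) => a b /=; ring. Qed.

Lemma nsq_dilate r (z : Cd) : nsq (dilate r z) = r ^+ 2 * nsq z.
Proof.
rewrite /nsq mulr_sumr; apply: eq_bigr => j _.
by rewrite re_dilate im_dilate; ring.
Qed.

Lemma measurable_nsq_lt (C : set Cd) c : measurable C ->
  measurable (C `&` [set z | nsq z < c]).
Proof.
move=> mC; apply: measurableI => //.
rewrite (_ : [set z | _] = (@nsq R n.+1) @^-1` `]-oo, c[%classic).
  exact: (measurable_preimage (@measurable_nsq R n.+1) (measurable_itv _)).
by apply/seteqP; split => z /=; rewrite in_itv.
Qed.

(** The set is the dilation of C [&] B by sqrt c, and C^(n+1) has real dimension 2 (n + 1). *)
Lemma lebesgue_conic (C : set Cd) c : measurable C -> conic C -> 0 < c ->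
  leb (C `&` [set z | nsq z < c]) = ((c ^+ n.+1)%:E * leb (C `&` B))%E.
Proof.
move=> mC cC c0; pose r := Num.sqrt c.
have r0 : 0 < r by rewrite sqrtr_gt0.
have ri0 : 0 < r^-1 by rewrite invr_gt0.
have [_ _ /(_ (C `&` B))] := scales_lebesgue_Cn n.+1 ri0.
rewrite invrK exprM sqr_sqrtr ?ltW// => <-; last first.
  exact: measurableI mC (@measurable_unit_ball R n.+1).
congr (_ _); apply/seteqP; split => z [Cz zc]; split.
- exact/cC.
- apply/unit_ballE; rewrite nsq_dilate exprVn sqr_sqrtr ?ltW//.
  by rewrite mulrC ltr_pdivrMr// mul1r.
- exact/(cC r^-1 z).
- move: zc => /= /unit_ballE; rewrite nsq_dilate exprVn sqr_sqrtr ?ltW//.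
  by rewrite mulrC ltr_pdivrMr// mul1r.
Qed.

(** Here Re z_0 is positive and comparable to |z|, so it is a Lipschitz function of |z|^2 and of the
    other real coordinates when |z| is close to 1. *)
Definition cone : set Cd := [set z | 0 < re z ord0 /\ nsq z <= 4 * re z ord0 ^+ 2].

Lemma conic_cone : conic cone.
Proof.
move=> r z r0; rewrite /cone /= re_dilate nsq_dilate exprMn pmulr_rgt0//.
by rewrite mulrCA ler_pM2l// exprn_gt0.
Qed.

Lemma measurable_cone : measurable cone.
Proof.
have mr := @measurable_re R n.+1 ord0.
rewrite (_ : cone = (fun z => re z ord0) @^-1` `]0, +oo[%classic `&`
  (fun z => nsq z - 4 * re z ord0 ^+ 2) @^-1` `]-oo, 0]%classic).
  apply: measurableI.
    exact: (measurable_preimage mr (measurable_itv _)).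
  apply: (measurable_preimage _ (measurable_itv _)).
  apply: measurable_funB; first exact: measurable_nsq.
  by apply: measurable_funM => //; exact: measurable_funX.
apply/seteqP; split => z; rewrite /cone/= !in_itv /= andbT => -[h1 h2]; split => //.
  by rewrite subr_le0.
by rewrite -subr_le0.
Qed.

Lemma lebesgue_ball_fin : (leb B < +oo)%E.
Proof.
pose z0 : Cd := [tuple 0 | j < n.+1].
have [mQ QE] := cube_Cn z0 (@ler01 R).
apply: (@le_lt_trans _ _ ((((2 * 1) ^+ 2) ^+ n.+1)%:E)); last exact: ltry.
rewrite -QE; apply: le_measure; rewrite ?inE//; first exact: measurable_unit_ball.
move=> z /unit_ballE z1 j; rewrite /near_C tnth_mktuple /= !subr0.
have [] := sqr_le_near (le_trans (coord_nsq z j) (ltW z1)).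
by rewrite sqrtr1.
Qed.

Lemma lebesgue_cone_gt0 : (0 < leb (cone `&` B))%E.
Proof.
pose z0 : Cd := [tuple (if j == ord0 then 1 / 2 else 0)%:C | j < n.+1].
(* In the cube of half-side [r] around (1/2, 0, ..., 0), Re z_0 stays in [1/4, 3/4] and the squares
   of all other real coordinates add up to at most 1/8. *)
pose r : R := 1 / (4 * n.+1%:R).
have n0 : (0 : R) < n.+1%:R by rewrite ltr0n.
have r0 : 0 < r by rewrite divr_gt0// mulr_gt0.
have [mQ QE] := cube_Cn z0 (ltW r0).
apply: (@lt_le_trans _ _ ((((2 * r) ^+ 2) ^+ n.+1)%:E)).
  by rewrite lte_fin !exprn_gt0// mulr_gt0.
have n1 : (1 : R) <= n.+1%:R by rewrite ler1n.
rewrite -QE; apply: le_measure; rewrite ?inE//.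
  exact: measurableI measurable_cone (@measurable_unit_ball R n.+1).
move=> z zQ.
have r4 : r <= 1 / 4.
  by rewrite /r ler_pdivrMr ?mulr_gt0//; lra.
have nr : n.+1%:R * r ^+ 2 <= 1 / 16.
  have -> : n.+1%:R * r ^+ 2 = (n.+1%:R)^-1 / 16 by rewrite /r; field; rewrite gt_eqF.
  by rewrite ler_pM2r// invf_le1.
have z0r : `|re z ord0 - 1 / 2| <= r.
  by have [] := zQ ord0; rewrite tnth_mktuple eqxx.
have z0i : `|im z ord0| <= r.
  by have [_] := zQ ord0; rewrite tnth_mktuple eqxx /= subr0.
have zj j : j != ord0 -> `|re z j| <= r /\ `|im z j| <= r.
  by move=> j0; have [] := zQ j; rewrite tnth_mktuple (negPf j0) /= !subr0.
have sqle x : `|x| <= r -> x ^+ 2 <= r ^+ 2.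
  by move=> xr; rewrite -real_normK ?num_real// ler_pXn2r ?nnegrE// ltW.
have nz : nsq z <= re z ord0 ^+ 2 + 2 / 16.
  apply: (@le_trans _ _ (re z ord0 ^+ 2 + \sum_(j < n.+1) (2 * r ^+ 2))).
    rewrite /nsq (bigD1 ord0)//= [in leRHS](bigD1 ord0)//=.
    have : \sum_(j < n.+1 | j != ord0) (re z j ^+ 2 + im z j ^+ 2) <=
        \sum_(j < n.+1 | j != ord0) 2 * r ^+ 2.
      by apply: ler_sum => j j0; have [/sqle ? /sqle ?] := zj j j0; lra.
    by have := sqle _ z0i; have := sqr_ge0 r; lra.
  by rewrite lerD2l sumr_const card_ord -mulr_natl; lra.
move: z0r; rewrite ler_norml => /andP[h1 h2]; split.
  split; first lra.
  by nra.
by apply/unit_ballE; nra.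
Qed.

Lemma lebesgue_ball_gt0 : (0 < leb B)%E.
Proof.
apply: (lt_le_trans lebesgue_cone_gt0); apply: le_measure; rewrite ?inE//.
- exact: measurableI measurable_cone (@measurable_unit_ball R n.+1).
- exact: measurable_unit_ball.
Qed.

Local Notation V := (@vol R n.+1).

Lemma vol_leb : exists2 c : R, 0 < c & forall A, V A = (c%:E * leb A)%E.
Proof.
exists (fine (leb B))^-1 => //.
by rewrite invr_gt0 fine_gt0// lebesgue_ball_gt0 lebesgue_ball_fin.
Qed.

Lemma vol_ball : V B = 1%:E.
Proof.
rewrite /vol /= /mscale /=.
have fB : leb B \is a fin_num.
  by rewrite ge0_fin_numE ?lebesgue_ball_fin.
rewrite -[X in (_ * X)%E](fineK fB) -EFinM mulVf// gt_eqF// fine_gt0//.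
by rewrite lebesgue_ball_gt0 lebesgue_ball_fin.
Qed.

Definition shell (C : set Cd) (a b : R) : set Cd :=
  C `&` [set z | a < 1 - nsq z <= b].

Lemma shellE C a b : shell C a b =
  (C `&` [set z | nsq z < 1 - a]) `\` (C `&` [set z | nsq z < 1 - b]).
Proof.
apply/seteqP; split => z /=.
  move=> [Cz /andP[za zb]]; split; first by split => //; lra.
  by move=> [_]; apply/negP; rewrite -leNgt; lra.
move=> [[Cz za] zb]; split=> //; apply/andP; split; first lra.
by rewrite leNgt; apply/negP => h; apply: zb; split=> //; lra.
Qed.

Lemma measurable_shell C a b : measurable C -> measurable (shell C a b).
Proof. by move=> mC; rewrite shellE; apply: measurableD; exact: measurable_nsq_lt. Qed.

Lemma lebesgue_shell C a b : measurable C -> conic C -> 0 <= a -> a <= b -> b < 1 ->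
  leb (shell C a b) =
  (((1 - a) ^+ n.+1 - (1 - b) ^+ n.+1)%:E * leb (C `&` B))%E.
Proof.
move=> mC cC a0 ab b1.
have CB : (leb (C `&` B) < +oo)%E.
  apply: (le_lt_trans _ lebesgue_ball_fin); apply: le_measure; rewrite ?inE//.
    exact: measurableI mC (@measurable_unit_ball R n.+1).
  exact: measurable_unit_ball.
have fCB : leb (C `&` B) \is a fin_num by rewrite ge0_fin_numE.
have La : leb (C `&` [set z | nsq z < 1 - a]) =
   ((1 - a) ^+ n.+1 * fine (leb (C `&` B)))%:E.
  by rewrite lebesgue_conic//; [rewrite EFinM fineK|lra].
have Lb : leb (C `&` [set z | nsq z < 1 - b]) =
   ((1 - b) ^+ n.+1 * fine (leb (C `&` B)))%:E.
  by rewrite lebesgue_conic//; [rewrite EFinM fineK|lra].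
pose X c : set Cd := C `&` [set z | nsq z < 1 - c].
have mX c : measurable (X c) by exact: measurable_nsq_lt.
have D : leb (shell C a b) = (leb (X a) - leb (X a `&` X b))%E.
  have fa : (leb (X a) < +oo)%E by rewrite La ltry.
  rewrite shellE; apply: measureD; [exact: mX|exact: mX|exact: fa].
have I : X a `&` X b = X b.
  by apply: setIidr => z /= [Cz zb]; split=> //=; move: zb => /=; lra.
by rewrite D I La Lb -[X in _ = (_ * X)%E](fineK fCB) -EFinM -EFinB mulrBl.
Qed.

Lemma vol_sublevel : exists2 C : R, 0 < C &
  forall (z : Cd) t, B z -> 0 < t -> (V (sublevel z t) <= (C * t ^+ n.+2)%:E)%E.
Proof.
have [c c0 VE] := vol_leb; have [C C0 H] := lebesgue_sublevel R n.
(* The summand 4^(n+2) handles t > 1/4, where (4 t)^(n+2) already exceeds the volume 1 of the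
   ball. *)
exists (c * C + 4 ^+ n.+2).
  by apply: addr_gt0; [exact: mulr_gt0|exact: exprn_gt0].
move=> z t zB t0; rewrite mulrDl EFinD; have [t4|t4] := leP t (1 / 4).
  rewrite -[leLHS]adde0 leeD//; last by rewrite lee_fin mulr_ge0// exprn_ge0// ltW.
  by rewrite VE -mulrA EFinM; apply: lee_wpmul2l; [rewrite lee_fin ltW|exact: H].
rewrite -[leLHS]add0e leeD//.
  by rewrite lee_fin (mulr_ge0 (ltW (mulr_gt0 c0 C0)) (exprn_ge0 _ (ltW t0))).
apply: (@le_trans _ _ (V B)).
  apply: le_measure; rewrite ?inE//; first exact: measurable_sublevel.
    exact: measurable_unit_ball.
  by move=> w [].
by rewrite vol_ball -exprMn lee_fin exprn_ege1//; lra.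
Qed.

Lemma vol_shell_le : exists2 C : R, 0 < C & forall t, 0 < t ->
  (V (B `&` [set z : Cd | (1 - nsq z <= t)%R]) <= (C * t)%:E)%E.
Proof.
(* For t >= 1/2 the part 2 t >= 1 suffices; for smaller t the volume is 1 - (1 - t)^(n+1), at most
   (n + 1) t by Bernoulli's inequality. *)
exists (n.+1%:R + 2) => [|t t0]; first by rewrite addr_gt0// ltr0n.
have [t1|t1] := leP (1 / 2) t.
  apply: (@le_trans _ _ (V B)).
    apply: le_measure; rewrite ?inE//.
    - rewrite (_ : _ `&` _ = shell setT 0 t); first exact: measurable_shell.
      apply/seteqP; split => z /=.
        by move=> [/unit_ballE zB zt]; split=> //=; rewrite zt andbT; lra.
      by move=> [_ /= /andP[z0 zt]]; split => //; apply/unit_ballE; lra.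
    - exact: measurable_unit_ball.
  by rewrite vol_ball lee_fin; have := ler0n R n.+1; nra.
rewrite (_ : _ `&` _ = shell setT 0 t); last first.
  apply/seteqP; split => z /=.
    by move=> [/unit_ballE zB zt]; split=> //=; rewrite zt andbT; lra.
  by move=> [_ /= /andP[z0 zt]]; split => //; apply/unit_ballE; lra.
have [c c0 VE] := vol_leb; have := vol_ball; rewrite !VE.
rewrite lebesgue_shell//; [|lra..]; rewrite setTI muleCA => ->.
rewrite mule1 lee_fin subr0 expr1n.
suff : 1 - n.+1%:R * t <= (1 - t) ^+ n.+1 by lra.
have t01 : 0 <= 1 - t by lra.
elim: (n.+1) => [|k IH]; first by rewrite expr0; lra.
rewrite exprS -natr1; have := ler_wpM2l t01 IH; have := ler0n R k; nra.
Qed.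

Lemma vol_cone_shell : exists2 c : R, 0 < c & forall s, 0 < s -> s <= 1 / 2 ->
  ((c * s)%:E <= V (shell cone (s / 4) s))%E.
Proof.
have [c c0 VE] := vol_leb.
have fC : leb (cone `&` B) \is a fin_num.
  rewrite ge0_fin_numE// (le_lt_trans _ lebesgue_ball_fin)//.
  apply: le_measure; rewrite ?inE//; last exact: measurable_unit_ball.
  exact: measurableI measurable_cone (@measurable_unit_ball R n.+1).
have L0 : 0 < fine (leb (cone `&` B)).
  by rewrite fine_gt0// lebesgue_cone_gt0 -ge0_fin_numE.
(* With a = 1 - s/4 and b = 1 - s one has a^(n+1) - b^(n+1) >= (a - b) a^n, where a - b = 3 s / 4
   and a >= 1/2. *)
exists (c * (3 / 4 * (1 / 2) ^+ n) * fine (leb (cone `&` B))).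
  by rewrite !mulr_gt0// exprn_gt0.
move=> s s0 s2; rewrite VE lebesgue_shell//; [|exact: measurable_cone|exact: conic_cone|lra..].
rewrite -[X in (_ <= _ * (_ * X))%E](fineK fC) -!EFinM lee_fin.
move: L0; set L := fine _ => L0.
rewrite (_ : c * (3 / 4 * (1 / 2) ^+ n) * L * s =
  c * (3 / 4 * (1 / 2) ^+ n * s * L)); last by ring.
rewrite ler_pM2l// ler_pM2r//.
set a := 1 - s / 4; set b := 1 - s.
have ab : (1 / 2) ^+ n <= a ^+ n.
  by case: n => [|k]; rewrite ?expr0// ler_pXn2r ?nnegrE /a//; lra.
have ba : b ^+ n <= a ^+ n.
  by case: n => [|k]; rewrite ?expr0// ler_pXn2r ?nnegrE /a /b//; lra.
have b0 : 0 <= b by rewrite /b; lra.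
rewrite !exprS.
have := ler_wpM2l b0 ba.
have a3 : a - b = 3 / 4 * s by rewrite /a /b; lra.
have : (a - b) * (1 / 2) ^+ n <= (a - b) * a ^+ n by rewrite ler_wpM2l// a3; lra.
have := congr1 (fun x => x * a ^+ n) a3.
have := congr1 (fun x => x * (1 / 2) ^+ n) a3.
by rewrite /=; lra.
Qed.

End shells.

(** * Integrability of the kernel on the product of two balls *)

Section kernel_integral.
Variables (R : realType) (n : nat).
Local Open Scope complex_scope.
Local Notation Cd := (n.+1.-tuple R[i]).
Local Notation B := (@unit_ball R n.+1).
Local Notation V := (@vol R n.+1).

Lemma vol_sigma_finite : sigma_finite setT V.
Proof.
have [c c0 VE] := vol_leb R n.
have [F TF mF] := sigma_finiteT (lebesgue_Cn R n.+1).
exists F => // k; have [mFk Fk] := mF k; split => //.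
by rewrite VE lte_mul_pinfty// lee_fin ltW.
Qed.

(** The measure [vol] with the sigma-finite structure that Tonelli's theorem asks for. *)
Definition volS : {sigma_finite_measure set Cd -> \bar R} :=
  HB.pack (Measure.sort V) (Measure.class V)
    (Measure_isSigmaFinite.Build _ _ _ (Measure.sort V) vol_sigma_finite).

Lemma measurable_integral_slice (F : Cd * Cd -> \bar R) :
  measurable_fun setT F -> (forall p, 0 <= F p)%E ->
  measurable_fun setT (fun z => \int[V]_w F (z, w))%E.
Proof.
move=> mF F0.
exact: (measurable_fun_fubini_tonelli_F (m2 := volS) F mF F0).
Qed.

(** After extension by zero, the integral is the difference of those of the positive and negative
    parts, each measurable in z by Tonelli; integrability of the slices is not assumed. *)
Lemma measurable_integral_ball (F : Cd * Cd -> \bar R) :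
  measurable_fun (B `*` B) F ->
  measurable_fun B (fun z => \int[V]_(w in B) F (z, w))%E.
Proof.
move=> mF; have mB := @measurable_unit_ball R n.+1.
have mBB : measurable (B `*` B) by exact: measurableX.
pose G := F \_ (B `*` B).
have mG : measurable_fun setT G by apply/(measurable_restrictT F mBB); exact: mF.
apply: (@eq_measurable_fun _ _ _ _ _
   (fun z => \int[V]_w (G^\+ (z, w)) - \int[V]_w (G^\- (z, w)))%E).
  move=> z /[!inE] zB; transitivity (\int[V]_w G (z, w))%E.
    rewrite [RHS]integralE /=; congr (_ - _)%E; apply: eq_integral => w _.
      by rewrite !funeposE.
    by rewrite !funenegE.
  rewrite [RHS]integral_mkcond; apply: eq_integral => w _.
  rewrite /G !patchE; congr (if _ then _ else _).
  by apply/idP/idP; rewrite !inE //= => -[].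
apply: measurable_funTS; apply: emeasurable_funB; apply: measurable_integral_slice => //.
- exact: measurable_funepos.
- exact: measurable_funeneg.
Qed.

Lemma measurable_Rintegral_ball (F : Cd * Cd -> R) :
  measurable_fun (B `*` B) F ->
  measurable_fun B (fun z => \int[V]_(w in B) F (z, w)).
Proof.
move=> mF; apply: (measurableT_comp (fine_measurable measurableT)).
by apply: (measurable_integral_ball (F := EFin \o F)); apply/measurable_EFinP.
Qed.

(** On the ball, the common modulus of the kernels of K and K^+. *)
Definition kabs (a : R) (z w : Cd) : R := umod z w `^ (- a).

Lemma kabs_ge0 a z w : 0 <= kabs a z w. Proof. exact: powR_ge0. Qed.

Lemma measurable_kabs a : measurable_fun setT (fun p : Cd * Cd => kabs a p.1 p.2).
Proof.
exact: (measurableT_comp (measurable_powR (- a)) (@measurable_umod R n.+1)).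
Qed.

Definition kint (a : R) (z : Cd) : \bar R := (\int[V]_(w in B) (kabs a z w)%:E)%E.

Lemma measurable_kint a : measurable_fun B (kint a).
Proof.
apply: (measurable_integral_ball (F := fun p => (kabs a p.1 p.2)%:E)).
by apply: measurable_funTS; apply/measurable_EFinP; exact: measurable_kabs.
Qed.

Lemma dyadic_bracket (u : R) : 0 < u -> u <= 3 ->
  exists k : nat, 3 * (1 / 2) ^+ k.+1 < u <= 3 * (1 / 2) ^+ k.
Proof.
move=> u0 u3.
have ex : exists k : nat, 3 * (1 / 2) ^+ k.+1 < u.
  pose m := Num.truncn (3 / u); exists m.
  have um : 3 / u < m.+1%:R by exact: truncnS_gt.
  have m2 : (m.+1%:R : R) <= 2 ^+ m.+1.
    by rewrite -natrX ler_nat ltnW// ltn_expl.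
  rewrite div1r exprVn ltr_pdivrMr ?exprn_gt0//.
  by rewrite mulrC -ltr_pdivrMr// (lt_le_trans um).
case: (ex_minnP ex) => k kP kmin; exists k; rewrite kP /=.
case: k kP kmin => [|k] kP kmin; first by rewrite expr0 mulr1.
by rewrite leNgt; apply/negP => /kmin; rewrite ltnn.
Qed.

(** For a >= 0 there is no loss; for a < 0 the lower bound t / 2 < u costs the factor 2^|a|. One
    statement serves both signs. *)
Lemma powR_bracket (a t u : R) : 0 < t -> t / 2 < u -> u <= t ->
  u `^ a <= 2 `^ `|a| * t `^ a.
Proof.
move=> t0 tu ut; have u0 : 0 < u by lra.
have [a0|a0] := leP 0 a.
  apply: (@le_trans _ _ (t `^ a)).
    by apply: ge0_ler_powR => //; rewrite nnegrE ltW.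
  rewrite ler_peMl ?powR_ge0//.
  have /(@ler_powR _ _)/(_ 0 `|a| (normr_ge0 a)) : (1 : R) <= 2 by rewrite ler1n.
  by rewrite powRr0.
have v0 : 0 < t / 2 by lra.
rewrite ltr0_norm// [in t `^ a](_ : t = 2 * (t / 2)); last by field.
rewrite powRM ?(ltW v0)// mulrA -powRD ?addNr ?powRr0 ?eqxx ?mul1r; last first.
  by rewrite pnatr_eq0 implybT.
rewrite -[a in leLHS]opprK -[a in leRHS]opprK !(powRN _ (- a)).
rewrite lef_pV2 ?posrE ?powR_gt0//.
by apply: ge0_ler_powR; rewrite ?nnegrE ?ltW// oppr_gt0.
Qed.

Lemma powR_expn (x p : R) k : 0 <= x -> (x ^+ k) `^ p = (x `^ p) ^+ k.
Proof.
by move=> x0; rewrite -(powR_mulrn k x0) -(powR_mulrn k (powR_ge0 x p)) -!powRrM mulrC.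
Qed.

Lemma kabs_bracket a z w : B z -> B w -> exists k : nat,
  sublevel z (3 * (1 / 2) ^+ k) w /\
  kabs a z w <= 2 `^ `|a| * (3 * (1 / 2) ^+ k) `^ (- a).
Proof.
move=> zB wB; have [k /andP[k1 k2]] := dyadic_bracket (umod_gt0 zB wB) (umod_le3 zB wB).
exists k; split=> //; rewrite -[`|a|]normrN; apply: powR_bracket => //.
by move: k1; rewrite exprS; lra.
Qed.

Lemma nneseries_geometric_le (u : nat -> \bar R) (K q : R) : 0 <= K -> 0 <= q -> q < 1 ->
  (forall k, 0 <= u k)%E -> (forall k, u k <= (K * q ^+ k)%:E)%E ->
  (\sum_(0 <= k <oo) u k <= (K / (1 - q))%:E)%E.
Proof.
move=> K0 q0 q1 u0 uK; apply: lime_le.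
  by apply: is_cvg_nneseries => k _ _; exact: u0.
apply: nearW => m; apply: (@le_trans _ _ (\sum_(0 <= k < m) (K * q ^+ k)%:E)%E).
  by apply: lee_sum => k _; exact: uK.
rewrite sumEFin lee_fin -mulr_sumr ler_wpM2l// -[leRHS]mul1r ler_pdivlMr ?subr_gt0//.
rewrite big_mkord -subr_ge0 mulrC.
by have := subrX1 q m; have := exprn_ge0 m q0; lra.
Qed.

(* Dyadic decomposition: |u|^(-a) is summed over the sets |u| ~ t_k = 3 / 2^k, whose
   mass in (z, w) is O(t_k^(n+3)). *)
Lemma kint_lty a : a < (n.+1 + 2)%:R ->
  exists2 C : R, 0 <= C & (\int[V]_(z in B) kint a z <= C%:E)%E.
Proof.
move=> ha; pose t k : R := 3 * (1 / 2) ^+ k.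
have t0 k : 0 < t k by rewrite mulr_gt0// exprn_gt0.
have [C1 C10 HC1] := vol_sublevel R n; have [C2 C20 HC2] := vol_shell_le R n.
pose b k : R := 2 `^ `|a| * t k `^ (- a).
have b0 k : 0 <= b k by rewrite mulr_ge0// powR_ge0.
(* The sublevel set of z at height [t k] is empty unless z lies in this shell. This supplies the
   last factor [t k]. *)
pose S k : set Cd := B `&` [set z : Cd | 1 - nsq z <= 2 * t k].
have mB := @measurable_unit_ball R n.+1.
have mS k : measurable (S k).
  apply: measurableI => //.
  rewrite (_ : [set z : Cd | _] = (fun z : Cd => 1 - nsq z) @^-1` `]-oo, 2 * t k]%classic).
    apply: measurable_preimage (measurable_itv _).
    by apply: measurable_funB => //; exact: measurable_nsq.
  by apply/seteqP; split => z /=; rewrite in_itv.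
pose c k : R := b k * (C1 * t k ^+ n.+2).
have c0 k : 0 <= c k by rewrite mulr_ge0// mulr_ge0 ?exprn_ge0// ltW.
have kintle z : B z -> (kint a z <= \sum_(0 <= k <oo) (c k)%:E * (\1_(S k) z)%:E)%E.
  move=> zB.
  apply: (@le_trans _ _
    (\int[V]_(w in B) (\sum_(0 <= k <oo) (b k)%:E * (\1_(sublevel z (t k)) w)%:E))%E).
    apply: ge0_le_integral => //.
    - by move=> w _; rewrite lee_fin kabs_ge0.
    - apply: measurable_funTS; apply/measurable_EFinP.
      exact: (measurable_section1 z (measurable_kabs a)).
    - apply: measurable_funTS; apply: ge0_emeasurable_sum => k.
        by move=> w _ _; rewrite mule_ge0 ?lee_fin.
      move=> _; apply: emeasurable_funM => //.
      by apply/measurable_EFinP; apply: measurable_indic; exact: measurable_sublevel.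
    - move=> w wB; have [k [kw kb]] := kabs_bracket a zB wB.
      apply: (le_trans _ (nneseries_lim_ge k.+1 _)); last first.
        by move=> m _ _; rewrite mule_ge0 ?lee_fin.
      rewrite big_nat_recr//= -[leLHS]add0e leeD//.
        by apply: sume_ge0 => i _; rewrite mule_ge0 ?lee_fin.
      by rewrite indicE mem_set// mule1 lee_fin.
  rewrite integral_nneseries//; last 2 first.
  - move=> k; apply: measurable_funTS; apply: emeasurable_funM => //.
    by apply/measurable_EFinP; apply: measurable_indic; exact: measurable_sublevel.
  - by move=> k w _; rewrite mule_ge0 ?lee_fin.
  apply: lee_nneseries => [k _ _|k _].
    by apply: integral_ge0 => w _; rewrite mule_ge0 ?lee_fin.
  rewrite ge0_integralZl//; last 2 first.
  - apply: measurable_funTS; apply/measurable_EFinP; apply: measurable_indic.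
    exact: measurable_sublevel.
  - by rewrite lee_fin.
  rewrite integral_indic//; last exact: measurable_sublevel.
  rewrite (_ : sublevel z (t k) `&` B = sublevel z (t k)); last first.
    by apply: setIidl => w [].
  rewrite /c (EFinM (b k)) -(muleA (b k)%:E); apply: lee_wpmul2l; rewrite ?lee_fin//.
  rewrite indicE; have [_|zS] := boolP (z \in S k).
    by rewrite mule1; exact: HC1.
  rewrite (_ : sublevel _ _ = set0) ?measure0 ?mule0//.
  apply/seteqP; split=> // w [wB uw]; move/negP: zS; apply; rewrite inE; split => //.
  exact: sublevel_nsq uw.
(* Ratio of the geometric series: the k-th term is a constant times [t k] to the power n + 3 - a,
   and the exponent is positive by hypothesis. *)
pose q : R := (1 / 2) `^ ((n.+1 + 2)%:R - a).
have q0 : 0 <= q by exact: powR_ge0.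
have q1 : q < 1.
  have p0 : 0 < (n.+1 + 2)%:R - a by lra.
  have := @gt0_ltr_powR R _ p0 (1 / 2) 1; rewrite powR1 !nnegrE; apply; lra.
pose K : R := 2 `^ `|a| * C1 * (C2 * 2) * 3 `^ ((n.+1 + 2)%:R - a).
have K0 : 0 <= K by rewrite !mulr_ge0 ?powR_ge0// ltW.
exists (K / (1 - q)); first by rewrite divr_ge0// subr_ge0 ltW.
apply: (@le_trans _ _ (\int[V]_(z in B) (\sum_(0 <= k <oo) (c k)%:E * (\1_(S k) z)%:E))%E).
  apply: ge0_le_integral => //.
  - by move=> z _; apply: integral_ge0 => w _; rewrite lee_fin kabs_ge0.
  - exact: measurable_kint.
  - apply: measurable_funTS; apply: ge0_emeasurable_sum => k.
      by move=> w _ _; rewrite mule_ge0 ?lee_fin.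
    move=> _; apply: emeasurable_funM => //.
    by apply/measurable_EFinP; exact: measurable_indic.
rewrite integral_nneseries//; last 2 first.
- move=> k; apply: measurable_funTS; apply: emeasurable_funM => //.
  by apply/measurable_EFinP; exact: measurable_indic.
- by move=> k w _; rewrite mule_ge0 ?lee_fin.
apply: nneseries_geometric_le => // k.
  by apply: integral_ge0 => w _; rewrite mule_ge0 ?lee_fin.
rewrite ge0_integralZl//; last 2 first.
- by apply: measurable_funTS; apply/measurable_EFinP; exact: measurable_indic.
- by rewrite lee_fin.
rewrite integral_indic// setIidl; last by move=> z [].
apply: (@le_trans _ _ ((c k)%:E * (C2 * (2 * t k))%:E)%E).
  by apply: lee_wpmul2l; rewrite ?lee_fin//; apply: HC2; rewrite mulr_gt0.
rewrite -EFinM lee_fin le_eqVlt; apply/orP; left; apply/eqP.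
have E : q ^+ k * 3 `^ ((n.+1 + 2)%:R - a) = t k `^ (- a) * t k ^+ n.+2 * t k.
  rewrite -mulrA -exprSr -[X in _ = _ * X]powR_mulrn ?ltW// -powRD; last first.
    by rewrite (gt_eqF (t0 k)) implybT.
  rewrite [- a + _]addrC (_ : n.+3 = (n.+1 + 2)%N); last by rewrite addn2.
  rewrite /t powRM// ?exprn_ge0// mulrC /q; congr (_ * _).
  by rewrite powR_expn.
rewrite /c /b /K; ring: E.
Qed.

End kernel_integral.

(** * Measurability of complex-valued functions *)

Section complex_measurability.
Context d (T : measurableType d) (R : realType).

Lemma measurable_funC (D : set T) (f : T -> R[i]) :
  measurable_fun D (fun x => complex.Re (f x)) ->
  measurable_fun D (fun x => complex.Im (f x)) -> measurable_fun D f.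
Proof.
move=> mr mi mD; move: (mD).
pose h := @mkcomplex R \o (fun x => (((fun x => complex.Re (f x)) \_ D) x : measurableTypeR R,
  ((fun x => complex.Im (f x)) \_ D) x : measurableTypeR R)).
apply: (@eq_measurable_fun _ _ _ _ D h).
  move=> x xD; rewrite /h /= !patchE xD /mkcomplex /=.
  by case: (f x).
apply: measurable_funTS; apply: measurableT_comp; first exact: measurable_mkcomplex.
apply: measurable_fun_pair.
  exact: (measurable_restrictT _ mD).1 mr.
exact: (measurable_restrictT _ mD).1 mi.
Qed.

Lemma measurable_Re_fun (D : set T) (f : T -> R[i]) :
  measurable_fun D f -> measurable_fun D (fun x => complex.Re (f x)).
Proof. by move=> mf; exact: (measurableT_comp (@measurable_Re R)). Qed.

Lemma measurable_Im_fun (D : set T) (f : T -> R[i]) :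
  measurable_fun D f -> measurable_fun D (fun x => complex.Im (f x)).
Proof. by move=> mf; exact: (measurableT_comp (@measurable_Im R)). Qed.

Lemma normc_ReIm (x : R[i]) : normc x = Num.sqrt (complex.Re x ^+ 2 + complex.Im x ^+ 2).
Proof. by case: x. Qed.

Lemma normc_ge0 (x : R[i]) : 0 <= normc x.
Proof. by rewrite normc_ReIm sqrtr_ge0. Qed.

Lemma Re_normc (x : R[i]) : `|complex.Re x| <= normc x.
Proof. by rewrite normc_ReIm -sqrtr_sqr ler_wsqrtr// lerDl sqr_ge0. Qed.

Lemma Im_normc (x : R[i]) : `|complex.Im x| <= normc x.
Proof. by rewrite normc_ReIm -sqrtr_sqr ler_wsqrtr// lerDr sqr_ge0. Qed.

Lemma normc_le_ReIm (x : R[i]) : normc x <= `|complex.Re x| + `|complex.Im x|.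
Proof.
rewrite -(@ler_pXn2r _ 2) ?nnegrE ?addr_ge0 ?normc_ge0// normc_ReIm sqr_sqrtr ?addr_ge0 ?sqr_ge0//.
rewrite sqrrD !real_normK ?num_real//.
have := mulr_ge0 (normr_ge0 (complex.Re x)) (normr_ge0 (complex.Im x)); lra.
Qed.

Lemma ReB (x y : R[i]) : complex.Re (x - y) = complex.Re x - complex.Re y.
Proof. by case: x y => ? ? []. Qed.

Lemma ImB (x y : R[i]) : complex.Im (x - y) = complex.Im x - complex.Im y.
Proof. by case: x y => ? ? []. Qed.

Lemma measurable_funCB (D : set T) (f g : T -> R[i]) : measurable_fun D f ->
  measurable_fun D g -> measurable_fun D (fun x => f x - g x).
Proof.
move=> mf mg; apply: measurable_funC.
  by under eq_fun do rewrite ReB; apply: measurable_funB; exact: measurable_Re_fun.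
by under eq_fun do rewrite ImB; apply: measurable_funB; exact: measurable_Im_fun.
Qed.

Lemma measurable_normc_fun (D : set T) (f : T -> R[i]) :
  measurable_fun D f -> measurable_fun D (fun x => normc (f x)).
Proof.
move=> mf; under eq_fun do rewrite normc_ReIm.
apply: (measurableT_comp (continuous_measurable_fun (@sqrt_continuous R))).
by apply: measurable_funD; apply: measurable_funX;
  [exact: measurable_Re_fun|exact: measurable_Im_fun].
Qed.

End complex_measurability.

(** * Comparison of the L^p norms on the ball *)

Section ball_norms.
Variables (R : realType) (n : nat).
Local Open Scope complex_scope.
Local Notation Cd := (n.+1.-tuple R[i]).
Local Notation B := (@unit_ball R n.+1).
Local Notation V := (@vol R n.+1).
Let mB := @measurable_unit_ball R n.+1.

Lemma ball_norm1E (f : Cd -> R[i]) :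
  ball_norm 1 f = (\int[V]_(z in B) (normc (f z))%:E)%E.
Proof.
rewrite /ball_norm Lnorm1 [RHS]integral_mkcond; apply: eq_integral => z _.
by rewrite gee0_abs// patchE; case: ifPn => // _; rewrite lee_fin normc_ge0.
Qed.

Lemma vol_gt0 : (0 < V [set: Cd])%E.
Proof.
apply: (@lt_le_trans _ _ (V B)); first by rewrite vol_ball lte_fin.
by apply: le_measure; rewrite ?inE.
Qed.

Lemma ball_norm_pinfty_le (f : Cd -> R[i]) M : 0 <= M ->
  (forall z, B z -> normc (f z) <= M) -> (ball_norm +oo f <= M%:E)%E.
Proof.
move=> M0 fM; rewrite /ball_norm unlock vol_gt0; apply/ess_supP.
apply: nearW => z /=; rewrite patchE; case: ifPn => [/set_mem zB|_].
  by rewrite gee0_abs ?lee_fin ?normc_ge0 ?fM.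
by rewrite abse0 lee_fin.
Qed.

Lemma ball_norm_pinfty_ae (f : Cd -> R[i]) M : (ball_norm +oo f <= M%:E)%E ->
  {ae V, forall z, B z -> normc (f z) <= M}.
Proof.
rewrite /ball_norm unlock vol_gt0 => /ess_supP.
apply: filterS => z /=; rewrite patchE => + zB.
by rewrite mem_set// gee0_abs ?lee_fin ?normc_ge0.
Qed.

(** Because the ball has measure 1, one bounded test function serves all exponents [p] at once. *)
Lemma ball_norm_le1 (p : \bar R) (f : Cd -> R[i]) : (1 <= p)%E ->
  measurable_fun B f -> (forall z, B z -> normc (f z) <= 1) ->
  (ball_norm p f <= 1)%E.
Proof.
case: p => [p| |] // p1 mf f1; last exact: ball_norm_pinfty_le.
rewrite lee_fin in p1; have p0 : 0 < p by rewrite (lt_le_trans ltr01).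
rewrite /ball_norm unlock -[leRHS](poweR1r p^-1).
apply: gt0_ler_poweR; rewrite ?in_itv/= ?invr_ge0 ?(ltW p0)// ?leey ?andbT ?lee_fin//.
  by rewrite integral_ge0// => z _; exact: poweR_ge0.
rewrite -[1%E](vol_ball R n) -[leRHS]mul1e -integral_cst// [leRHS]integral_mkcond.
apply: ge0_le_integral => //.
- by move=> z _; exact: poweR_ge0.
- apply: (measurableT_comp (measurable_poweR p)).
  apply: measurableT_comp => //; apply/(measurable_restrictT _ mB).
  by apply/measurable_EFinP; exact: measurable_normc_fun.
- by apply/(measurable_restrictT _ mB); exact: measurable_cst.
- move=> z _; rewrite !patchE; case: ifPn => [/set_mem zB|_].
    rewrite gee0_abs ?lee_fin ?normc_ge0//.
    have <- : 1 `^ p = 1 :> R by rewrite powR1.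
    by apply: ge0_ler_powR; rewrite ?nnegrE ?normc_ge0 ?f1 ?(ltW p0).
  by change (`|0| `^ p <= 0)%E; rewrite abse0 poweR0r// gt_eqF.
Qed.

Lemma measurable_ball_norm_fun (f : Cd -> R[i]) : measurable_fun B f ->
  measurable_fun B (fun z => (normc (f z))%:E).
Proof. by move=> mf; apply/measurable_EFinP; exact: measurable_normc_fun. Qed.

(** For finite q this follows from x <= 1 + x^q, in place of Jensen's inequality. The bound 1 + M^q
    is not homogeneous, but only its dependence on [M] alone matters. *)
Lemma L1_le_of_Lq (q : \bar R) (M : R) : (1 <= q)%E -> 0 <= M ->
  exists2 M' : R, 0 <= M' & forall f : Cd -> R[i], measurable_fun B f ->
    (ball_norm q f <= M%:E)%E -> (ball_norm 1 f <= M'%:E)%E.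
Proof.
case: q => [q| |] // q1 M0; last first.
  exists M => // f mf /ball_norm_pinfty_ae fM; rewrite ball_norm1E.
  rewrite -[leRHS]mule1 -(vol_ball R n) -integral_cst//.
  apply: ae_ge0_le_integral => //.
  - by move=> z _; rewrite lee_fin normc_ge0.
  - exact: measurable_ball_norm_fun.
rewrite lee_fin in q1; have q0 : 0 < q by rewrite (lt_le_trans ltr01).
exists (1 + M `^ q) => [|f mf fM]; first by rewrite addr_ge0// powR_ge0.
have E : (\int[V]_(z in B) (normc (f z) `^ q)%:E <= (M `^ q)%:E)%E.
  have : (ball_norm q%:E f `^ q <= M%:E `^ q)%E.
    apply: gt0_ler_poweR; rewrite ?in_itv/= ?(ltW q0)// ?leey ?andbT ?lee_fin//.
    exact: Lnorm_ge0.
  rewrite poweR_Lnorm ?gt_eqF// poweR_EFin; congr (_ <= _)%E.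
  rewrite [RHS]integral_mkcond; apply: eq_integral => z _.
  rewrite !patchE; case: ifPn => _; last by rewrite abse0 poweR0r// gt_eqF.
  by rewrite gee0_abs ?lee_fin ?normc_ge0// poweR_EFin.
rewrite ball_norm1E.
apply: (@le_trans _ _ (\int[V]_(z in B) (1%:E + (normc (f z) `^ q)%:E))%E).
  apply: ge0_le_integral => //.
  - by move=> z _; rewrite lee_fin normc_ge0.
  - exact: measurable_ball_norm_fun.
  - apply: emeasurable_funD => //; apply/measurable_EFinP.
    by apply: (measurableT_comp (measurable_powR q)); exact: measurable_normc_fun.
  - move=> z _; rewrite lee_fin; set x := normc _.
    have x0 : 0 <= x by exact: normc_ge0.
    have [x1|x1] := leP x 1; first by have := powR_ge0 x q; lra.
    have /(@ler_powR _ _)/(_ _ _ q1) : 1 <= x by exact: ltW.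
    by rewrite powRr1//; lra.
rewrite ge0_integralD//.
- by rewrite integral_cst// mul1e vol_ball EFinD leeD.
- by move=> z _; rewrite lee_fin powR_ge0.
- apply/measurable_EFinP.
  by apply: (measurableT_comp (measurable_powR q)); exact: measurable_normc_fun.
Qed.

End ball_norms.

(** * Integral operators dominated by |1 - <z, w>|^(-a) *)

Section integral_operators.
Variables (R : realType) (n : nat).
Local Open Scope complex_scope.
Local Notation Cd := (n.+1.-tuple R[i]).
Local Notation B := (@unit_ball R n.+1).
Local Notation V := (@vol R n.+1).
Let mB := @measurable_unit_ball R n.+1.

Definition op (k : Cd -> Cd -> R[i]) (f : Cd -> R[i]) (z : Cd) : R[i] :=
  cintegral (fun w => f w * k z w).

(** What the kernels of K and K^+ have in common. Real and imaginary parts are treated separately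
    because [cintegral] integrates them separately. *)
Definition dominated (a : R) (k : Cd -> Cd -> R[i]) :=
  [/\ measurable_fun (B `*` B) (fun p => complex.Re (k p.1 p.2)),
      measurable_fun (B `*` B) (fun p => complex.Im (k p.1 p.2)) &
      forall z w, B z -> B w ->
        `|complex.Re (k z w)| <= kabs a z w /\ `|complex.Im (k z w)| <= kabs a z w].

Definition opRe k (f : Cd -> R[i]) (p : Cd * Cd) : R :=
  complex.Re (f p.2) * complex.Re (k p.1 p.2) - complex.Im (f p.2) * complex.Im (k p.1 p.2).

Definition opIm k (f : Cd -> R[i]) (p : Cd * Cd) : R :=
  complex.Re (f p.2) * complex.Im (k p.1 p.2) + complex.Im (f p.2) * complex.Re (k p.1 p.2).

Lemma Re_op k f z : complex.Re (op k f z) = \int[V]_(w in B) opRe k f (z, w).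
Proof.
apply: eq_Rintegral => w _; rewrite /opRe /=.
by case: (f w) (k z w) => a b [c e].
Qed.

Lemma Im_op k f z : complex.Im (op k f z) = \int[V]_(w in B) opIm k f (z, w).
Proof.
apply: eq_Rintegral => w _; rewrite /opIm /=.
by case: (f w) (k z w) => a b [c e].
Qed.

Lemma measurable_funB2 d (T : measurableType d) (g : Cd -> T) :
  measurable_fun B g -> measurable_fun (B `*` B) (fun p => g p.2).
Proof.
move=> mg; apply: (@measurable_comp _ _ _ _ _ _ B g) => //.
  by move=> _ [p [_ pB] <-].
exact: (measurable_funTS measurable_snd).
Qed.

Lemma measurable_opRe a k f : dominated a k -> measurable_fun B f ->
  measurable_fun (B `*` B) (opRe k f).
Proof.
move=> [mr mi _] mf; apply: measurable_funB; apply: measurable_funM => //.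
  exact: (measurable_funB2 (measurable_Re_fun mf)).
exact: (measurable_funB2 (measurable_Im_fun mf)).
Qed.

Lemma measurable_opIm a k f : dominated a k -> measurable_fun B f ->
  measurable_fun (B `*` B) (opIm k f).
Proof.
move=> [mr mi _] mf; apply: measurable_funD; apply: measurable_funM => //.
  exact: (measurable_funB2 (measurable_Re_fun mf)).
exact: (measurable_funB2 (measurable_Im_fun mf)).
Qed.

Lemma measurable_op a k f : dominated a k -> measurable_fun B f ->
  measurable_fun B (op k f).
Proof.
move=> dk mf; apply: measurable_funC.
  under eq_fun do rewrite Re_op.
  exact: (measurable_Rintegral_ball (measurable_opRe dk mf)).
under eq_fun do rewrite Im_op.
exact: (measurable_Rintegral_ball (measurable_opIm dk mf)).
Qed.

Lemma measurable_ball_slice d (T : measurableType d) (F : Cd * Cd -> T) z : B z ->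
  measurable_fun (B `*` B) F -> measurable_fun B (fun w => F (z, w)).
Proof.
move=> zB mF; apply: (@measurable_comp _ _ _ _ _ _ (B `*` B) F) => //.
- exact: measurableX.
- by move=> _ [w wB <-].
- by apply: measurable_funTS; exact: measurable_fun_pair.
Qed.

Lemma Rintegral_ball_le (g : Cd -> R) (N : R) a z : 0 <= N -> B z ->
  measurable_fun B g -> {ae V, forall w, B w -> `|g w| <= N * kabs a z w} ->
  (`|\int[V]_(w in B) g w|%:E <= N%:E * kint a z)%E.
Proof.
move=> N0 zB mg gN.
have mk : measurable_fun B (fun w => (kabs a z w)%:E).
  apply: measurable_funTS; apply/measurable_EFinP.
  exact: (measurable_section1 z (@measurable_kabs R n a)).
apply: (@le_trans _ _ (`|\int[V]_(w in B) (g w)%:E|)%E).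
  (* An infinite integral is sent to 0 by [Rintegral], so the inequality holds in that case too. *)
  by rewrite /Rintegral; case: (integral _ _ _) => [r| |] /=; rewrite ?normr0 ?leey.
apply: (le_trans (le_abse_integral _ _ _)) => //.
  by apply/measurable_EFinP.
rewrite /kint -ge0_integralZl//; last first.
  by move=> w _; rewrite lee_fin kabs_ge0.
apply: ae_ge0_le_integral => //.
- by apply: measurableT_comp => //; apply/measurable_EFinP.
- by move=> w _; rewrite mule_ge0 ?lee_fin ?kabs_ge0.
- exact: emeasurable_funM.
Qed.

Lemma op_le a k f N z : dominated a k -> measurable_fun B f -> 0 <= N -> B z ->
  {ae V, forall w, B w -> normc (f w) <= N} ->
  ((normc (op k f z))%:E <= (4 * N)%:E * kint a z)%E.
Proof.
move=> dk mf N0 zB fN; have [_ _ kk] := dk.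
have kint0 : (0 <= kint a z)%E by apply: integral_ge0 => w _; rewrite lee_fin kabs_ge0.
apply: (@le_trans _ _ (`|complex.Re (op k f z)|%:E + `|complex.Im (op k f z)|%:E)%E).
  by rewrite -EFinD lee_fin normc_le_ReIm.
(* The real and the imaginary part of f(w) k(z, w) each consist of two products bounded by N
   |u|^(-a). *)
rewrite (_ : 4 * N = 2 * N + 2 * N); last by ring.
rewrite EFinD ge0_muleDl ?lee_fin ?mulr_ge0// Re_op Im_op leeD//.
  apply: Rintegral_ball_le; rewrite ?mulr_ge0//.
    exact: (measurable_ball_slice zB (measurable_opRe dk mf)).
  apply: filterS fN => w fN wB; have {}fN := fN wB.
  have [kr ki] := kk z w zB wB; rewrite /opRe /=.
  rewrite (le_trans (ler_normB _ _))// !normrM.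
  have := ler_pM (normr_ge0 _) (normr_ge0 _) (le_trans (Re_normc _) fN) kr.
  have := ler_pM (normr_ge0 _) (normr_ge0 _) (le_trans (Im_normc _) fN) ki.
  by lra.
apply: Rintegral_ball_le; rewrite ?mulr_ge0//.
  exact: (measurable_ball_slice zB (measurable_opIm dk mf)).
apply: filterS fN => w fN wB; have {}fN := fN wB.
have [kr ki] := kk z w zB wB; rewrite /opIm /=.
rewrite (le_trans (ler_normD _ _))// !normrM.
have := ler_pM (normr_ge0 _) (normr_ge0 _) (le_trans (Re_normc _) fN) ki.
have := ler_pM (normr_ge0 _) (normr_ge0 _) (le_trans (Im_normc _) fN) kr.
by lra.
Qed.

Lemma op_bounded a k : a < (n.+1 + 2)%:R -> dominated a k ->
  bounded_Lp +oo 1 (op k).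
Proof.
move=> ha dk; have [C C0 HC] := kint_lty ha; exists (4 * C) => f [mf fy].
have N0 : (0 <= ball_norm +oo f)%E by exact: Lnorm_ge0.
have NE : ball_norm +oo f = (fine (ball_norm +oo f))%:E.
  by rewrite fineK// ge0_fin_numE.
move: NE; set N := fine _ => NE.
have N0' : 0 <= N by rewrite fine_ge0.
have fN : {ae V, forall w, B w -> normc (f w) <= N}.
  by apply: ball_norm_pinfty_ae; rewrite NE.
have mT := measurable_op dk mf.
have main : (ball_norm 1 (op k f) <= (4 * C)%:E * ball_norm +oo f)%E.
  rewrite NE -EFinM ball_norm1E.
  apply: (@le_trans _ _ (\int[V]_(z in B) ((4 * N)%:E * kint a z))%E).
    apply: ge0_le_integral => //.
    - by move=> z _; rewrite lee_fin normc_ge0.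
    - exact: measurable_ball_norm_fun.
    - by apply: emeasurable_funM => //; exact: measurable_kint.
    - by move=> z zB; exact: op_le.
  rewrite ge0_integralZl//; last 3 first.
  - exact: measurable_kint.
  - by move=> z _; apply: integral_ge0 => w _; rewrite lee_fin kabs_ge0.
  - by rewrite lee_fin mulr_ge0.
  rewrite (_ : 4 * C * N = 4 * N * C); last by ring.
  by rewrite (EFinM (4 * N)); apply: lee_wpmul2l => //; rewrite lee_fin mulr_ge0.
split=> //; split=> //; apply: (le_lt_trans main).
by rewrite NE -EFinM ltry.
Qed.

End integral_operators.

(** * The kernels of K and K^+ in real terms *)

Section kernels.
Variables (R : realType) (n : nat) (a : R).
Local Open Scope complex_scope.
Local Notation Cd := (n.+1.-tuple R[i]).
Local Notation B := (@unit_ball R n.+1).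

Definition ker (z w : Cd) : R[i] := (cpow (1 - cinner z w) a)^-1.
Definition kerp (z w : Cd) : R[i] := ((normc (1 - cinner z w) `^ a)%:C)^-1.

Lemma K_op : @K R n.+1 a = op ker. Proof. by []. Qed.
Lemma Kplus_op : @Kplus R n.+1 a = op kerp. Proof. by []. Qed.

(** Since Re u > 0 on the ball, the argument of u is an arctangent; this form is visibly continuous,
    unlike the case distinction in [carg]. *)
Definition uarg (z w : Cd) : R := atan (uim z w / ure z w).

(** For x > 0 the quotient x / |x + iy| is the cosine of atan (y / x); the sign of y decides whether
    [acos] returns this angle or its opposite. *)
Lemma carg_atan (x y : R) : 0 < x -> carg (x +i* y) = atan (y / x).
Proof.
move=> x0; rewrite /carg /=.
have E : x / Num.sqrt (x ^+ 2 + y ^+ 2) = cos (atan (y / x)).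
  rewrite cos_atan; have -> : 1 + (y / x) ^+ 2 = (x ^+ 2 + y ^+ 2) / x ^+ 2.
    by field; rewrite gt_eqF.
  rewrite sqrtrM ?addr_ge0 ?sqr_ge0// sqrtrV ?sqr_ge0// sqrtr_sqr gtr0_norm//.
  by rewrite invfM invrK mulrC.
rewrite E; have := atan_ltpi2 (y / x); have := atan_gtNpi2 (y / x).
have pi0 := pi_gt0 R.
case: ifPn => y0 h1 h2.
  rewrite cosK// in_itv/=; apply/andP; split; last lra.
  by rewrite -[leLHS](atan0 R); apply: le_atan; rewrite divr_ge0// ltW.
rewrite -ltNge in y0.
rewrite -cosN cosK ?opprK// in_itv/=; apply/andP; split; last lra.
rewrite oppr_ge0 -[leRHS](atan0 R); apply: le_atan.
by rewrite ler_pdivrMr// mul0r ltW.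
Qed.

Lemma kerE z w : B z -> B w ->
  ker z w = kabs a z w * cos (a * uarg z w) +i* (- (kabs a z w * sin (a * uarg z w))).
Proof.
move=> zB wB; have u0 := ure_gt0 zB wB; have m0 := umod_gt0 zB wB.
(* The inverse is recognized by its product with the power, which reduces to cos^2 + sin^2 = 1 and
   also shows that the power is nonzero. *)
set x := _ +i* _; suff E : cpow (1 - cinner z w) a * x = 1.
  have nz : cpow (1 - cinner z w) a != 0.
    apply/eqP => e0; move: E; rewrite e0 mul0r => /esym/eqP.
    by rewrite oner_eq0.
  by rewrite /ker -[RHS](mulKf nz) E mulr1.
rewrite /cpow /cexp /clog normc_u cinnerE carg_atan// -/(uarg z w) /x /=.
rewrite !mul0r subr0 addr0 /kabs powRN /powR gt_eqF//.
set r := expR _; set t := a * _; have r0 : 0 < r by exact: expR_gt0.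
have cs := cos2Dsin2 t.
apply/eqP; rewrite eq_complex /=; apply/andP; split; apply/eqP.
  transitivity (cos t ^+ 2 + sin t ^+ 2); last exact: cs.
  by field; rewrite gt_eqF.
by field; rewrite gt_eqF.
Qed.

Lemma kerpE z w : B z -> B w -> kerp z w = kabs a z w +i* 0.
Proof.
move=> zB wB; rewrite /kerp normc_u /kabs powRN.
have m0 := umod_gt0 zB wB; have p0 := powR_gt0 a m0.
apply/eqP; rewrite eq_complex /= expr0n /= addr0 mul0r oppr0 eqxx andbT.
by apply/eqP; field; rewrite gt_eqF.
Qed.

Lemma measurable_uarg : measurable_fun (B `*` B) (fun p => uarg p.1 p.2).
Proof.
apply: (@eq_measurable_fun _ _ _ _ _
  (* The real power -1 is measurable on all of R and agrees with the inverse where Re u > 0. *)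
  (fun p => atan (uim p.1 p.2 * ure p.1 p.2 `^ (-1)))).
  move=> p /[!inE] -[p1 p2]; rewrite /uarg powR_inv1//.
  by rewrite ltW// ure_gt0.
apply: measurable_funTS.
apply: (measurableT_comp (continuous_measurable_fun (@continuous_atan R))).
apply: measurable_funM; first exact: measurable_uim.
exact: (measurableT_comp (measurable_powR (-1)) (@measurable_ure R n.+1)).
Qed.

Lemma dominated_ker : dominated a ker.
Proof.
have mk : measurable_fun (B `*` B) (fun p => kabs a p.1 p.2).
  by apply: measurable_funTS; exact: measurable_kabs.
have mt : measurable_fun (B `*` B) (fun p => a * uarg p.1 p.2).
  by apply: measurable_funM => //; exact: measurable_uarg.
split.
- apply: (@eq_measurable_fun _ _ _ _ _
    (fun p => kabs a p.1 p.2 * cos (a * uarg p.1 p.2))).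
    by move=> p /[!inE] -[p1 p2]; rewrite kerE.
  apply: measurable_funM => //.
  exact: (measurableT_comp (continuous_measurable_fun (@continuous_cos R)) mt).
- apply: (@eq_measurable_fun _ _ _ _ _
    (fun p => - (kabs a p.1 p.2 * sin (a * uarg p.1 p.2)))).
    by move=> p /[!inE] -[p1 p2]; rewrite kerE.
  apply: measurable_funN; apply: measurable_funM => //.
  exact: (measurableT_comp (continuous_measurable_fun (@continuous_sin R)) mt).
- move=> z w zB wB; rewrite kerE//= normrN !normrM ger0_norm ?kabs_ge0//.
  split; rewrite ler_piMr ?kabs_ge0// ler_norml; apply/andP.
    by split; [exact: cos_geN1|exact: cos_le1].
  by split; [exact: sin_geN1|exact: sin_le1].
Qed.

Lemma dominated_kerp : dominated a kerp.
Proof.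
split.
- apply: (@eq_measurable_fun _ _ _ _ _ (fun p => kabs a p.1 p.2)).
    by move=> p /[!inE] -[p1 p2]; rewrite kerpE.
  by apply: measurable_funTS; exact: measurable_kabs.
- apply: (@eq_measurable_fun _ _ _ _ _ (cst 0 : Cd * Cd -> R)) => //.
  by move=> p /[!inE] -[p1 p2]; rewrite kerpE.
- move=> z w zB wB; rewrite kerpE//= normr0 ger0_norm ?kabs_ge0//.
Qed.

End kernels.

(** * Compactness *)

Lemma strictly_increasing_ge (f : nat -> nat) : {homo f : m n / (m < n)%N} ->
  forall n, (n <= f n)%N.
Proof.
move=> hf; elim=> // n IH; apply: (leq_ltn_trans IH); exact: hf.
Qed.

Section diagonal_extraction.
Variables (R : realType) (x : nat -> nat -> R).
Hypothesis xb : forall i, exists C : R, forall n, `|x i n| <= C.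

Let extract (psi : nat -> nat) i : {th : nat -> nat |
  {homo th : m n / (m < n)%N} /\ cvgn (x i \o psi \o th)}.
Proof.
apply: cid; have [C xC] := xb i.
have [|th hth cth] := @bolzano_weierstrass R (x i \o psi).
  exists C; split; first exact: num_real.
  by move=> y Cy m _; exact: le_trans (xC _) (ltW Cy).
exists th; split => // m n mn.
by rewrite (leqW_mono hth).
Qed.

(** Nested subsequences: along [Psi i] the sequences of index less than i converge. *)
Let Psi := fix Psi i := if i is i'.+1 then Psi i' \o sval (extract (Psi i') i') else id.

Let Psi_homo i : {homo Psi i : m n / (m < n)%N}.
Proof.
elim: i => [//|i IH] m n mn /=; apply: IH.
by have [h _] := svalP (extract (Psi i) i); exact: h.
Qed.

(** Later subsequences refine earlier ones without moving a position backwards. Hence the diagonal,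
    from index k on, runs through [Psi k] at positions that tend to infinity. *)
Let Psi_sub k n m : (k <= n)%N -> exists2 m', (m <= m')%N & Psi n m = Psi k m'.
Proof.
elim: n m => [|n IH] m; first by rewrite leqn0 => /eqP ->; exists m.
rewrite leq_eqVlt => /predU1P[->|]; first by exists m.
rewrite ltnS => kn; have [h _] := svalP (extract (Psi n) n).
have [m' mm' E] := IH (sval (extract (Psi n) n) m) kn.
exists m' => //; apply: leq_trans mm'; exact: strictly_increasing_ge.
Qed.

Lemma diagonal_extraction : exists phi : nat -> nat,
  {homo phi : m n / (m < n)%N} /\ forall i, cvgn (x i \o phi).
Proof.
exists (fun n => Psi n n); split.
  apply: homo_ltn; first exact: ltn_trans.
  move=> n /=; apply: Psi_homo; have [h _] := svalP (extract (Psi n) n).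
  exact: strictly_increasing_ge.
move=> i; have [_ ci] := svalP (extract (Psi i) i).
have /cvg_ex[l cl] : cvgn (x i \o Psi i.+1) by exact: ci.
apply/cvg_ex; exists l; apply/cvgrPdist_lt => e e0.
move/cvgrPdist_lt : cl => /(_ e e0) [N _ HN].
exists (maxn N i.+1) => // n /=; rewrite geq_max => /andP[Nn iN].
have [m' nm' ->] := Psi_sub n iN.
by apply: HN => /=; exact: leq_trans nm'.
Qed.

End diagonal_extraction.

Lemma cvg_sumr (R : realType) (I : Type) (r : seq I) (f : I -> nat -> R) (l : I -> R) :
  (forall i, f i m @[m --> \oo] --> l i) ->
  \sum_(i <- r) f i m @[m --> \oo] --> \sum_(i <- r) l i.
Proof.
move=> fl; elim: r => [|i r IH].
  by rewrite big_nil; under eq_fun do rewrite big_nil; exact: cvg_cst.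
by rewrite big_cons; under eq_fun do rewrite big_cons; exact: cvgD.
Qed.

Lemma cvg_sqr (R : realType) (f : nat -> R) (l : R) :
  f m @[m --> \oo] --> l -> f m ^+ 2 @[m --> \oo] --> l ^+ 2.
Proof. by move=> fl; under eq_fun do rewrite expr2; exact: cvgM. Qed.

Section kernel_continuity.
Variables (R : realType) (n : nat) (a : R).
Local Open Scope complex_scope.
Local Notation Cd := (n.+1.-tuple R[i]).
Local Notation B := (@unit_ball R n.+1).
Local Notation V := (@vol R n.+1).
Let mB := @measurable_unit_ball R n.+1.

(** The first term bounds |u|^(-a) when a < 0, by |u| <= 3; the second one when a >= 0, by |u| >=
    r. *)
Definition kbound (r : R) : R := 3 `^ `|a| + r `^ (- `|a|).

Lemma kbound_ge0 r : 0 <= kbound r.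
Proof. by rewrite addr_ge0 ?powR_ge0. Qed.

Lemma kabs_le_kbound z w r : B z -> B w -> 0 < r -> 2 * r <= 1 - nsq z ->
  kabs a z w <= kbound r.
Proof.
move=> zB wB r0 zr; rewrite /kabs /kbound.
have ru : r <= umod z w.
  have := ure_umod z w; have := ure_ge zB wB; rewrite gtr0_norm ?ure_gt0//; lra.
have [a0|a0] := leP 0 a.
  rewrite ger0_norm// ler_wpDl ?powR_ge0// !powRN lef_pV2 ?posrE ?powR_gt0 ?umod_gt0//.
  by apply: ge0_ler_powR; rewrite ?nnegrE ?umod_ge0 ?(ltW r0).
rewrite ltr0_norm// ler_wpDr ?powR_ge0//.
apply: ge0_ler_powR; rewrite ?nnegrE ?umod_ge0 ?oppr_ge0 ?(ltW a0)//.
exact: umod_le3.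
Qed.

Lemma kint_fin z : B z -> kint a z \is a fin_num.
Proof.
move=> zB; have z1 : 0 < (1 - nsq z) / 2 by move/unit_ballE: zB; lra.
rewrite ge0_fin_numE; last by apply: integral_ge0 => w _; rewrite lee_fin kabs_ge0.
apply: (@le_lt_trans _ _ ((kbound ((1 - nsq z) / 2))%:E)); last exact: ltry.
rewrite -[leRHS]mule1 -(vol_ball R n) -integral_cst//.
apply: ge0_le_integral => //.
- by move=> w _; rewrite lee_fin kabs_ge0.
- apply: measurable_funTS; apply/measurable_EFinP.
  exact: (measurable_section1 z (@measurable_kabs R n a)).
- by move=> w wB; rewrite lee_fin; apply: kabs_le_kbound => //; lra.
Qed.

(** Convergence in C^d is spelled out in coordinates, so that only limits of real sequences
    occur. *)
Definition cvg_coords (zs : nat -> Cd) (z : Cd) :=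
  forall j, (re (zs m) j @[m --> \oo] --> re z j) /\ (im (zs m) j @[m --> \oo] --> im z j).

Lemma cvg_ipre zs z w : cvg_coords zs z ->
  ipre (zs m) w @[m --> \oo] --> ipre z w.
Proof.
move=> cz; apply: cvg_sumr => j; have [cr ci] := cz j.
by apply: cvgD; apply: cvgM => //; exact: cvg_cst.
Qed.

Lemma cvg_ipim zs z w : cvg_coords zs z ->
  ipim (zs m) w @[m --> \oo] --> ipim z w.
Proof.
move=> cz; apply: cvg_sumr => j; have [cr ci] := cz j.
by apply: cvgB; apply: cvgM => //; exact: cvg_cst.
Qed.

Lemma cvg_nsq zs z : cvg_coords zs z -> nsq (zs m) @[m --> \oo] --> nsq z.
Proof.
move=> cz; apply: cvg_sumr => j; have [cr ci] := cz j.
by apply: cvgD; apply: cvg_sqr.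
Qed.

Lemma cvg_ker zs z w : cvg_coords zs z -> B z -> B w -> (forall m, B (zs m)) ->
  (complex.Re (ker a (zs m) w) @[m --> \oo] --> complex.Re (ker a z w)) /\
  (complex.Im (ker a (zs m) w) @[m --> \oo] --> complex.Im (ker a z w)).
Proof.
move=> cz zB wB zsB.
have cre : ure (zs m) w @[m --> \oo] --> ure z w.
  by apply: cvgB; [exact: cvg_cst|exact: cvg_ipre].
have cim : uim (zs m) w @[m --> \oo] --> uim z w.
  by apply: cvgN; exact: cvg_ipim.
have cmod : umod (zs m) w @[m --> \oo] --> umod z w.
  apply: (@continuous_cvg _ _ _ _ _ _ (@Num.sqrt R)); first exact: sqrt_continuous.
  by apply: cvgD; apply: cvg_sqr.
have ck : kabs a (zs m) w @[m --> \oo] --> kabs a z w.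
  have E y : B y -> kabs a y w = expR (- a * ln (umod y w)).
    by move=> yB; rewrite /kabs /powR gt_eqF// umod_gt0.
  rewrite E//; under eq_fun do rewrite E//.
  apply: (@continuous_cvg _ _ _ _ _ _ (@expR R)); first exact: continuous_expR.
  apply: cvgM; [exact: cvg_cst|]; apply: (@continuous_cvg _ _ _ _ _ _ (@ln R)) => //.
  by apply: continuous_ln; exact: umod_gt0.
have carg : a * uarg (zs m) w @[m --> \oo] --> a * uarg z w.
  apply: cvgM; [exact: cvg_cst|];
  apply: (@continuous_cvg _ _ _ _ _ _ (@atan R)); first exact: continuous_atan.
  by apply: cvgM => //; apply: cvgV => //; rewrite gt_eqF// ure_gt0.
rewrite kerE//; split; under eq_fun do rewrite kerE//=.
  by apply: cvgM => //; apply: (@continuous_cvg _ _ _ _ _ _ (@cos R)) => //; exact: continuous_cos.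
apply: cvgN.
by apply: cvgM => //; apply: (@continuous_cvg _ _ _ _ _ _ (@sin R)) => //; exact: continuous_sin.
Qed.

End kernel_continuity.

Lemma normcB_le (R : realType) (x y : R[i]) : normc (x - y) <=
  `|complex.Re x - complex.Re y| + `|complex.Im x - complex.Im y|.
Proof. by rewrite (le_trans (normc_le_ReIm _))// ReB ImB. Qed.

Lemma cvg_normcB (R : realType) (f : nat -> R[i]) (l : R[i]) :
  complex.Re (f m) @[m --> \oo] --> complex.Re l ->
  complex.Im (f m) @[m --> \oo] --> complex.Im l ->
  normc (f m - l) @[m --> \oo] --> (0 : R).
Proof.
move=> /cvgrPdist_lt fr /cvgrPdist_lt fi; apply/cvgrPdist_lt => e e0.
have e2 : 0 < e / 2 by lra.
near=> m; rewrite sub0r normrN ger0_norm ?normc_ge0// (le_lt_trans (normcB_le _ _))//.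
rewrite (splitr e) distrC [X in _ + X]distrC; apply: ltrD.
  by near: m; exact: fr.
by near: m; exact: fi.
Unshelve. all: by end_near. Qed.

Lemma norm_sum_le4 (R : realType) (x y c : R) : `|x| <= c -> `|y| <= c -> `|x| + `|y| <= 4 * c.
Proof. by move=> xc yc; have := le_trans (normr_ge0 _) xc; lra. Qed.

Lemma norm_dist_sum_le4 (R : realType) (x y x' y' c : R) : `|x| <= c -> `|y| <= c ->
  `|x'| <= c -> `|y'| <= c -> `|x - x'| + `|y - y'| <= 4 * c.
Proof. by have := ler_normB x x'; have := ler_normB y y'; lra. Qed.

Lemma cvg_normr_le (R : realType) (f : nat -> R) (l c : R) :
  f m @[m --> \oo] --> l -> (forall m, `|f m| <= c) -> `|l| <= c.
Proof.
move=> fl fc; rewrite leNgt; apply/negP => cl.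
move/cvgrPdist_lt : fl => /(_ (`|l| - c)) []; first by rewrite subr_gt0.
move=> N _ /(_ N (leqnn N)) /=.
by have := fc N; have := lerB_dist l (f N); lra.
Qed.

Lemma slack_le (R : realType) (M e : R) : 0 <= M -> 0 < e ->
  2 * M * (e / (4 * (M + 1))) <= e / 2.
Proof.
move=> M0 e0; rewrite (_ : 2 * M * _ = e / 2 * (M / (M + 1))); last by field; lra.
by rewrite ler_piMr ?ler_pdivrMr; lra.
Qed.

Lemma dist_lt_halves (R : realType) (l x y e c : R) :
  `|l - x| < e / 2 -> `|y - x| <= c -> c <= e / 2 -> `|l - y| < e.
Proof.
rewrite ltr_norml ler_norml => /andP[? ?] /andP[? ?] ?.
by rewrite ltr_norml; apply/andP; split; lra.
Qed.

Section compactness.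
Variables (R : realType) (n : nat) (a : R).
Local Open Scope complex_scope.
Local Notation Cd := (n.+1.-tuple R[i]).
Local Notation B := (@unit_ball R n.+1).
Local Notation V := (@vol R n.+1).
Let mB := @measurable_unit_ball R n.+1.

Variable k : Cd -> Cd -> R[i].
Hypothesis dk : dominated a k.
Hypothesis ck : forall zs z w, cvg_coords zs z -> B z -> B w -> (forall m, B (zs m)) ->
  (complex.Re (k (zs m) w) @[m --> \oo] --> complex.Re (k z w)) /\
  (complex.Im (k (zs m) w) @[m --> \oo] --> complex.Im (k z w)).

(** The index type is countable, so that [pickle] enumerates these points for the diagonal
    extraction. *)
Definition rat_point (q : n.+1.-tuple (rat * rat)) : Cd :=
  [tuple ratr (tnth q j).1 +i* ratr (tnth q j).2 | j < n.+1].

Lemma rat_approx (x e : R) : 0 < e -> exists r : rat, `|ratr r - x| < e.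
Proof.
move=> e0; have [|r] := @rat_in_itvoo R (x - e) (x + e); first lra.
by rewrite in_itv/= -ltr_distl => ?; exists r.
Qed.

(** Besides convergence, a common distance from the sphere is recorded: it bounds the kernel
    uniformly along the sequence. *)
Lemma rat_point_approx (z : Cd) : B z -> exists qs : nat -> n.+1.-tuple (rat * rat),
  cvg_coords (rat_point \o qs) z /\
  exists2 r, 0 < r & 2 * r <= 1 - nsq z /\ forall m, 2 * r <= 1 - nsq (rat_point (qs m)).
Proof.
move=> zB; have z1 : nsq z < 1 by exact/unit_ballE.
have H m : exists q : n.+1.-tuple (rat * rat), forall j,
    `|re (rat_point q) j - re z j| < m.+1%:R^-1 /\ `|im (rat_point q) j - im z j| < m.+1%:R^-1.
  have m0 : (0 : R) < m.+1%:R^-1 by rewrite invr_gt0.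
  have /choice[f fE] : forall j, exists q : rat * rat,
      `|ratr q.1 - re z j| < m.+1%:R^-1 /\ `|ratr q.2 - im z j| < m.+1%:R^-1.
    move=> j; have [r1 h1] := rat_approx (re z j) m0.
    by have [r2 h2] := rat_approx (im z j) m0; exists (r1, r2).
  by exists [tuple f j | j < n.+1] => j; rewrite /re /im !tnth_mktuple /=.
have [qs qsP] := choice H.
have small (f : nat -> R) l : (forall m, `|f m - l| < m.+1%:R^-1) -> f m @[m --> \oo] --> l.
  move=> fl; apply/cvgrPdist_lt => e e0.
  near=> m; rewrite distrC (lt_trans (fl m))//.
  by near: m; exact: near_infty_natSinv_lt (PosNum e0).
have cqs : cvg_coords (rat_point \o qs) z.
  by move=> j; split; apply: small => m; have [] := qsP m j.
have := cvg_nsq cqs => /cvgrPdist_lt /(_ ((1 - nsq z) / 2)) [|N _ HN]; first lra.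
(* Dropping the first [N] terms leaves 1 - |q|^2 > (1 - |z|^2) / 2 for all the others. *)
exists (fun m => qs (m + N)%N); split.
  move=> j; have [cr ci] := cqs j; split.
    by rewrite -(cvg_shiftn N) in cr.
  by rewrite -(cvg_shiftn N) in ci.
exists ((1 - nsq z) / 4); first lra.
split=> [|m]; first lra.
have := HN (m + N)%N; rewrite /= leq_addl => /(_ isT).
by rewrite ltr_distl => /andP[? ?]; lra.
Unshelve. all: by end_near. Qed.

Lemma measurable_ker_slice z : B z ->
  measurable_fun B (fun w => complex.Re (k z w)) /\
  measurable_fun B (fun w => complex.Im (k z w)).
Proof.
move=> zB; have [mr mi _] := dk.
by split; [exact: (measurable_ball_slice zB mr)|exact: (measurable_ball_slice zB mi)].
Qed.

Lemma integral_dist_cvg0 (F : nat -> Cd -> R) (G : Cd -> R) (C : R) :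
  (forall m, measurable_fun B (F m)) -> measurable_fun B G ->
  (forall w, B w -> F m w @[m --> \oo] --> G w) ->
  (forall m w, B w -> `|F m w| <= C) -> (forall w, B w -> `|G w| <= C) ->
  (\int[V]_(w in B) (`|G w - F m w|%:E))%E @[m --> \oo] --> 0%E.
Proof.
move=> mF mG FG FC GC.
rewrite -(integral0 V B).
apply: (@dominated_cvg _ _ _ V B mB _ _ (fun=> (2 * C)%:E)) => //.
- move=> m; apply/measurable_EFinP; apply: measurableT_comp => //.
  exact: measurable_funB.
- move=> w wB; apply: cvg_EFin; first by apply: nearW.
  rewrite /comp /= -[X in _ --> X](normr0 R) -[X in `|X|](subrr (G w)).
  by apply: cvg_norm; apply: cvgB; [exact: cvg_cst|exact: FG].
- apply/integrableP; split; first exact: measurable_cst.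
  by rewrite integral_cst// vol_ball mule1 ltry.
- move=> m w wB; rewrite lee_fin normr_id (le_trans (ler_normB _ _))//.
  by have := FC m w wB; have := GC w wB; lra.
Qed.

(** The map z -> k(z, .) is continuous into L^1, by dominated convergence with the constant majorant
    [kbound a r]. *)
Lemma ker_approx z e : B z -> 0 < e -> exists q, [/\ B (rat_point q),
   (\int[V]_(w in B) (`|complex.Re (k z w) - complex.Re (k (rat_point q) w)|%:E) < e%:E)%E &
   (\int[V]_(w in B) (`|complex.Im (k z w) - complex.Im (k (rat_point q) w)|%:E) < e%:E)%E].
Proof.
move=> zB e0; have [qs [cq [r r0 [zr qr]]]] := rat_point_approx zB.
have qB m : B (rat_point (qs m)) by apply/unit_ballE; have := qr m; lra.
have [_ _ kk] := dk.
have bq m w : B w -> `|complex.Re (k (rat_point (qs m)) w)| <= kbound a r /\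
    `|complex.Im (k (rat_point (qs m)) w)| <= kbound a r.
  move=> wB; have := kabs_le_kbound a (qB m) wB r0 (qr m).
  by have [? ?] := kk _ _ (qB m) wB; split; lra.
have bz w : B w -> `|complex.Re (k z w)| <= kbound a r /\
    `|complex.Im (k z w)| <= kbound a r.
  move=> wB; have := kabs_le_kbound a zB wB r0 zr.
  by have [? ?] := kk _ _ zB wB; split; lra.
have cr := @integral_dist_cvg0 (fun m w => complex.Re (k (rat_point (qs m)) w))
  (fun w => complex.Re (k z w)) (kbound a r).
have ci := @integral_dist_cvg0 (fun m w => complex.Im (k (rat_point (qs m)) w))
  (fun w => complex.Im (k z w)) (kbound a r).
have {}cr : (\int[V]_(w in B) (`|complex.Re (k z w) -
    complex.Re (k (rat_point (qs m)) w)|%:E))%E @[m --> \oo] --> 0%E.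
  apply: cr => [m||w wB|m w wB|w wB].
  - by have [] := measurable_ker_slice (qB m).
  - by have [] := measurable_ker_slice zB.
  - by have [] := @ck _ z w cq zB wB qB.
  - by have [] := bq m w wB.
  - by have [] := bz w wB.
have {}ci : (\int[V]_(w in B) (`|complex.Im (k z w) -
    complex.Im (k (rat_point (qs m)) w)|%:E))%E @[m --> \oo] --> 0%E.
  apply: ci => [m||w wB|m w wB|w wB].
  - by have [] := measurable_ker_slice (qB m).
  - by have [] := measurable_ker_slice zB.
  - by have [] := @ck _ z w cq zB wB qB.
  - by have [] := bq m w wB.
  - by have [] := bz w wB.
have near_lt (f : nat -> \bar R) : f m @[m --> \oo] --> 0%E -> \forall m \near \oo, (f m < e%:E)%E.
  by move=> f0; apply: (f0 [set y | (y < e%:E)%E]); apply: open_ereal_lt'; rewrite lte_fin.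
near \oo => m; exists (qs m); split => //.
  by near: m; exact: near_lt.
by near: m; exact: near_lt.
Unshelve. all: by end_near. Qed.

(* [rot f] is -i f, so that the imaginary part of [op k f] is the real part of
   [op k (rot f)]. *)
Definition rot (f : Cd -> R[i]) (w : Cd) : R[i] := complex.Im (f w) +i* - complex.Re (f w).

Lemma Im_op_rot f z : complex.Im (op k f z) = complex.Re (op k (rot f) z).
Proof.
rewrite Im_op Re_op; apply: eq_Rintegral => w _; rewrite /opIm /opRe /=.
by ring.
Qed.

Lemma normc_rot f w : normc (rot f w) = normc (f w).
Proof. by rewrite !normc_ReIm /= sqrrN addrC. Qed.

Lemma measurable_rot f : measurable_fun B f -> measurable_fun B (rot f).
Proof.
move=> mf; apply: measurable_funC; first exact: measurable_Im_fun.
by apply: measurable_funN; exact: measurable_Re_fun.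
Qed.

Section bounded_function.
Variables (f : Cd -> R[i]) (N : R).
Hypotheses (mf : measurable_fun B f) (N0 : 0 <= N).
Hypothesis fN : {ae V, forall w, B w -> normc (f w) <= N}.

Lemma opRe_le z : B z ->
  {ae V, forall w, B w -> `|opRe k f (z, w)| <= (2 * N) * kabs a z w}.
Proof.
move=> zB; apply: filterS fN => w fNw wB; have {}fNw := fNw wB.
have [_ _ kk] := dk.
have [kr ki] := kk z w zB wB; rewrite /opRe /=.
rewrite (le_trans (ler_normB _ _))// !normrM.
have := ler_pM (normr_ge0 _) (normr_ge0 _) (le_trans (Re_normc _) fNw) kr.
have := ler_pM (normr_ge0 _) (normr_ge0 _) (le_trans (Im_normc _) fNw) ki.
by lra.
Qed.

Lemma integrable_opRe z : B z ->
  V.-integrable B (EFin \o (fun w => opRe k f (z, w))).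
Proof.
move=> zB; have mo := measurable_ball_slice zB (measurable_opRe dk mf).
apply/integrableP; split; first exact/measurable_EFinP.
have fk := kint_fin a zB.
apply: (@le_lt_trans _ _ ((2 * N)%:E * kint a z)%E); last first.
  by rewrite -(fineK fk) -EFinM ltry.
have mk : measurable_fun B (fun w => (kabs a z w)%:E).
  apply: measurable_funTS; apply/measurable_EFinP.
  exact: (measurable_section1 z (@measurable_kabs R n a)).
rewrite /kint -ge0_integralZl//; last 2 first.
- by move=> w _; rewrite lee_fin kabs_ge0.
- by rewrite lee_fin mulr_ge0.
apply: ae_ge0_le_integral => //.
- by apply: measurableT_comp => //; apply/measurable_EFinP.
- by move=> w _; rewrite mule_ge0 ?lee_fin ?kabs_ge0 ?mulr_ge0.
- exact: emeasurable_funM.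
- exact: opRe_le.
Qed.

(** Equicontinuity: the bound depends on [f] only through [N], hence is the same along a bounded
    sequence. *)
Lemma Re_op_close z q e : B z -> B q ->
  (\int[V]_(w in B) (`|complex.Re (k z w) - complex.Re (k q w)|%:E) < e%:E)%E ->
  (\int[V]_(w in B) (`|complex.Im (k z w) - complex.Im (k q w)|%:E) < e%:E)%E ->
  `|complex.Re (op k f z) - complex.Re (op k f q)| <= 2 * N * e.
Proof.
move=> zB qB er ei; rewrite !Re_op -RintegralB//; [|exact: integrable_opRe..].
have mo y (yB : B y) := measurable_ball_slice yB (measurable_opRe dk mf).
have [mzr mzi] := measurable_ker_slice zB; have [mqr mqi] := measurable_ker_slice qB.
set g := fun w => _.
have mg : measurable_fun B g by apply: measurable_funB; exact: mo.
rewrite -lee_fin.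
apply: (@le_trans _ _ (`|\int[V]_(w in B) (g w)%:E|)%E).
  by rewrite /Rintegral; case: (integral _ _ _) => [r| |] /=; rewrite ?normr0 ?leey.
apply: (le_trans (le_abse_integral _ _ _)) => //; first exact/measurable_EFinP.
pose Dr w := (`|complex.Re (k z w) - complex.Re (k q w)|%:E)%E.
pose Di w := (`|complex.Im (k z w) - complex.Im (k q w)|%:E)%E.
have mDr : measurable_fun B Dr.
  apply/measurable_EFinP; apply: measurableT_comp => //; exact: measurable_funB.
have mDi : measurable_fun B Di.
  apply/measurable_EFinP; apply: measurableT_comp => //; exact: measurable_funB.
apply: (@le_trans _ _ (\int[V]_(w in B) (N%:E * (Dr w + Di w)))%E).
  apply: ae_ge0_le_integral => //.
  - by apply: measurableT_comp => //; apply/measurable_EFinP.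
  - by move=> w _; rewrite mule_ge0 ?adde_ge0 ?lee_fin.
  - by apply: emeasurable_funM => //; exact: emeasurable_funD.
  - apply: filterS fN => w fNw wB; have {}fNw := fNw wB.
    rewrite /Dr /Di -EFinD -EFinM lee_fin /g /opRe /=.
    rewrite (_ : _ - _ = complex.Re (f w) * (complex.Re (k z w) - complex.Re (k q w)) -
       complex.Im (f w) * (complex.Im (k z w) - complex.Im (k q w))); last by ring.
    rewrite (le_trans (ler_normB _ _))// !normrM mulrDr lerD//.
      by rewrite ler_wpM2r// (le_trans (Re_normc _)).
    by rewrite ler_wpM2r// (le_trans (Im_normc _)).
rewrite ge0_integralZl//; last 2 first.
- exact: emeasurable_funD.
- by move=> w _; rewrite adde_ge0 ?lee_fin.
rewrite ge0_integralD//.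
rewrite (_ : 2 * N * e = N * (e + e)); last by ring.
by rewrite EFinM EFinD; apply: lee_wpmul2l => //; apply: leeD; exact: ltW.
- by move=> w _; rewrite /Dr lee_fin.
- by move=> w _; rewrite /Di lee_fin.
Qed.

End bounded_function.

(** The Boolean selects the real or, through [rot], the imaginary part, so that a single extraction
    handles both. *)
Definition rotb (b : bool) (f : Cd -> R[i]) := if b then f else rot f.

Lemma cvg_op_subsequence (u : nat -> Cd -> R[i]) (M : R) : 0 <= M ->
  (forall m, measurable_fun B (u m)) ->
  (forall m, {ae V, forall w, B w -> normc (u m w) <= M}) ->
  exists phi : nat -> nat, {homo phi : m n / (m < n)%N} /\
    forall z b, B z -> cvgn (fun m => complex.Re (op k (rotb b (u (phi m))) z)).
Proof.
move=> M0 mu uM.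
have mru b m : measurable_fun B (rotb b (u m)).
  by case: b => //=; exact: measurable_rot.
have ruM b m : {ae V, forall w, B w -> normc (rotb b (u m) w) <= M}.
  case: b; first exact: uM.
  by apply: filterS (uM m) => w; rewrite /rotb normc_rot.
(* Codes that do not describe a rational point of the ball get the constant sequence 0, which keeps
   every row bounded. *)
pose x (i m : nat) : R := if unpickle i is Some (b, q) then
  if `[< B (rat_point q) >] then complex.Re (op k (rotb b (u m)) (rat_point q)) else 0
  else 0.
have [i|phi [hphi cphi]] := @diagonal_extraction R x.
  rewrite /x; case: unpickle => [[b q]|]; last by exists 0 => m; rewrite normr0.
  case: asboolP => [qB|]; last by exists 0 => m; rewrite normr0.
  exists (fine ((4 * M)%:E * kint a (rat_point q))%E) => m.
  have fk := kint_fin a qB.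
  rewrite -lee_fin fineK; last by rewrite fin_numM.
  apply: le_trans (op_le dk (mru b m) M0 qB (ruM b m)).
  by rewrite lee_fin Re_normc.
exists phi; split=> // z b zB.
apply/cauchy_cvgP; apply/cauchyP => e e0.
(* [M + 1] instead of [M], which may be 0. *)
have e'0 : 0 < e / (4 * (M + 1)) by rewrite divr_gt0// mulr_gt0// ltr_wpDl.
have [q [qB er ei]] := ker_approx zB e'0.
have /cvg_ex[l cl] := cphi (pickle (b, q)).
(* The Cauchy criterion only asks for some point within [e] of almost all terms; the limit at the
   nearby rational point qualifies, although it depends on [e]. *)
exists l; rewrite -ball_normE.
have {}cl : complex.Re (op k (rotb b (u (phi m))) (rat_point q)) @[m --> \oo] --> l.
  move: cl; rewrite (_ : x _ \o phi =
    fun m => complex.Re (op k (rotb b (u (phi m))) (rat_point q)))//.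
  by apply/funext => m; rewrite /x /= pickleK; case: asboolP.
suff : \forall m \near \oo, `|l - complex.Re (op k (rotb b (u (phi m))) z)| < e by [].
near=> m.
have h1 : `|l - complex.Re (op k (rotb b (u (phi m))) (rat_point q))| < e / 2.
  near: m; move/cvgrPdist_lt : cl; apply; first lra.
have h2 := Re_op_close (mru b (phi m)) M0 (ruM b (phi m)) zB qB er ei.
exact: (dist_lt_halves h1 h2 (slack_le M0 e0)).
Unshelve. all: by end_near. Qed.

Lemma op_compact : a < (n.+1 + 2)%:R -> compact_Lp +oo 1 (op k).
Proof.
move=> ha; have [C C0 HC] := kint_lty ha.
have [M1 HM1] := op_bounded ha dk.
split=> [f /HM1[]//|u M uM].
have M0 : 0 <= M.
  have [_ h] := uM 0%N; rewrite -lee_fin; apply: le_trans h; exact: Lnorm_ge0.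
have mu m : measurable_fun B (u m) by have [[]] := uM m.
have uN m : {ae V, forall w, B w -> normc (u m w) <= M}.
  by apply: ball_norm_pinfty_ae; have [] := uM m.
have [phi [hphi cphi]] := cvg_op_subsequence M0 mu uN.
pose T m z := op k (u (phi m)) z.
pose g z : R[i] := lim (complex.Re (T m z) @[m --> \oo]) +i* lim (complex.Im (T m z) @[m --> \oo]).
have mT m : measurable_fun B (T m) by exact: (measurable_op dk (mu (phi m))).
have cr z : B z -> complex.Re (T m z) @[m --> \oo] --> complex.Re (g z).
  by move=> zB; exact: (cphi z true zB).
have ci z : B z -> complex.Im (T m z) @[m --> \oo] --> complex.Im (g z).
  move=> zB; have := cphi z false zB; rewrite /rotb.
  by under eq_fun do rewrite -Im_op_rot.
have mg : measurable_fun B g.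
  apply: measurable_funC.
    by apply: (measurable_fun_cvg (h := fun m z => complex.Re (T m z))) cr => m;
       exact: measurable_Re_fun.
  by apply: (measurable_fun_cvg (h := fun m z => complex.Im (T m z))) ci => m;
     exact: measurable_Im_fun.
have Tle m z : B z -> ((normc (T m z))%:E <= (4 * M)%:E * kint a z)%E.
  by move=> zB; exact: op_le.
pose H (z : Cd) := fine ((4 * M)%:E * kint a z)%E.
have HE z : B z -> ((4 * M)%:E * kint a z)%E = (H z)%:E.
  by move=> zB; rewrite /H fineK// fin_numM// kint_fin.
have TH m z : B z -> normc (T m z) <= H z.
  by move=> zB; rewrite -lee_fin -HE//; exact: Tle.
have gr z : B z -> `|complex.Re (g z)| <= H z.
  move=> zB; apply: (cvg_normr_le (cr z zB)) => m.
  exact: (le_trans (Re_normc _) (TH m z zB)).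
have gi z : B z -> `|complex.Im (g z)| <= H z.
  move=> zB; apply: (cvg_normr_le (ci z zB)) => m.
  exact: (le_trans (Im_normc _) (TH m z zB)).
(* The real and imaginary parts of [T m] and of [g] are all at most [H], that is 4 M [kint]; so 4
   [H] dominates both |g| and |T m - g|. *)
have mk : measurable_fun B (fun z => (4%:E * ((4 * M)%:E * kint a z))%E).
  by do 2 apply: emeasurable_funM => //; exact: measurable_kint.
have k0 z : (0 <= kint a z)%E by apply: integral_ge0 => w _; rewrite lee_fin kabs_ge0.
have k40 z : (0 <= 4%:E * ((4 * M)%:E * kint a z))%E.
  by rewrite !mule_ge0 ?lee_fin ?mulr_ge0.
have ik : V.-integrable B (fun z => (4%:E * ((4 * M)%:E * kint a z))%E).
  apply/integrableP; split => //.
  under eq_integral do rewrite gee0_abs//.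
  rewrite ge0_integralZl//; last 2 first.
  - by apply: emeasurable_funM => //; exact: measurable_kint.
  - by move=> z _; rewrite mule_ge0 ?lee_fin ?mulr_ge0.
  rewrite ge0_integralZl//; last 2 first.
  - exact: measurable_kint.
  - by rewrite lee_fin mulr_ge0.
  apply: lte_mul_pinfty => //; apply: lte_mul_pinfty => //.
    by rewrite lee_fin mulr_ge0.
  by apply: le_lt_trans HC _; rewrite ltry.
exists phi, g; split=> //; split.
  split=> //; rewrite ball_norm1E.
  apply: (@le_lt_trans _ _ (\int[V]_(z in B) (4%:E * ((4 * M)%:E * kint a z)))%E); last first.
    move/integrableP : ik => [_]; under eq_integral do rewrite gee0_abs//.
    by [].
  apply: ge0_le_integral => //.
  - by move=> z _; rewrite lee_fin normc_ge0.
  - exact: measurable_ball_norm_fun.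
  - move=> z zB; rewrite HE// -EFinM lee_fin (le_trans (normc_le_ReIm _))//.
    exact: (norm_sum_le4 (gr z zB) (gi z zB)).
pose D m z := (normc (T m z - g z))%:E.
have mD m : measurable_fun B (D m).
  by apply/measurable_EFinP; apply: measurable_normc_fun; exact: measurable_funCB.
have mcst : measurable_fun B (cst 0%E : Cd -> \bar R) by exact: measurable_cst.
have Dcvg : {ae V, forall z, B z -> D m z @[m --> \oo] --> 0%E}.
  apply: nearW => z zB; apply: cvg_EFin; first by apply: nearW.
  exact: (cvg_normcB (cr z zB) (ci z zB)).
have Ddom : {ae V, forall z, forall m, B z -> (`|D m z| <= 4%:E * ((4 * M)%:E * kint a z))%E}.
  apply: nearW => z m zB; rewrite /D HE// -EFinM lee_fin ger0_norm ?normc_ge0//.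
  rewrite (le_trans (normcB_le _ _))//.
  have tr := le_trans (Re_normc (T m z)) (TH m z zB).
  have ti := le_trans (Im_normc (T m z)) (TH m z zB).
  exact: (norm_dist_sum_le4 tr ti (gr z zB) (gi z zB)).
have [_ _] := dominated_convergence mB mD mcst Dcvg ik Ddom.
rewrite integral0; apply: cvg_trans; apply: near_eq_cvg; apply: nearW => m.
by rewrite ball_norm1E.
Qed.

End compactness.

Lemma K_compact (R : realType) n (a : R) : a < (n.+1 + 2)%:R ->
  compact_Lp +oo 1 (@K R n.+1 a).
Proof. by move=> ha; apply: (op_compact (@dominated_ker R n a) (@cvg_ker R n a)). Qed.

(** * Unboundedness at the critical exponent *)

(** Expansion of a bilinear form at f + s g for a sign s: p and q are the diagonal terms, x and y
    the cross terms. *)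
Lemma sign_expand (R : realType) (p x y q s c c' : R) : s * s = 1 ->
  0 <= s * (x + y) -> c <= p -> c' <= q -> c + c' <= p + s * x + s * (y + s * q).
Proof.
move=> s2 sxy cp cq; rewrite (_ : _ + _ * (y + _) = p + s * (x + y) + s * s * q); last by ring.
by rewrite s2; lra.
Qed.

(** * The quadratic form of the kernel and the choice of signs *)

Section quadratic_form.
Variables (R : realType) (n : nat) (a : R).
Local Open Scope complex_scope.
Local Notation Cd := (n.+1.-tuple R[i]).
Local Notation B := (@unit_ball R n.+1).
Local Notation V := (@vol R n.+1).
Variable k : Cd -> Cd -> R[i].
Hypothesis dk : dominated a k.
Let mB := @measurable_unit_ball R n.+1.

Lemma umod_sym (z w : Cd) : umod z w = umod w z.
Proof.
have e1 : ipre z w = ipre w z by apply: eq_bigr => j _; ring.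
have e2 : ipim z w = - ipim w z by rewrite -sumrN; apply: eq_bigr => j _; ring.
by rewrite /umod /ure /uim e1 e2 sqrrN.
Qed.

Lemma integrable_bounded (g : Cd -> R) C : measurable_fun B g ->
  (forall w, B w -> `|g w| <= C) -> V.-integrable B (EFin \o g).
Proof.
move=> mg gC; apply/integrableP; split; first exact/measurable_EFinP.
apply: (@le_lt_trans _ _ (C%:E)); last exact: ltry.
rewrite -[leRHS]mule1 -(vol_ball R n) -integral_cst//.
by apply: ge0_le_integral => //; apply: measurableT_comp => //; exact/measurable_EFinP.
Qed.

Lemma integrable_scale (g : Cd -> R) s : V.-integrable B (EFin \o g) ->
  V.-integrable B (EFin \o (fun w => s * g w)).
Proof.
move=> ig; have := integrableZl mB s ig; congr (V.-integrable B _).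
Qed.

Lemma Rintegral_bounded (g : Cd -> R) C : measurable_fun B g ->
  (forall w, B w -> `|g w| <= C) -> `|\int[V]_(w in B) g w| <= C.
Proof.
move=> mg gC; have ig := integrable_bounded mg gC.
apply: (le_trans (le_normr_Rintegral mB ig)).
have -> : C = \int[V]_(w in B) C.
  by rewrite Rintegral_cst// vol_ball /= mulr1.
apply: le_Rintegral => //.
  apply: (integrable_bounded (C := C)); first exact: measurableT_comp.
  by move=> w wB; rewrite normr_id gC.
apply: (integrable_bounded (C := `|C|)); first exact: measurable_cst.
by [].
Qed.

(* The support of [f] stays away from the sphere, which makes the kernel bounded there. *)
Definition adm r (f : Cd -> R) := [/\ measurable_fun setT f,
  exists M : R, forall z, `|f z| <= M &
  forall z, f z != 0 -> B z /\ 2 * r <= 1 - nsq z].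

(** For real [f] this is the real part of [op k f], which is all that the lower bound uses. *)
Definition Tr (f : Cd -> R) z : R := \int[V]_(w in B) (f w * complex.Re (k z w)).

Definition Qb (f g : Cd -> R) : R := \int[V]_(z in B) (g z * Tr f z).

Lemma adm_le r r' f : r' <= r -> adm r f -> adm r' f.
Proof.
move=> rr [mf bf sf]; split=> // z /sf[zB zr]; split => //; lra.
Qed.

Section admissible.
Variables (r : R) (r0 : 0 < r).

Lemma Tr_slice f z : adm r f -> B z ->
  measurable_fun B (fun w => f w * complex.Re (k z w)) /\
  exists M, forall w, B w -> `|f w * complex.Re (k z w)| <= M * kbound a r.
Proof.
move=> [mf [M fM] sf] zB; have [mr _ kk] := dk; split.
  apply: measurable_funM; first exact: measurable_funTS.
  exact: (measurable_ball_slice zB mr).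
exists M => w wB; rewrite normrM; have M0 := le_trans (normr_ge0 _) (fM w).
have [->|/sf[_ wr]] := eqVneq (f w) 0.
  by rewrite normr0 mul0r mulr_ge0// kbound_ge0.
apply: ler_pM => //; have [kr _] := kk z w zB wB; apply: le_trans kr _.
(* The distance from the sphere is that of w, in the support of [f], and z is arbitrary; hence the
   exchange of the arguments. *)
by rewrite /kabs umod_sym; exact: kabs_le_kbound.
Qed.

Lemma measurable_Tr f : adm r f -> measurable_fun B (Tr f).
Proof.
move=> [mf _ _]; have [mr _ _] := dk.
apply: (measurable_Rintegral_ball (F := fun p => f p.2 * complex.Re (k p.1 p.2))).
apply: measurable_funM => //.
by apply: measurable_funB2; exact: measurable_funTS.
Qed.

Lemma Tr_bounded f : adm r f -> exists C, forall z, B z -> `|Tr f z| <= C.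
Proof.
move=> af; have [_ [M fM] sf] := af; have [_ _ kk] := dk.
exists (M * kbound a r) => z zB; have [mT _] := Tr_slice af zB.
apply: Rintegral_bounded => // w wB.
rewrite normrM; have M0 := le_trans (normr_ge0 _) (fM w).
have [->|/sf[_ wr]] := eqVneq (f w) 0.
  by rewrite normr0 mul0r mulr_ge0// kbound_ge0.
apply: ler_pM => //; have [kr _] := kk z w zB wB; apply: le_trans kr _.
by rewrite /kabs umod_sym; exact: kabs_le_kbound.
Qed.

Lemma integrable_Tr f z : adm r f -> B z ->
  V.-integrable B (EFin \o (fun w => f w * complex.Re (k z w))).
Proof.
move=> af zB; have [mT [M bT]] := Tr_slice af zB.
exact: integrable_bounded mT bT.
Qed.

Lemma integrable_Qb f g : adm r f -> adm r g ->
  V.-integrable B (EFin \o (fun z => g z * Tr f z)).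
Proof.
move=> af [mg [M gM] _]; have [C fC] := Tr_bounded af.
apply: (integrable_bounded (C := M * C)).
  by apply: measurable_funM; [exact: measurable_funTS|exact: measurable_Tr].
by move=> z zB; rewrite normrM; apply: ler_pM => //; exact: fC.
Qed.

Lemma adm_lin f g s : adm r f -> adm r g -> adm r (fun z => f z + s * g z).
Proof.
move=> [mf [M fM] sf] [mg [N gN] mesh]; split.
- by apply: measurable_funD => //; exact: measurable_funM.
- exists (M + `|s| * N) => z; rewrite (le_trans (ler_normD _ _))// normrM.
  by rewrite lerD// ler_wpM2l.
- move=> z; have [f0|/sf//] := eqVneq (f z) 0.
  have [g0|/mesh//] := eqVneq (g z) 0.
  by rewrite f0 g0 mulr0 addr0 eqxx.
Qed.

Lemma Tr_lin f g s z : adm r f -> adm r g -> B z ->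
  Tr (fun z => f z + s * g z) z = Tr f z + s * Tr g z.
Proof.
move=> af ag zB; rewrite /Tr -RintegralZl//; last exact: integrable_Tr.
rewrite -RintegralD//.
- by apply: eq_Rintegral => w _; ring.
- exact: integrable_Tr.
- rewrite (_ : _ \o _ = EFin \o (fun w => (s * g w) * complex.Re (k z w))); last first.
    by apply/funext => w /=; rewrite mulrA.
  apply: integrable_Tr => //.
  have := adm_lin s (_ : adm r (cst 0)) ag.
  under eq_fun do rewrite add0r.
  apply; split; first exact: measurable_cst.
    by exists 0 => w; rewrite normr0.
  by move=> w; rewrite eqxx.
Qed.

Lemma Qb_linl f g h s : adm r f -> adm r g -> adm r h ->
  Qb (fun z => f z + s * g z) h = Qb f h + s * Qb g h.
Proof.
move=> af ag ah; rewrite /Qb -RintegralZl//; last exact: integrable_Qb.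
rewrite -RintegralD//; [|exact: integrable_Qb|].
  apply: eq_Rintegral => z /[!inE] zB; rewrite Tr_lin//; ring.
by apply: integrable_scale; exact: integrable_Qb.
Qed.

Lemma Qb_linr f g h s : adm r f -> adm r g -> adm r h ->
  Qb h (fun z => f z + s * g z) = Qb h f + s * Qb h g.
Proof.
move=> af ag ah; rewrite /Qb -RintegralZl//; last exact: integrable_Qb.
rewrite -RintegralD//; [|exact: integrable_Qb|].
  by apply: eq_Rintegral => z _; ring.
by apply: integrable_scale; exact: integrable_Qb.
Qed.

End admissible.

(** The support is recorded so that functions on disjoint sets can be added, up to signs, without
    leaving [-1, 1]. *)
Definition achieves r (A : set Cd) (c : R) := exists f, [/\ adm r f,
  forall z, `|f z| <= 1, forall z, ~ A z -> f z = 0 & c <= Qb f f].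

Lemma achieves0 r : achieves r set0 0.
Proof.
exists (cst 0); split=> //.
- split; first exact: measurable_cst.
    by exists 0 => w; rewrite normr0.
  by move=> w; rewrite eqxx.
- by move=> z; rewrite normr0.
- rewrite /Qb; under eq_Rintegral do rewrite mul0r.
  by rewrite Rintegral_cst// mul0r.
Qed.

Lemma achieves_le r r' A c c' : r' <= r -> c' <= c -> achieves r A c -> achieves r' A c'.
Proof.
move=> rr cell_ratio [f [af f1 fA fc]]; exists f; split=> //; first exact: adm_le af.
exact: le_trans fc.
Qed.

(* The sign of the second summand is chosen so that the cross terms are nonnegative. *)
Lemma achievesU r A A' c c' : 0 < r -> A `&` A' = set0 ->
  achieves r A c -> achieves r A' c' -> achieves r (A `|` A') (c + c').
Proof.
move=> r0 AA [f [af f1 fA fc]] [g [ag g1 gA gc]].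
pose x := Qb f g + Qb g f.
pose s : R := if 0 <= x then 1 else -1.
have s2 : s * s = 1 by rewrite /s; case: ifP => _; ring.
have sx : 0 <= s * x.
  by rewrite /s; case: ifPn => [|]; rewrite ?mul1r// -ltNge mulN1r oppr_ge0 => /ltW.
exists (fun z => f z + s * g z); split.
- exact: adm_lin.
- move=> z; have [Az|/fA ->] := pselect (A z); last first.
    by rewrite add0r normrM /s; case: ifP; rewrite ?normrN normr1 mul1r.
  rewrite (gA z) ?mulr0 ?addr0// => A'z.
  by have : set0 z by rewrite -AA.
- move=> z /not_orP[/fA -> /gA ->]; ring.
- have afg := adm_lin s af ag.
  rewrite (Qb_linl r0)// !(Qb_linr r0)//.
  exact: sign_expand.
Qed.

Lemma achieves_bigcup r (I : eqType) (l : seq I) (A : I -> set Cd) (c : I -> R) : 0 < r ->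
  uniq l -> (forall i j, i \in l -> j \in l -> i != j -> A i `&` A j = set0) ->
  (forall i, i \in l -> achieves r (A i) (c i)) ->
  achieves r (\big[setU/set0]_(i <- l) A i) (\sum_(i <- l) c i).
Proof.
move=> r0; elim: l => [|i l IH] ul dA Ac; first by rewrite !big_nil; exact: achieves0.
rewrite !big_cons; move: ul => /= /andP[il ul].
apply: achievesU => //.
- rewrite big_distrr /=; apply: big1_seq => j /= jl.
  apply: dA; rewrite ?inE ?eqxx ?jl ?orbT//.
  by apply: contra il => /eqP ->.
- by apply: Ac; rewrite inE eqxx.
- apply: IH => // [j j' jl jl'|j jl].
    by apply: dA; rewrite inE ?jl ?jl' orbT.
  by apply: Ac; rewrite inE jl orbT.
Qed.

(** The indicator of [E] is the witness: its form is the integral of Re k over [E] x [E]. *)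
Lemma achieves_cell r (E : set Cd) m : 0 < r -> 0 <= m -> measurable E ->
  E `<=` B -> (forall z, E z -> 2 * r <= 1 - nsq z) ->
  (forall z w, E z -> E w -> m <= complex.Re (k z w)) ->
  achieves r E (m * fine (V E) ^+ 2).
Proof.
move=> r0 m0 mE EB Er Em; pose f : Cd -> R := \1_E.
have f1 z : E z -> f z = 1 by move=> zE; rewrite /f indicE mem_set.
have f0 z : ~ E z -> f z = 0 by move=> zE; rewrite /f indicE memNset.
have fb z : `|f z| <= 1.
  by have [/f1 ->|/f0 ->] := pselect (E z); rewrite ?normr1 ?normr0.
have af : adm r f.
  split; first exact: measurable_indic.
    by exists 1.
  move=> z fz; have zE : E z by apply: contrapT => /f0 fz0; rewrite fz0 eqxx in fz.
  by split; [exact: EB|exact: Er].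
have If : \int[V]_(z in B) f z = fine (V E).
  rewrite /Rintegral /f integral_indic//; congr (fine (V _)); exact: setIidl.
have intf : V.-integrable B (EFin \o f).
  by apply: (integrable_bounded (C := 1)) => //; apply: measurable_funTS; exact: measurable_indic.
exists f; split=> //.
have Tm z : E z -> m * fine (V E) <= Tr f z.
  move=> zE; have zB := EB z zE.
  rewrite -If -RintegralZl//; apply: le_Rintegral => //.
  - exact: integrable_scale.
  - exact: (integrable_Tr r0 af zB).
  - move=> w wB; have [wE|/f0 ->] := pselect (E w); last by rewrite mulr0 mul0r.
    by rewrite f1// mulr1 mul1r Em.
rewrite expr2 mulrA mulrC -{1}If -RintegralZr//.
apply: le_Rintegral => //.
- rewrite (_ : _ \o _ = EFin \o (fun z => m * fine (V E) * f z)).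
    exact: integrable_scale.
  by apply/funext => z /=; rewrite mulrC.
- exact: (integrable_Qb r0 af af).
- move=> z zB; have [zE|/f0 ->] := pselect (E z); last by rewrite !mul0r.
  by rewrite f1// !mul1r Tm.
Qed.

(** Duality of L^1 and L^oo: since |f| <= 1, the form at f is at most the L^1 norm of the image of
    f. *)
Lemma achieves_L1 r A c : 0 < r -> achieves r A c -> exists f : Cd -> R[i],
  [/\ measurable_fun B f, forall z, B z -> normc (f z) <= 1 &
      (c%:E <= ball_norm 1 (op k f))%E].
Proof.
move=> r0 [f [af f1 fA fc]]; have [mf _ _] := af.
pose F z : R[i] := (f z)%:C; exists F; split.
- by apply: measurable_funC => /=; [exact: measurable_funTS|exact: measurable_cst].
- by move=> z _; rewrite normc_ReIm /= expr0n addr0 sqrtr_sqr.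
have E z : complex.Re (op k F z) = Tr f z.
  by rewrite Re_op; apply: eq_Rintegral => w _; rewrite /opRe /= mul0r subr0.
have iQ := integrable_Qb r0 af af.
have mT := measurable_Tr af.
rewrite ball_norm1E.
apply: (@le_trans _ _ (\int[V]_(z in B) (`|f z * Tr f z|%:E))%E).
  apply: (@le_trans _ _ (Qb f f)%:E); first by rewrite lee_fin.
  apply: (@le_trans _ _ (`|\int[V]_(z in B) (f z * Tr f z)%:E|)%E).
    rewrite /Qb /Rintegral; case: (integral _ _ _) => [t| |] /=; rewrite ?lee_fin ?ler_norm ?leey//.
  apply: le_abse_integral => //; apply/measurable_EFinP; apply: measurable_funM => //.
  exact: measurable_funTS.
apply: ge0_le_integral => //.
- apply/measurable_EFinP; apply: measurableT_comp => //; apply: measurable_funM => //.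
  exact: measurable_funTS.
- apply: measurable_ball_norm_fun; apply: (measurable_op dk).
  by apply: measurable_funC => /=; [exact: measurable_funTS|exact: measurable_cst].
- move=> z zB; rewrite lee_fin normrM -E (le_trans _ (Re_normc _))// ler_piMl//.
Qed.

End quadratic_form.

(** Cauchy-Schwarz against the constant 1, from the nonnegative sum of the squares (|I| v_i -
    S)^2. *)
Lemma sum_sqr_le (R : realFieldType) (I : finType) (v : I -> R) :
  (\sum_i v i) ^+ 2 <= #|I|%:R * \sum_i v i ^+ 2.
Proof.
set S := \sum_i v i.
have [I0|I0] := posnP #|I|.
  rewrite I0 mul0r /S big1 ?expr0n// => i _.
  by have : i \in pred0 by rewrite -(card0_eq I0).
have N0 : 0 < #|I|%:R :> R by rewrite ltr0n.
have : 0 <= \sum_i (#|I|%:R * v i - S) ^+ 2 by apply: sumr_ge0 => i _; exact: sqr_ge0.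
rewrite (eq_bigr (fun i => #|I|%:R ^+ 2 * v i ^+ 2 - 2 * #|I|%:R * S * v i + S ^+ 2)); last first.
  by move=> i _; ring.
have cS : \sum_(i : I) S ^+ 2 = #|I|%:R * S ^+ 2 by rewrite sumr_const mulr_natl.
rewrite big_split sumrB /= cS -!mulr_sumr -/S.
rewrite (_ : _ + _ = #|I|%:R * (#|I|%:R * (\sum_i v i ^+ 2) - S ^+ 2)); last by ring.
by rewrite pmulr_rge0// subr_ge0.
Qed.

(** Half-open, so that the slots partition the nonnegative reals. *)
Definition slot (R : numDomainType) (m : nat) (y : R) := m%:R <= y < m.+1%:R.

Lemma slot_inj (R : numDomainType) m m' (y : R) : slot m y -> slot m' y -> m = m'.
Proof.
move=> /andP[h1 h2] /andP[h3 h4]; apply/eqP; rewrite eqn_leq.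
have := le_lt_trans h1 h4; have := le_lt_trans h3 h2.
by rewrite !ltr_nat !ltnS => -> ->.
Qed.

Lemma slot_dist (R : realDomainType) m (y y' : R) : slot m y -> slot m y' -> `|y - y'| <= 1.
Proof.
rewrite /slot -natr1 => /andP[h1 h2] /andP[h3 h4].
by rewrite ler_norml; apply/andP; split; lra.
Qed.

Lemma slot_truncn (R : realType) (y : R) : 0 <= y -> slot (Num.truncn y) y.
Proof. exact: truncn_itv. Qed.

(** * The cells of one level *)

Section level.
Variables (R : realType) (n : nat).
Local Open Scope complex_scope.
Local Notation Cd := (n.+1.-tuple R[i]).
Local Notation B := (@unit_ball R n.+1).
Local Notation V := (@vol R n.+1).
Let mB := @measurable_unit_ball R n.+1.

Local Notation J := ('I_n.+1 * bool)%type.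
Local Notation x0 := (ord0 : 'I_n.+1, true).

Definition coord (z : Cd) (x : J) : R := if x.2 then re z x.1 else im z x.1.

(* The mesh of a cell at level [s] is [cell_ratio * s], where [cell_ratio] is small
   enough for |Im u| <= eps Re u to hold inside a cell.  All coordinates but Re z_0 are
   cut into intervals of length [mesh]; on [cone_level] they determine Re z_0 up to
   O(mesh).  The slot of Re z_0 is used instead to cut Im <z, b> into intervals of
   length [mesh ^ 2], where [b] is a fixed point of the coarse cell. *)
Definition lip_const : R := 8 * n%:R + 8.
(** This constant and the next one sum over n + 1 coordinates, two terms each: products of a
    difference with a coordinate of modulus at most 1 here, squares of differences in
    [dsq_const]. *)
Definition ipim_const : R := 2 * n.+1%:R * lip_const.
Definition dsq_const : R := 2 * n.+1%:R * lip_const ^+ 2.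

Variables (eps : R) (eps0 : 0 < eps) (eps1 : eps <= 1).
(** Inside a cell |Im u| <= ([dsq_const] + 1) [mesh]^2 and Re u >= s^2 / 8, so [mesh] = [cell_ratio]
    s yields |Im u| <= eps Re u. *)
Definition cell_ratio : R := eps / (8 * (dsq_const + 1)).

Let n1 : 1 <= n.+1%:R :> R. Proof. by rewrite ler1n. Qed.
Let n0 : 0 <= n%:R :> R. Proof. by rewrite ler0n. Qed.
Let L8 : 8 <= lip_const. Proof. by rewrite /lip_const; have := n0; lra. Qed.
Let E1 : 1 <= ipim_const. Proof. by rewrite /ipim_const; have := n1; have := L8; nra. Qed.
Let D1 : 1 <= dsq_const. Proof. by rewrite /dsq_const; have := n1; have := L8; nra. Qed.

Lemma cell_ratio_gt0 : 0 < cell_ratio.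
Proof. by rewrite divr_gt0// mulr_gt0//; have := D1; lra. Qed.

Lemma cell_ratio_le : cell_ratio <= 1 / 16.
Proof.
rewrite /cell_ratio ler_pdivrMr; last by have := D1; lra.
by have := D1; have := eps1; lra.
Qed.

Lemma cell_ratio_eps : (dsq_const + 1) * cell_ratio ^+ 2 <= eps / 8.
Proof.
have : (dsq_const + 1) * cell_ratio = eps / 8 by rewrite /cell_ratio; field; have := D1; lra.
have c0 := cell_ratio_gt0; have c1 := cell_ratio_le; have := D1.
move=> d1 e; rewrite -e expr2 mulrA ler_piMr//; first by rewrite mulr_ge0//; lra.
by lra.
Qed.

Variables (s : R) (s0 : 0 < s) (sc : s <= cell_ratio).
Definition mesh : R := cell_ratio * s.
(** The factor 4 between the two bounds matches the halving of [s] from one level to the next and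
    makes the levels disjoint. *)
Definition cone_level : set Cd := shell (@cone R n) (s ^+ 2 / 4) (s ^+ 2).

Let s1 : s <= 1 / 16. Proof. exact: le_trans cell_ratio_le. Qed.
Let ssq : s ^+ 2 <= mesh. Proof. by rewrite expr2 ler_wpM2r// ltW. Qed.
Let sg0 : 0 < mesh. Proof. by rewrite mulr_gt0// cell_ratio_gt0. Qed.
Let sg1 : mesh <= 1.
Proof. by rewrite /mesh; have := cell_ratio_gt0; have := cell_ratio_le; have := s1; have := s0; nra. Qed.

Lemma cone_level_ball z : cone_level z -> B z.
Proof.
move=> [_ /= /andP[h _]]; apply/unit_ballE.
by have := sqr_ge0 s; lra.
Qed.

Lemma measurable_cone_level : measurable cone_level.
Proof. by apply: measurable_shell; exact: measurable_cone. Qed.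

Lemma coord_le1 z x : B z -> `|coord z x| <= 1.
Proof.
move=> /unit_ballE z1; case: x => j b.
have [] := sqr_le_near (le_trans (coord_nsq z j) (ltW z1)).
by rewrite sqrtr1 /coord; case: b.
Qed.

Lemma re0_ge z : cone_level z -> 1 / 4 <= re z ord0.
Proof.
move=> [[z0 zc] /= /andP[_ h]].
have s2 : s ^+ 2 <= 1 / 16 by have := s1; have := s0; nra.
rewrite leNgt; apply/negP => zl.
have : re z ord0 ^+ 2 <= 1 / 16 by nra.
by lra.
Qed.

Lemma sqr_dist_le (y y' t : R) : `|y| <= 1 -> `|y'| <= 1 -> `|y - y'| <= t ->
  `|y ^+ 2 - y' ^+ 2| <= 2 * t.
Proof.
move=> y1 y'1 yt; rewrite subr_sqr normrM mulrC; apply: ler_pM => //.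
by rewrite (le_trans (ler_normD _ _))//; lra.
Qed.

Definition close (z w : Cd) := forall x, x != x0 -> `|coord z x - coord w x| <= mesh.

(** On the shell |z|^2 varies by at most s^2 <= [mesh], and each of the 2n + 1 other squares by 2
    [mesh]; so (Re z_0)^2 varies by (4n + 3) [mesh]. The sum of the two values of Re z_0 is at least
    1/2 on the cone, which doubles the constant. *)
Lemma close_re0 z w : cone_level z -> cone_level w -> close z w ->
  `|re z ord0 - re w ord0| <= (8 * n%:R + 6) * mesh.
Proof.
move=> zS wS zw; have zB := cone_level_ball zS; have wB := cone_level_ball wS.
have zwn : `|nsq z - nsq w| <= s ^+ 2.
  move: zS wS => [_ /= /andP[? ?]] [_ /= /andP[? ?]]; have := sqr_ge0 s.
  by rewrite ler_norml => ?; apply/andP; split; lra.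
pose d (x : J) := coord z x ^+ 2 - coord w x ^+ 2.
have dle x : x != x0 -> `|d x| <= 2 * mesh.
  by move=> xx; apply: sqr_dist_le; rewrite ?coord_le1// zw.
have E : d x0 = nsq z - nsq w - d (ord0, false) -
    \sum_(j < n) (d (lift ord0 j, true) + d (lift ord0 j, false)).
  have -> : \sum_(j < n) (d (lift ord0 j, true) + d (lift ord0 j, false)) =
      \sum_(j < n) (re z (lift ord0 j) ^+ 2 + im z (lift ord0 j) ^+ 2) -
      \sum_(j < n) (re w (lift ord0 j) ^+ 2 + im w (lift ord0 j) ^+ 2).
    by rewrite -sumrB; apply: eq_bigr => j _; rewrite /d /coord /=; ring.
  by rewrite /nsq !big_ord_recl /d /coord /=; ring.
have h1 : `|d (ord0, false)| <= 2 * mesh by exact: dle.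
have h2 : `|\sum_(j < n) (d (lift ord0 j, true) + d (lift ord0 j, false))| <= n%:R * (4 * mesh).
  apply: (le_trans (ler_norm_sum _ _ _)).
  apply: (@le_trans _ _ (\sum_(j < n) (4 * mesh))).
    apply: ler_sum => j _; apply: (le_trans (ler_normD _ _)).
    have := @dle (lift ord0 j, true) isT; have := @dle (lift ord0 j, false) isT.
    by lra.
  by rewrite sumr_const card_ord -[leLHS]mulr_natl.
have h3 : `|d x0| <= (4 * n%:R + 3) * mesh.
  rewrite E; apply: (le_trans (ler_normB _ _)).
  apply: (le_trans (lerD (ler_normB _ _) (lexx _))).
  by have := ssq; lra.
move: h3; rewrite /d /coord /= subr_sqr normrM.
have zw2 : 1 / 2 <= re z ord0 + re w ord0 by have := re0_ge zS; have := re0_ge wS; lra.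
rewrite [X in _ * X]ger0_norm; last lra.
have := normr_ge0 (re z ord0 - re w ord0).
move: (`|_|) => t t0 h3.
have : t * (1 / 2) <= t * (re z ord0 + re w ord0) by rewrite ler_wpM2l.
by lra.
Qed.

Lemma close_coord z w x : cone_level z -> cone_level w -> close z w ->
  `|coord z x - coord w x| <= lip_const * mesh.
Proof.
move=> zS wS zw; have [->|xx] := eqVneq x x0.
  by apply: (le_trans (close_re0 zS wS zw)); rewrite ler_wpM2r ?(ltW sg0)// /lip_const; lra.
apply: (le_trans (zw x xx)); rewrite ler_peMl ?(ltW sg0)//.
by have := L8; lra.
Qed.

Lemma close_dsq z w : cone_level z -> cone_level w -> close z w ->
  dsq z w <= dsq_const * mesh ^+ 2.
Proof.
move=> zS wS zw; rewrite /dsq.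
apply: (@le_trans _ _ (\sum_(j < n.+1) 2 * (lip_const * mesh) ^+ 2)).
  apply: ler_sum => j _.
  have sq (y : R) : `|y| <= lip_const * mesh -> y ^+ 2 <= (lip_const * mesh) ^+ 2.
    move=> yl; rewrite -real_normK ?num_real// ler_pXn2r ?nnegrE//.
    exact: le_trans yl.
  have := sq _ (close_coord (j, true) zS wS zw).
  have := sq _ (close_coord (j, false) zS wS zw).
  by rewrite /coord /=; lra.
by rewrite sumr_const card_ord -[leLHS]mulr_natl /dsq_const le_eqVlt; apply/orP; left; apply/eqP; ring.
Qed.

(** Im <b, b> = 0, so only z - b contributes. This linear bound gives the range that the fine slots
    have to cover. *)
Lemma close_ipim z b : cone_level z -> cone_level b -> close z b ->
  `|ipim z b| <= ipim_const * mesh.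
Proof.
move=> zS bS zb; have bB := cone_level_ball bS.
have -> : ipim z b = \sum_(j < n.+1) ((im z j - im b j) * re b j - (re z j - re b j) * im b j).
  by apply: eq_bigr => j _; ring.
apply: (le_trans (ler_norm_sum _ _ _)).
apply: (@le_trans _ _ (\sum_(j < n.+1) (2 * (lip_const * mesh)))).
  apply: ler_sum => j _; apply: (le_trans (ler_normB _ _)); rewrite !normrM.
  have h1 := close_coord (j, true) zS bS zb; have h2 := close_coord (j, false) zS bS zb.
  have h3 := coord_le1 (j, true) bB; have h4 := coord_le1 (j, false) bB.
  rewrite /coord /= in h1 h2 h3 h4.
  have := ler_pM (normr_ge0 _) (normr_ge0 _) h1 h4.
  have := ler_pM (normr_ge0 _) (normr_ge0 _) h2 h3.
  by lra.
by rewrite sumr_const card_ord -[leLHS]mulr_natl /ipim_const le_eqVlt; apply/orP; left; apply/eqP; ring.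
Qed.

(** Im <z, w> = Im <z - b, w - b> + Im <z, b> - Im <w, b>. The first term is quadratic in the mesh,
    so it is enough to control the function Im <., b> of one variable, with [b] fixed. *)
Lemma close_uim z w b : cone_level z -> cone_level w -> cone_level b -> close z b -> close w b ->
  `|ipim z b - ipim w b| <= mesh ^+ 2 -> `|uim z w| <= (dsq_const + 1) * mesh ^+ 2.
Proof.
move=> zS wS bS zb wb zwb.
pose X := \sum_(j < n.+1) ((im z j - im b j) * (re w j - re b j) -
  (re z j - re b j) * (im w j - im b j)).
have E : ipim z w = X + (ipim z b - ipim w b).
  by rewrite /X /ipim -sumrB -big_split /=; apply: eq_bigr => j _; ring.
have Xle : `|X| <= dsq_const * mesh ^+ 2.
  apply: (@le_trans _ _ ((dsq z b + dsq w b) / 2)).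
    rewrite /X /dsq -big_split mulr_suml (le_trans (ler_norm_sum _ _ _))//=.
    apply: ler_sum => j _ /=.
    move: (im z j - im b j) (re z j - re b j) (im w j - im b j) (re w j - re b j) => p q p' q'.
    rewrite ler_norml; apply/andP.
    have := sqr_ge0 (p + q'); have := sqr_ge0 (p - q').
    have := sqr_ge0 (q + p'); have := sqr_ge0 (q - p').
    by rewrite !sqrrB !sqrrD; split; lra.
  by have := close_dsq zS bS zb; have := close_dsq wS bS wb; lra.
by rewrite /uim normrN E (le_trans (ler_normD _ _))//; lra.
Qed.

Lemma close_kernel z w b : cone_level z -> cone_level w -> cone_level b ->
  close z b -> close w b -> close z w ->
  `|ipim z b - ipim w b| <= mesh ^+ 2 ->
  `|uim z w| <= eps * ure z w /\ umod z w <= 3 * s ^+ 2.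
Proof.
move=> zS wS bS zb wb zw zwb.
have hi := close_uim zS wS bS zb wb zwb.
have h1 : (dsq_const + 1) * mesh ^+ 2 <= eps / 8 * s ^+ 2.
  by rewrite /mesh exprMn mulrA ler_wpM2r ?sqr_ge0// cell_ratio_eps.
have s2 := sqr_ge0 s.
have hu : s ^+ 2 / 8 <= ure z w.
  by apply: le_trans (ure_ge (cone_level_ball zS) (cone_level_ball wS));
  move: zS => [_ /= /andP[? ?]]; lra.
have hd := close_dsq zS wS zw.
have sg2 := sqr_ge0 mesh.
have hu2 : ure z w <= 2 * s ^+ 2.
  rewrite ureE; move: (zS) (wS) => [_ /= /andP[? ?]] [_ /= /andP[? ?]].
  have e8 : eps / 8 * s ^+ 2 <= 1 / 8 * s ^+ 2.
    by rewrite ler_wpM2r// ler_pM2r// eps1.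
  by lra.
have hui : `|uim z w| <= eps * ure z w.
  apply: (le_trans hi); apply: (le_trans h1); rewrite -mulrA ler_wpM2l ?(ltW eps0)//.
  by rewrite mulrC.
split=> //.
have hui2 : `|uim z w| <= 2 * s ^+ 2.
  apply: (le_trans hui); apply: le_trans hu2; rewrite ler_piMl//; lra.
have u0 : 0 <= ure z w by lra.
have p2 : 0 <= 2 * s ^+ 2 by lra.
have p3 : 0 <= 3 * s ^+ 2 by lra.
rewrite -(@ler_pXn2r _ 2) ?nnegrE ?umod_ge0// umod_sqr.
have h3 : ure z w ^+ 2 <= (2 * s ^+ 2) ^+ 2 by rewrite ler_pXn2r ?nnegrE.
have h4 : uim z w ^+ 2 <= (2 * s ^+ 2) ^+ 2.
  by rewrite -[uim z w ^+ 2]real_normK ?num_real// ler_pXn2r ?nnegrE.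
apply: (le_trans (lerD h3 h4)).
rewrite -subr_ge0 (_ : _ - _ = (s ^+ 2) ^+ 2); first exact: sqr_ge0.
by ring.
Qed.

Definition coarse (i : J -> nat) : set Cd :=
  cone_level `&` [set z | forall x, x != x0 -> slot (i x) ((coord z x + 1) / mesh)].

(** The choice depends on [i] only through the set [coarse i], hence not on the slot at [x0]; the
    origin is a dummy value for an empty set. *)
Definition rep (i : J -> nat) : Cd := xget [tuple 0 | _ < n.+1] (coarse i).

(** The shift makes the value nonnegative on the coarse cell, as slots require. The range of length
    O([mesh]) is cut into pieces of length [mesh]^2, so O(1 / [mesh]) slots suffice, as for the
    other coordinates. *)
Definition fine_arg (i : J -> nat) z : R := (ipim z (rep i) + ipim_const * mesh) / mesh ^+ 2.

Definition cell (i : J -> nat) : set Cd :=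
  coarse i `&` [set z | slot (i x0) (fine_arg i z)].

Lemma coarse_close i z w : coarse i z -> coarse i w -> close z w.
Proof.
move=> [_ zi] [_ wi] x xx; have := slot_dist (zi x xx) (wi x xx).
rewrite -mulrBl normrM (gtr0_norm (x := mesh^-1)) ?invr_gt0// ler_pdivrMr// mul1r.
by rewrite (_ : _ - _ = coord z x - coord w x); last by ring.
Qed.

Lemma coarse_rep i z : coarse i z -> coarse i (rep i).
Proof. by move=> zi; rewrite /rep; apply: xgetPex; exists z. Qed.

Lemma cell_kernel i z w : cell i z -> cell i w ->
  `|uim z w| <= eps * ure z w /\ umod z w <= 3 * s ^+ 2.
Proof.
move=> [zi fz] [wi fw]; have bi := coarse_rep zi.
have [zS _] := zi; have [wS _] := wi; have [bS _] := bi.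
apply: (close_kernel zS wS bS (coarse_close zi bi) (coarse_close wi bi) (coarse_close zi wi)).
have := slot_dist fz fw; rewrite /fine_arg -mulrBl normrM.
rewrite (gtr0_norm (x := (mesh ^+ 2)^-1)) ?invr_gt0 ?exprn_gt0//.
rewrite ler_pdivrMr ?exprn_gt0// mul1r => h.
have -> : ipim z (rep i) - ipim w (rep i) =
  ipim z (rep i) + ipim_const * mesh - (ipim w (rep i) + ipim_const * mesh) by ring.
exact: h.
Qed.

Lemma coarse_eq i i' : (forall x, x != x0 -> i x = i' x) -> coarse i = coarse i'.
Proof.
move=> ii; apply/seteqP; split => z [zS zi]; split=> // x xx.
  by rewrite -ii// zi.
by rewrite ii// zi.
Qed.

(** The point determines the coarse slots, these determine the representative, and the fine slot
    follows. *)
Lemma cell_inj i i' z : cell i z -> cell i' z -> i =1 i'.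
Proof.
move=> [zi fz] [zi' fz'].
have ii x : x != x0 -> i x = i' x.
  by move=> xx; apply: slot_inj (zi.2 x xx) (zi'.2 x xx).
move=> x; have [->|/ii//] := eqVneq x x0.
apply: slot_inj fz _; move: fz'.
by rewrite /slot /= /fine_arg /rep (coarse_eq ii).
Qed.

Lemma measurable_slot (g : Cd -> R) m : measurable_fun setT g ->
  measurable [set z | slot m (g z)].
Proof.
move=> mg; rewrite (_ : [set z | _] = g @^-1` `[m%:R, m.+1%:R[%classic).
  exact: (measurable_preimage mg (measurable_itv _)).
by apply/seteqP; split => z /=; rewrite in_itv.
Qed.

Lemma measurable_coord x : measurable_fun setT (fun z : Cd => coord z x).
Proof. by case: x => j []; [exact: measurable_re|exact: measurable_im]. Qed.

Lemma measurable_coarse i : measurable (coarse i).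
Proof.
apply: measurableI; first exact: measurable_cone_level.
rewrite (_ : [set z | _] = \bigcap_(x in [set x : J | x != x0])
    [set z | slot (i x) ((coord z x + 1) / mesh)]); last first.
  by apply/seteqP; split => z.
apply: fin_bigcap_measurable; first exact: finite_finset.
move=> x _; apply: measurable_slot; apply: measurable_funM => //.
by apply: measurable_funD => //; exact: measurable_coord.
Qed.

Lemma measurable_cell i : measurable (cell i).
Proof.
apply: measurableI; first exact: measurable_coarse.
apply: measurable_slot; apply: measurable_funM => //; apply: measurable_funD => //.
rewrite (_ : (fun z => _) = fun z => - ipim (rep i) z).
  by apply: measurable_funN; exact: (measurable_section1 (rep i) (@measurable_ipim R n.+1)).
by apply/funext => z; rewrite /ipim -sumrN; apply: eq_bigr => j _; ring.
Qed.

(** A common bound for all slots: coordinates range over an interval of length 2 <= 2 [ipim_const],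
    and the fine argument up to 2 [ipim_const] / [mesh]. *)
Definition mesh_size : nat := Num.truncn (2 * ipim_const / mesh).

Definition fcell (i : {ffun J -> 'I_mesh_size.+1}) : set Cd := cell (fun x => i x : nat).

Lemma cell_cover z : cone_level z -> exists i, fcell i z.
Proof.
move=> zS; have zB := cone_level_ball zS.
pose t x := Num.truncn ((coord z x + 1) / mesh).
have tN x : (t x <= mesh_size)%N.
  apply: le_truncn; rewrite ler_pM2r ?invr_gt0//.
  by have := coord_le1 x zB; rewrite ler_norml => /andP[_ ?]; have := E1; lra.
have t0 x : 0 <= (coord z x + 1) / mesh.
  rewrite divr_ge0 ?(ltW sg0)//.
  by have := coord_le1 x zB; rewrite ler_norml => /andP[? _]; lra.
have zt : coarse t z by split=> // x _; exact: slot_truncn.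
have bt := coarse_rep zt; have [bS _] := bt.
have := close_ipim zS bS (coarse_close zt bt); rewrite ler_norml => /andP[h1 h2].
pose m := Num.truncn (fine_arg t z).
have mN : (m <= mesh_size)%N.
  apply: le_truncn; rewrite /fine_arg expr2 invfM mulrA ler_pM2r ?invr_gt0//.
  by rewrite ler_pdivrMr//; lra.
pose i : {ffun J -> 'I_mesh_size.+1} := [ffun x => inord (if x == x0 then m else t x)].
have iE x : i x = (if x == x0 then m else t x) :> nat.
  by rewrite ffunE inordK// ltnS; case: ifP.
have ci : coarse (fun x => i x : nat) = coarse t.
  by apply: coarse_eq => x xx; rewrite iE (negPf xx).
exists i; split; first by rewrite ci.
rewrite /= iE eqxx /fine_arg /rep ci; apply: slot_truncn.
by rewrite divr_ge0 ?sqr_ge0//; rewrite /rep in h1; lra.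
Qed.

(** The summand 1 pays for rounding up, since [mesh] <= 1. *)
Definition count_const : R := (2 * ipim_const + 1) / cell_ratio.

Lemma count_const_gt0 : 0 < count_const.
Proof. by rewrite divr_gt0 ?cell_ratio_gt0//; have := E1; lra. Qed.

Lemma mesh_size_le : mesh_size.+1%:R <= count_const / s.
Proof.
have : mesh_size%:R <= 2 * ipim_const / mesh.
  by rewrite /mesh_size truncn_le divr_ge0 ?(ltW sg0)//; have := E1; lra.
have : 1 <= 1 / mesh by rewrite ler_pdivlMr// mul1r.
have -> : count_const / s = 2 * ipim_const / mesh + 1 / mesh.
  by rewrite /count_const /mesh; field; rewrite !gt_eqF// cell_ratio_gt0.
by rewrite -natr1; lra.
Qed.

Lemma fine_vol_fin (A : set Cd) : measurable A -> A `<=` B -> V A \is a fin_num.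
Proof.
move=> mA AB; rewrite ge0_fin_numE//; apply: (@le_lt_trans _ _ (V B)).
  by apply: le_measure; rewrite ?inE.
by rewrite vol_ball ltry.
Qed.

Lemma fcellB i : fcell i `<=` B.
Proof. by move=> z [[/cone_level_ball]]. Qed.

Lemma vol_bigsetU_le (I : Type) (l : seq I) (A : I -> set Cd) :
  (forall i, measurable (A i)) ->
  (V (\big[setU/set0]_(i <- l) A i) <= \sum_(i <- l) V (A i))%E.
Proof.
move=> mA; elim: l => [|i l IH]; first by rewrite !big_nil measure0.
rewrite !big_cons; apply: (@le_trans _ _ (V (A i) + V (\big[setU/set0]_(j <- l) A j))%E).
  by apply: measureU2 => //; exact: bigsetU_measurable.
by rewrite leeD2l.
Qed.

Lemma vol_cone_level_le : fine (V cone_level) <= \sum_i fine (V (fcell i)).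
Proof.
have mc i : measurable (fcell i) by exact: measurable_cell.
rewrite -lee_fin fineK; last by apply: fine_vol_fin;
  [exact: measurable_cone_level|exact: cone_level_ball].
rewrite -sumEFin.
rewrite (eq_bigr (fun i => V (fcell i))); last first.
  by move=> i _; rewrite fineK// fine_vol_fin//; exact: fcellB.
apply: le_trans (vol_bigsetU_le _ mc).
apply: le_measure; rewrite ?inE; first exact: measurable_cone_level.
  exact: bigsetU_measurable.
move=> z /cell_cover[i iz]; rewrite -bigcup_seq; exists i => //=.
by rewrite mem_index_enum.
Qed.

(* Cauchy-Schwarz over the O(s^(-2(n+1))) cells. *)
Lemma sum_cells_ge c1 : 0 <= c1 -> c1 * s ^+ 2 <= fine (V cone_level) ->
  c1 ^+ 2 * count_const ^- (2 * n.+1) * s ^+ (2 * (n.+1 + 2)) <= \sum_i fine (V (fcell i)) ^+ 2.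
Proof.
move=> c10 cV.
have P0 : 0 < count_const / s by rewrite divr_gt0// count_const_gt0.
have V0 : 0 <= c1 * s ^+ 2 by rewrite mulr_ge0// sqr_ge0.
have h1 : (c1 * s ^+ 2) ^+ 2 <= #|{ffun J -> 'I_mesh_size.+1}|%:R * \sum_i fine (V (fcell i)) ^+ 2.
  apply: le_trans (sum_sqr_le _); rewrite ler_pXn2r ?nnegrE//.
    exact: le_trans vol_cone_level_le.
  by apply: sumr_ge0 => i _; rewrite fine_ge0.
have h2 : #|{ffun J -> 'I_mesh_size.+1}|%:R <= (count_const / s) ^+ (2 * n.+1).
  rewrite card_ffun card_prod !card_ord card_bool natrX mulnC ler_pXn2r ?nnegrE ?(ltW P0)//.
  exact: mesh_size_le.
have h3 : (c1 * s ^+ 2) ^+ 2 <= (count_const / s) ^+ (2 * n.+1) * \sum_i fine (V (fcell i)) ^+ 2.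
  apply: (le_trans h1); rewrite ler_wpM2r//.
  by apply: sumr_ge0 => i _; rewrite sqr_ge0.
rewrite -(@ler_pM2l _ ((count_const / s) ^+ (2 * n.+1))) ?exprn_gt0//; apply: le_trans h3.
rewrite le_eqVlt; apply/orP; left; apply/eqP.
have Fn : count_const ^+ (2 * n.+1) != 0 by rewrite expf_neq0// gt_eqF// count_const_gt0.
have sn : s ^+ (2 * n.+1) != 0 by rewrite expf_neq0// gt_eqF.
rewrite expr_div_n mulnDr exprD; move: Fn sn.
move: (count_const ^+ _) (s ^+ (2 * n.+1)) => F P Fn sn.
by field; apply/andP.
Qed.

Variables (a : R) (k : Cd -> Cd -> R[i]).
Hypotheses (ha : (n.+1 + 2)%:R <= a) (dk : dominated a k).
Variables (c0 : R) (c00 : 0 < c0).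
Hypothesis kc0 : forall z w, B z -> B w -> `|uim z w| <= eps * ure z w ->
  c0 * kabs a z w <= complex.Re (k z w).

Lemma cell_Re i z w : fcell i z -> fcell i w ->
  c0 * 3 `^ (- a) * s ^- (2 * (n.+1 + 2)) <= complex.Re (k z w).
Proof.
move=> zi wi; have [hu hm] := cell_kernel zi wi.
have zB := fcellB zi; have wB := fcellB wi.
apply: le_trans (kc0 zB wB hu); rewrite -mulrA ler_pM2l// /kabs.
have u0 := umod_gt0 zB wB; have a0 : 0 <= a by rewrite (le_trans _ ha).
have s20 : 0 < s ^+ 2 by rewrite exprn_gt0.
apply: (@le_trans _ _ ((3 * s ^+ 2) `^ (- a))); last first.
  rewrite !(powRN _ a) lef_pV2 ?posrE ?powR_gt0 ?mulr_gt0//.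
  by apply: ge0_ler_powR; rewrite ?nnegrE ?(ltW u0)// mulr_ge0// ltW.
rewrite powRM ?(ltW s20)// ler_wpM2l ?powR_ge0// powRN.
rewrite exprM -powR_mulrn ?(ltW s20)// lef_pV2 ?posrE ?powR_gt0//.
(* The hypothesis on the exponent enters here: as s^2 <= 1 and a >= n + 3, (s^2)^a <=
   (s^2)^(n+3). *)
apply: ger_powR => //; rewrite s20 /=.
by have := s1; have := s0; nra.
Qed.

(** Independent of [s]: the factor s^(-2(n+3)) from the kernel cancels s^(2(n+3)) from the squared
    volumes of the cells. *)
Definition level_gain (c1 : R) : R :=
  c0 * 3 `^ (- a) * (c1 ^+ 2 * count_const ^- (2 * n.+1)).

Lemma achieves_level r c1 : 0 < r -> 2 * r <= s ^+ 2 / 4 -> 0 <= c1 ->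
  c1 * s ^+ 2 <= fine (V cone_level) -> achieves k r cone_level (level_gain c1).
Proof.
move=> r0 rs c10 cV.
pose m := c0 * 3 `^ (- a) * s ^- (2 * (n.+1 + 2)).
have m0 : 0 <= m.
  by rewrite /m !mulr_ge0 ?(ltW c00) ?powR_ge0// invr_ge0 exprn_ge0 ?(ltW s0).
have H : achieves k r (\big[setU/set0]_(i <- index_enum {ffun J -> 'I_mesh_size.+1}) fcell i)
    (\sum_(i <- index_enum {ffun J -> 'I_mesh_size.+1}) m * fine (V (fcell i)) ^+ 2).
  apply: (achieves_bigcup dk) => //; first exact: index_enum_uniq.
    move=> i j _ _ ij; apply/seteqP; split=> // z [zi zj].
    move/eqP: ij; apply; apply/ffunP => x; apply: val_inj.
    exact: (cell_inj zi zj).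
  move=> i _; apply: (achieves_cell dk) => //.
  - exact: measurable_cell.
  - exact: fcellB.
  - by move=> z [[[_ /= /andP[zs _]] _] _]; lra.
  - by move=> z w zi wi; exact: cell_Re zi wi.
have E : \big[setU/set0]_(i <- index_enum {ffun J -> 'I_mesh_size.+1}) fcell i = cone_level.
  apply/seteqP; split=> z; rewrite -bigcup_seq; first by move=> [i _ [[]]].
  by move=> /cell_cover[i iz]; exists i => //=; rewrite mem_index_enum.
rewrite -E; apply: achieves_le H => //.
rewrite -mulr_sumr; apply: le_trans (ler_wpM2l m0 (sum_cells_ge c10 cV)).
rewrite /m /level_gain le_eqVlt; apply/orP; left; apply/eqP.
have sn : s ^+ (2 * (n.+1 + 2)) != 0 by rewrite expf_neq0// gt_eqF.
have Fn : count_const ^+ (2 * n.+1) != 0 by rewrite expf_neq0// gt_eqF// count_const_gt0.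
move: sn Fn; move: (count_const ^+ _) (s ^+ _) => F P Pn Fn.
by field; apply/andP.
Qed.

Lemma level_gain_gt0 c1 : 0 < c1 -> 0 < level_gain c1.
Proof.
move=> c10; rewrite /level_gain !mulr_gt0 ?powR_gt0 ?exprn_gt0//.
by rewrite invr_gt0 exprn_gt0// count_const_gt0.
Qed.

End level.

(** * Combination of the levels *)

Section unboundedness.
Variables (R : realType) (n : nat) (a : R).
Local Open Scope complex_scope.
Local Notation Cd := (n.+1.-tuple R[i]).
Local Notation B := (@unit_ball R n.+1).
Local Notation V := (@vol R n.+1).
Variables (k : Cd -> Cd -> R[i]).
Hypotheses (ha : (n.+1 + 2)%:R <= a) (dk : dominated a k).
Variables (eps c0 : R) (eps0 : 0 < eps) (eps1 : eps <= 1) (c00 : 0 < c0).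
Hypothesis kc0 : forall z w, B z -> B w -> `|uim z w| <= eps * ure z w ->
  c0 * kabs a z w <= complex.Re (k z w).

Lemma achieves_unbounded m : exists r A, 0 < r /\ achieves k r A m%:R.
Proof.
have [c1 c10 Hc1] := vol_cone_shell R n.
have C0 := cell_ratio_gt0 n eps0; have C1 := cell_ratio_le n eps1.
pose g := level_gain n eps a c0 c1.
have g0 : 0 < g by exact: level_gain_gt0.
pose N := (Num.truncn (m%:R / g)).+1.
pose s (l : nat) : R := cell_ratio n eps * (1 / 2) ^+ l.
have s0 l : 0 < s l by rewrite mulr_gt0// exprn_gt0.
have sc l : s l <= cell_ratio n eps.
  by rewrite ler_piMr ?(ltW C0)// exprn_ile1//; lra.
have sle l l' : (l <= l')%N -> s l' <= s l.
  move=> ll; rewrite ler_pM2l// -(subnK ll) exprD ler_piMl ?exprn_ge0//.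
  by rewrite exprn_ile1//; lra.
have s_half l : s l.+1 = s l / 2 by rewrite /s exprS; field.
(* A common distance from the sphere for the levels l < N: 2 r = s_N^2 / 4 <= s_l^2 / 4. *)
pose r := s N ^+ 2 / 8.
have r0 : 0 < r by rewrite divr_gt0// exprn_gt0.
pose S l : set Cd := cone_level (s l).
have H : achieves k r (\big[setU/set0]_(l <- iota 0 N) S l) (\sum_(l <- iota 0 N) g).
  apply: (achieves_bigcup dk) => //; first exact: iota_uniq.
    have lt_disj l l' : (l < l')%N -> S l `&` S l' = set0.
      move=> ll; apply/seteqP; split=> // z [[_ /= /andP[h1 _]] [_ /= /andP[_ h2]]].
      have : s l' ^+ 2 <= s l ^+ 2 / 4.
        rewrite (_ : _ / 4 = (s l / 2) ^+ 2); last by field.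
        by rewrite ler_pXn2r ?nnegrE ?(ltW (s0 _)) -?s_half ?(ltW (s0 _))// sle.
      by lra.
    move=> i j _ _; case: (ltngtP i j) => // h _; first exact: lt_disj.
    by rewrite setIC; exact: lt_disj.
  move=> l; rewrite mem_iota add0n => /andP[_ lN].
  apply: (achieves_level eps0 eps1 (s0 l) (sc l) ha dk c00 kc0 r0 _ (ltW c10)).
    have : s N ^+ 2 <= s l ^+ 2 by rewrite ler_pXn2r ?nnegrE ?(ltW (s0 _))// sle// ltnW.
    by rewrite /r; lra.
  rewrite -lee_fin fineK; last first.
    by apply: fine_vol_fin;
  [exact: measurable_cone_level|exact: cone_level_ball].
  apply: Hc1; first by rewrite exprn_gt0.
  by have := s0 l; have := sc l; nra.
exists r, (\big[setU/set0]_(l <- iota 0 N) S l); split=> //.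
apply: achieves_le H => //.
rewrite big_const_seq count_predT size_iota iter_addr_0 -[leRHS]mulr_natl.
by rewrite -ler_pdivrMr// ltW// truncnS_gt.
Qed.

Lemma op_unbounded m : exists f : Cd -> R[i], [/\ measurable_fun B f,
  forall z, B z -> normc (f z) <= 1 & ((m%:R : R)%:E <= ball_norm 1 (op k f))%E].
Proof.
have [r [A [r0 H]]] := achieves_unbounded m.
exact: (achieves_L1 dk r0 H).
Qed.

End unboundedness.

(** * Necessity of alpha < d + 2 for arbitrary exponents *)

Section necessity.
Variables (R : realType) (n : nat) (a : R).
Local Open Scope complex_scope.
Local Notation Cd := (n.+1.-tuple R[i]).
Local Notation B := (@unit_ball R n.+1).
Local Notation V := (@vol R n.+1).

(* Positivity of the kernel near the diagonal, where 1 - <z, w> is almost a positive real. *)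
Definition coercive (k : Cd -> Cd -> R[i]) := exists eps c0 : R,
  [/\ 0 < eps, eps <= 1, 0 < c0 & forall z w, B z -> B w ->
    `|uim z w| <= eps * ure z w -> c0 * kabs a z w <= complex.Re (k z w)].

Lemma cos_atan_ge : exists eps : R, [/\ 0 < eps, eps <= 1 &
  forall t, `|t| <= eps -> 1 / 2 <= cos (a * atan t)].
Proof.
have c : (fun t => cos (a * atan t)) @ (0 : R) --> (1 : R).
  have <- : cos (a * atan 0) = 1 :> R by rewrite atan0 mulr0 cos0.
  apply: (@continuous_cvg _ _ _ _ _ _ (@cos R)); first exact: continuous_cos.
  by apply: cvgM; [exact: cvg_cst|exact: continuous_atan].
move/cvgrPdist_lt : c => /(_ (1 / 2)) []; first lra.
move=> e /= e0 He; exists (Num.min 1 (e / 2)); split.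
- by rewrite lt_min ltr01 divr_gt0.
- by rewrite ge_min lexx.
- move=> t; rewrite le_min => /andP[_ te].
  have t0e : `|0 - t| < e by rewrite sub0r normrN; lra.
  by have /= := He t t0e; rewrite ltr_norml => /andP[_ ?]; lra.
Qed.

(** The real part of the kernel is |u|^(-a) cos (a arg u), and the condition bounds the tangent of
    arg u by [eps]. *)
Lemma coercive_ker : coercive (ker a).
Proof.
have [e [e0 e1 He]] := cos_atan_ge; exists e, (1 / 2); split=> //.
move=> z w zB wB uu; rewrite kerE//= mulrC ler_wpM2l ?kabs_ge0//.
apply: He; rewrite normrM normfV (gtr0_norm (ure_gt0 zB wB)).
by rewrite ler_pdivrMr// ure_gt0.
Qed.

Lemma coercive_kerp : coercive (kerp a).
Proof.
exists 1, 1; split=> // z w zB wB _.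
by rewrite kerpE//= mul1r.
Qed.

Variable k : Cd -> Cd -> R[i].
Hypotheses (dk : dominated a k) (kk : coercive k).

Lemma unbounded_test : (n.+1 + 2)%:R <= a -> forall m, exists f : Cd -> R[i],
  (forall p, (1 <= p)%E -> in_Lp p f /\ (ball_norm p f <= 1)%E) /\
  ((m%:R : R)%:E <= ball_norm 1 (op k f))%E.
Proof.
move=> ha m; have [eps [c0 [e0 e1 c00 kc0]]] := kk.
have [f [mf f1 fm]] := op_unbounded ha dk e0 e1 c00 kc0 m.
exists f; split=> // p p1; have fp := ball_norm_le1 p1 mf f1.
by split=> //; split=> //; apply: (le_lt_trans fp); rewrite ltry.
Qed.

Lemma bounded_exponent p q : (1 <= p)%E -> (1 <= q)%E ->
  bounded_Lp p q (op k) -> a < (n.+1 + 2)%:R.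
Proof.
move=> p1 q1 [M HM]; rewrite ltNge; apply/negP => ha.
(* The constant in [bounded_Lp] may be negative. *)
pose M0 := Num.max M 0.
have M00 : 0 <= M0 by rewrite le_max lexx orbT.
have [M' M'0 HM'] := L1_le_of_Lq n q1 M00.
have [f [/(_ p p1)[fp fp1] fm]] := unbounded_test ha (Num.truncn M').+1.
have [[mT _] Tle] := HM f fp.
have : (ball_norm q (op k f) <= M0%:E)%E.
  apply: (le_trans Tle); apply: (@le_trans _ _ (M0%:E * ball_norm p f)%E).
    by apply: lee_wpmul2r; [exact: Lnorm_ge0|rewrite lee_fin le_max lexx].
  by rewrite -[leRHS]mule1; apply: lee_wpmul2l => //; rewrite lee_fin.
move=> /(HM' _ mT) /(le_trans fm); rewrite lee_fin leNgt => /negP; apply.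
exact: truncnS_gt.
Qed.

(** The images of the test functions have L^1 norm at least m at index m, whereas L^q convergence of
    a subsequence to [g] bounds their L^1 norms eventually. *)
Lemma compact_exponent p q : (1 <= p)%E -> (1 <= q)%E ->
  compact_Lp p q (op k) -> a < (n.+1 + 2)%:R.
Proof.
move=> p1 q1 [HT HC]; rewrite ltNge; apply/negP => ha.
have [u uP] := choice (unbounded_test ha).
have [|phi [g [hphi [[mg gfin] cg]]]] := HC u 1.
  by move=> m; have [/(_ p p1)] := uP m.
have gE : ball_norm q g = (fine (ball_norm q g))%:E.
  by rewrite fineK// ge0_fin_numE//; exact: Lnorm_ge0.
have gM0 : 0 <= fine (ball_norm q g) by rewrite fine_ge0//; exact: Lnorm_ge0.
have [N _ HN] : \forall m \near \oo, (ball_norm q (op k (u (phi m)) \- g)%R < 1%:E)%E.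
  by apply: (cg [set y | (y < 1%:E)%E]); apply: open_ereal_lt'; rewrite lte_fin.
have [M1 M10 H1] := L1_le_of_Lq n q1 (@ler01 R).
have [M2 M20 H2] := L1_le_of_Lq n q1 gM0.
(* Late enough for the distance to [g] to be below 1, and beyond the resulting bound [M1 + M2]; then
   phi m >= m gives the contradiction. *)
pose m := maxn N (Num.truncn (M1 + M2)).+1.
have mT : measurable_fun B (op k (u (phi m))).
  have [/(_ p p1)[fp _] _] := uP (phi m).
  by have [] := HT _ fp.
have mD : measurable_fun B (op k (u (phi m)) \- g) by exact: measurable_funCB.
have h1 : (ball_norm 1 (op k (u (phi m)) \- g)%R <= M1%:E)%E.
  by apply: H1 => //; apply: ltW; apply: HN; rewrite /= leq_maxl.
have h2 : (ball_norm 1 g <= M2%:E)%E by apply: H2 => //; rewrite -gE.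
have h3 : (ball_norm 1 (op k (u (phi m))) <=
    ball_norm 1 (op k (u (phi m)) \- g)%R + ball_norm 1 g)%E.
  rewrite !ball_norm1E -ge0_integralD//; last 5 first.
  - exact: measurable_unit_ball.
  - by move=> z _; rewrite lee_fin normc_ge0.
  - exact: measurable_ball_norm_fun.
  - by move=> z _; rewrite lee_fin normc_ge0.
  - exact: measurable_ball_norm_fun.
  apply: ge0_le_integral.
  - exact: measurable_unit_ball.
  - by move=> z _; rewrite lee_fin normc_ge0.
  - exact: measurable_ball_norm_fun.
  - by apply: emeasurable_funD; exact: measurable_ball_norm_fun.
  - move=> z _; rewrite -EFinD lee_fin.
    have := le_normcD (op k (u (phi m)) z - g z) (g z).
    by rewrite subrK.
have [_ um] := uP (phi m).
have : ((m%:R : R)%:E <= (M1 + M2)%:E)%E.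
  apply: (@le_trans _ _ (((phi m)%:R : R)%:E)).
    by rewrite lee_fin ler_nat strictly_increasing_ge.
  by apply: (le_trans um); apply: (le_trans h3); rewrite EFinD leeD.
rewrite lee_fin leNgt => /negP; apply.
apply: (lt_le_trans (truncnS_gt _)).
by rewrite ler_nat leq_maxr.
Qed.

End necessity.

Local Close Scope classical_set_scope.

Theorem theorem4 (R : realType) (d : nat) (hd : (1 <= d)%N) (alpha : R) :
  [<-> alpha < (d + 2)%:R;
       exists p q : \bar R,
         (1 <= p)%E /\ (1 <= q)%E /\ bounded_Lp p q (@K R d alpha);
       exists p q : \bar R,
         (1 <= p)%E /\ (1 <= q)%E /\ bounded_Lp p q (@Kplus R d alpha);
       exists p q : \bar R,
         (1 <= p)%E /\ (1 <= q)%E /\ compact_Lp p q (@K R d alpha)].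
Proof.
case: d hd => [//|n] _; rewrite K_op Kplus_op.
tfae.
- move=> ha; exists +oo%E, 1%E; split; first exact: leey.
  by split=> //; exact: (op_bounded ha (@dominated_ker R n alpha)).
(* Each remaining implication passes through alpha < d + 2, since the given exponents say nothing
   directly about another operator or property. *)
- move=> [p [q [p1 [q1 HK]]]].
  have ha := bounded_exponent (@dominated_ker R n alpha) (@coercive_ker R n alpha) p1 q1 HK.
  exists +oo%E, 1%E; split; first exact: leey.
  by split=> //; exact: (op_bounded ha (@dominated_kerp R n alpha)).
- move=> [p [q [p1 [q1 HK]]]].
  have ha := bounded_exponent (@dominated_kerp R n alpha) (@coercive_kerp R n alpha) p1 q1 HK.
  exists +oo%E, 1%E; split; first exact: leey.
  by split=> //; exact: K_compact.
- move=> [p [q [p1 [q1 HK]]]].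
  exact: (compact_exponent (@dominated_ker R n alpha) (@coercive_ker R n alpha) p1 q1 HK).
Qed.
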